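(* Let $\rho_1=\rho_2=0$ and $\beta>0$. Then the semigroup $(S(t))_{t\ge 0}$ generated by $\mathcal{A}$ on $\mathcal{H}$ is exponentially stable, i.e. there exist constants $C>0$ and $\alpha>0$ such that for every $U_0\in D(\mathcal{A})$, with $U(t):=S(t)U_0$ and $E(t):=\tfrac12\|U(t)\|_{\mathcal{H}}^2$ for $t\ge 0$, $$E(t)\le C e^{-\alpha t}E(0)\qquad\text{for all } t\ge 0.$$
   Context: Let $l_0<l_1<l_2<l_3$ be real numbers, $I_1=(l_0,l_1)$, $I_2=(l_1,l_2)$, $I_3=(l_2,l_3)$, and let $\rho_1,\rho_2,\beta\ge 0$ be constants. Function spaces are complex-valued; primes and $^{(k)}$ denote (weak) derivatives in $x$. Spaces: $H^2_{l_0}:=\{u\in H^2(I_1):u(l_0)=u'(l_0)=0\}$ with inner product $\langle u,\tilde u\rangle_{H^2_{l_0}}:=\langle u'',\tilde u''\rangle_{L^2(I_1)}$; $H^2_{l_3}:=\{w\in H^2(I_3):w(l_3)=w'(l_3)=0\}$ with $\langle w,\tilde w\rangle_{H^2_{l_3}}:=\langle w'',\tilde w''\rangle_{L^2(I_3)}$. $\mathbb{H}:=\{(u,v,w)\in H^2_{l_0}\times H^1(I_2)\times H^2_{l_3}: u(l_1)=v(l_1),\ v(l_2)=w(l_2)\}$ with inner product $\langle u,\tilde u\rangle_{H^2_{l_0}}+\langle v',\tilde v'\rangle_{L^2(I_2)}+\langle w,\tilde w\rangle_{H^2_{l_3}}$; $\mathbb{L}:=L^2(I_1)\times L^2(I_2)\times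 L^2(I_3)$ with the sum of the $L^2$ inner products. $\mathcal{H}:=\mathbb{H}\times\mathbb{L}$ with the sum inner product; it is a Hilbert space. Elements are written $U=(u_1,v_1,w_1,u_2,v_2,w_2)$ with $(u_1,v_1,w_1)\in\mathbb{H}$, $(u_2,v_2,w_2)\in\mathbb{L}$. Formal operator: $AU:=\big(u_2,\ v_2,\ w_2,\ -u_1^{(4)}+\rho_1u_2'',\ v_1''-\beta v_2,\ -w_1^{(4)}+\rho_2w_2''\big)$. For $U,\tilde U\in\mathbb{H}\times\mathbb{H}$ put $$a(U,\tilde U):=\langle u_2,\tilde u_1\rangle_{H^2_{l_0}}+\langle v_2',\tilde v_1'\rangle_{L^2(I_2)}+\langle w_2,\tilde w_1\rangle_{H^2_{l_3}}-\langle u_1'',\tilde u_2''\rangle_{L^2(I_1)}-\rho_1\langle u_2',\tilde u_2'\rangle_{L^2(I_1)}-\beta\langle v_2,\tilde v_2\rangle_{L^2(I_2)}-\langle v_1',\tilde v_2'\rangle_{L^2(I_2)}-\langle w_1'',\tilde w_2''\rangle_{L^2(I_3)}-\rho_2\langle w_2',\tilde w_2'\rangle_{L^2(I_3)}.$$ $U$ satisfies the transmission conditions in the weak sense if $\langle AU,\tilde U\rangle_{\mathcal{H}}=a(U,\tilde U)$ for all $\tilde U\in\mathbb{H}\times\mathbb{H}$. The operator $\mathcal{A}:D(\mathcal{A})\subset\mathcal{H}\to\mathcal{H}$ is $\mathcal{A}U:=AU$ with domain $D(\mathcal{A}):=\{U\in\mathbb{H}\times\mathbb{H}: u_1^{(4)}\in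 L^2(I_1),\ v_1''\in L^2(I_2),\ w_1^{(4)}\in L^2(I_3),\ U \text{ satisfies the transmission conditions in the weak sense}\}$. The operator $\mathcal{A}$ generates a $C_0$-semigroup of contractions on $\mathcal{H}$, denoted $(S(t))_{t\ge0}$. *)

(* Defs.v *)
From HB Require Import structures.
From mathcomp Require Import all_boot all_order all_algebra.
From mathcomp Require Import generic_quotient ring_quotient.
From mathcomp Require Import complex.
From mathcomp Require Import all_classical all_reals all_analysis.

Set Implicit Arguments.
Unset Strict Implicit.
Unset Printing Implicit Defensive.

Import Order.TTheory GRing.Theory Num.Theory.
Import numFieldNormedType.Exports.

Local Open Scope classical_set_scope.
Local Open Scope quotient_scope.
Local Open Scope complex_scope.
Local Open Scope ring_scope.

Local Notation Re := (@complex.Re _).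
Local Notation Im := (@complex.Im _).

Section L2.
Context {R : realType}.
Variables a b : R.
Local Notation mu := (@lebesgue_measure R).
Local Notation I := [set` `]a, b[].

(* Elements of L2 a b are classes of functions R -> R[i] for equality almost
   everywhere on ]a, b[; values outside ]a, b[ are irrelevant.
   R[i]^o is R[i] seen as a vector space over itself (R[i] alone would be
   taken as a vector space over R). *)
Definition L2pred : {pred R -> R[i]^o} := [pred f : R -> R[i]^o |
  ((Re \o f) \_ I \in Lfun mu 2%:E) && ((Im \o f) \_ I \in Lfun mu 2%:E)].

Let one_le2 : (1 <= 2%:E :> \bar R)%E.
Proof. by rewrite lee_fin ler1n. Qed.

Let L2R_comb (c d : R) (f g : R -> R) :
  f \in Lfun mu 2%:E -> g \in Lfun mu 2%:E -> c *: f + d *: g \in Lfun mu 2%:E.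
Proof.
move=> fL gL; have [_ L2lin] := Lfun_submod_closed mu one_le2.
rewrite L2lin//; rewrite -[_ *: _]addr0 L2lin//.
by have [] := Lfun_submod_closed mu one_le2.
Qed.

Lemma L2_submod_closed : submod_closed L2pred.
Proof.
have [zL _] := Lfun_submod_closed mu one_le2.
split.
  rewrite inE; apply/andP; split; rewrite (_ : _ \_ _ = 0)//;
  by apply/funext => x; rewrite patchE; case: ifP.
move=> c f g; rewrite !inE => /andP[Rf If] /andP[Rg Ig]; apply/andP; split.
- have -> : (Re \o (c *: f + g)) \_ I =
      1 *: (Re c *: (Re \o f) \_ I + (- Im c) *: (Im \o f) \_ I)
      + 1 *: (Re \o g) \_ I.
    apply/funext => x; rewrite !fctE /= !patchE; case: ifP => _ /=.
      rewrite !scale1r; case: c (f x) (g x) => [? ?] [? ?] [? ?] /=.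
      by rewrite /GRing.scale/= mulNr.
    by rewrite !scaler0 !addr0 scaler0.
  by apply: L2R_comb => //; apply: L2R_comb.
- have -> : (Im \o (c *: f + g)) \_ I =
      1 *: (Re c *: (Im \o f) \_ I + (Im c) *: (Re \o f) \_ I)
      + 1 *: (Im \o g) \_ I.
    apply/funext => x; rewrite !fctE /= !patchE; case: ifP => _ /=.
      by rewrite !scale1r; case: c (f x) (g x) => [? ?] [? ?] [? ?].
    by rewrite !scaler0 !addr0 scaler0.
  by apply: L2R_comb => //; apply: L2R_comb.
Qed.

HB.instance Definition _ :=
  GRing.isSubmodClosed.Build R[i] (R -> R[i]^o) L2pred L2_submod_closed.

Record L2fun := MkL2fun { L2val :> R -> R[i]^o; L2valP : L2val \in L2pred }.

HB.instance Definition _ := [isSub for L2val].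
HB.instance Definition _ := [Choice of L2fun by <:].
HB.instance Definition _ := [SubChoice_isSubLmodule of L2fun by <:].

Definition L2null : {pred L2fun} :=
  [pred f : L2fun | `[< {ae mu, forall x, I x -> f x = 0} >]].

Let ae_filter : Filter (almost_everywhere mu) := ae_filter_ringOfSetsType mu.

Lemma L2null_zmod_closed : zmod_closed L2null.
Proof.
split; first by rewrite inE; apply: (@aeW _ _ _ mu) => x _.
move=> f g; rewrite !inE => f0 g0.
apply: (@filterS2 _ _ ae_filter _ _ _ _ f0 g0) => x {}f0 {}g0 Ix.
by rewrite -[LHS]/(L2val f x - L2val g x) f0// g0// subr0.
Qed.

HB.instance Definition _ :=
  GRing.isZmodClosed.Build L2fun L2null L2null_zmod_closed.

Definition L2 : Type := Quotient.quot L2null.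
HB.instance Definition _ := GRing.Zmodule.on L2.
HB.instance Definition _ := EqQuotient.on L2.

Lemma L2_piP (f g : L2fun) :
  (\pi_L2 f = \pi_L2 g) <-> {ae mu, forall x, I x -> f x = g x}.
Proof.
have -> : (\pi_L2 f = \pi_L2 g) <-> f - g \in L2null.
  by rewrite (rwP eqP) Quotient.idealrBE.
rewrite inE; split=> h; apply: (@filterS _ _ ae_filter _ _ _ h) => x {}h Ix.
- by apply/eqP; rewrite -subr_eq0; apply/eqP; exact: h.
- by rewrite -[LHS]/(L2val f x - L2val g x) h// subrr.
Qed.

Definition L2scale (c : R[i]) (f : L2) : L2 := \pi_L2 (c *: repr f).

Let pi_scale c (f : L2fun) : L2scale c (\pi_L2 f) = \pi_L2 (c *: f).
Proof.
apply/L2_piP.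
have : \pi_L2 (repr (\pi_L2 f)) = \pi_L2 f by rewrite reprK.
move/L2_piP => h; apply: (@filterS _ _ ae_filter _ _ _ h) => x {}h Ix.
by rewrite -[LHS]/(c *: L2val _ x) -[RHS]/(c *: L2val _ x) h.
Qed.

Let piD (f g : L2fun) : \pi_L2 f + \pi_L2 g = \pi_L2 (f + g).
Proof. exact/esym/Quotient.pi_add. Qed.

Let L2scaleA c d (f : L2) : L2scale c (L2scale d f) = L2scale (c * d) f.
Proof.
by elim/quotW: f => f; rewrite (pi_scale d f) !(pi_scale _ _) scalerA.
Qed.

Let L2scale1 : left_id 1 L2scale.
Proof. by move=> f; rewrite -[f]reprK pi_scale scale1r. Qed.

Let L2scaleDr : right_distributive L2scale +%R.
Proof.
by move=> c f g; rewrite -[f]reprK -[g]reprK piD !pi_scale piD scalerDr.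
Qed.

Let L2scaleDl (f : L2) : {morph L2scale^~ f : c d / c + d}.
Proof. by move=> c d; rewrite -[f]reprK !pi_scale piD scalerDl. Qed.

HB.instance Definition _ := GRing.Zmodule_isLmodule.Build R[i] L2
  L2scaleA L2scale1 L2scaleDr L2scaleDl.

Definition L2_to_fun (f : L2) : R -> R[i] := repr f.

End L2.

Coercion L2_to_fun : L2 >-> Funclass.

Section Sobolev.
Context {R : realType}.
Local Notation mu := (@lebesgue_measure R).

Definition Cintegral (D : set R) (h : R -> R[i]) : R[i] :=
  (\int[mu]_(x in D) Re (h x))%R +i* (\int[mu]_(x in D) Im (h x))%R.

Definition L2dot (a b : R) (f g : L2 a b) : R[i] :=
  Cintegral [set` `]a, b[] (fun x => f x * (g x)^*).

(* Smooth real functions with compact support in ]a, b[; testing against the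
   real ones is equivalent to testing against the complex ones. *)
Definition test_function (a b : R) (phi : R -> R) : Prop :=
  (forall n x, derivable (derive1n n phi) x 1) /\
  exists c d, [/\ a < c, d < b & forall x, phi x != 0 -> c <= x <= d].

Definition is_wderiv (a b : R) (k : nat) (u g : L2 a b) : Prop :=
  forall phi, test_function a b phi ->
    Cintegral [set` `]a, b[] (fun x => u x * (derive1n k phi x)%:C) =
    (-1) ^+ k * Cintegral [set` `]a, b[] (fun x => g x * (phi x)%:C).

Definition has_wderiv (a b : R) (k : nat) (u : L2 a b) : Prop :=
  exists g, is_wderiv k u g.

(* The k-th weak derivative, 0 when there is none in L^2. *)
Definition wderiv (a b : R) (k : nat) (u : L2 a b) : L2 a b :=
  xget 0 [set g | is_wderiv k u g].

Definition sobolev (a b : R) (m : nat) : set (L2 a b) :=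
  [set u | forall k, (k <= m)%N -> has_wderiv k u].

(* The representative of u that is continuous up to the boundary (0 when there
   is none); it gives the point values of u on [a, b]. *)
Definition crepr (a b : R) (u : L2 a b) : R -> R[i] :=
  xget (fun=> 0) [set f : R -> R[i] |
    [/\ {within `[a, b], continuous (Re \o f)},
        {within `[a, b], continuous (Im \o f)} &
        {ae mu, forall x, `]a, b[%classic x -> f x = u x}]].

End Sobolev.

(* The space on which a semigroup acts is a linear subspace H of a complex
   vector space X, with norm N on H; values outside H are irrelevant. *)

Section Semigroup.
Context {R : realType} {X : lmodType R[i]}.
Variables (H : set X) (N : X -> R).

Record contraction_C0_semigroup (S : R -> X -> X) : Prop := {
  C0_stable : forall (t : R) x, 0 <= t -> H x -> H (S t x);
  C0_linear : forall (t : R) c x y, 0 <= t -> H x -> H y ->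
    S t (c *: x + y) = c *: S t x + S t y;
  C0_contraction : forall (t : R) x, 0 <= t -> H x -> N (S t x) <= N x;
  C0_zero : forall x, H x -> S 0 x = x;
  C0_add : forall (s t : R) x, 0 <= s -> 0 <= t -> H x -> S (s + t) x = S s (S t x);
  C0_continuous : forall x, H x -> N (S t x - x) @[t --> 0^'+] --> (0 : R)
}.

(* The graph of the generator of S. *)
Definition C0_generator (S : R -> X -> X) (x y : X) : Prop :=
  [/\ H x, H y & N ((t^-1)%:C *: (S t x - x) - y) @[t --> 0^'+] --> (0 : R)].

Definition generates (D : set X) (A : X -> X) (S : R -> X -> X) : Prop :=
  forall x y, C0_generator S x y <-> (D x /\ y = A x).

End Semigroup.

Section System.
Context {R : realType}.
Variables l0 l1 l2 l3 : R.

Definition LL : Type := (L2 l0 l1 * L2 l1 l2 * L2 l2 l3)%type.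
HB.instance Definition _ := GRing.Lmodule.on LL.

Definition LLdot (U V : LL) : R[i] :=
  let: (u, v, w) := U in let: (u', v', w') := V in
  L2dot u u' + L2dot v v' + L2dot w w'.

Definition H2_l0 : set (L2 l0 l1) :=
  [set u | [/\ sobolev 2 u, crepr u l0 = 0 & crepr (wderiv 1 u) l0 = 0]].

Definition H2_l3 : set (L2 l2 l3) :=
  [set w | [/\ sobolev 2 w, crepr w l3 = 0 & crepr (wderiv 1 w) l3 = 0]].

Definition H2dot (a b : R) (u u' : L2 a b) : R[i] :=
  L2dot (wderiv 2 u) (wderiv 2 u').

Definition HH : set LL :=
  [set U | let: (u, v, w) := U in
    [/\ H2_l0 u, sobolev 1 v, H2_l3 w, crepr u l1 = crepr v l1 &
        crepr v l2 = crepr w l2]].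

Definition HHdot (U V : LL) : R[i] :=
  let: (u, v, w) := U in let: (u', v', w') := V in
  H2dot u u' + L2dot (wderiv 1 v) (wderiv 1 v') + H2dot w w'.

(* A 6-tuple (u1, v1, w1, u2, v2, w2) is ((u1, v1, w1), (u2, v2, w2)). *)
Definition state : Type := (LL * LL)%type.
HB.instance Definition _ := GRing.Lmodule.on state.

Definition calH : set state := [set U | HH U.1].

Definition calHdot (U V : state) : R[i] := HHdot U.1 V.1 + LLdot U.2 V.2.

Definition calHnorm (U : state) : R := Num.sqrt (Re (calHdot U U)).

Section Operator.
Variables rho1 rho2 beta : R.

Definition opA (U : state) : state :=
  let: ((u1, v1, w1), (u2, v2, w2)) := U in
  ((u2, v2, w2),
   (- wderiv 4 u1 + rho1%:C *: wderiv 2 u2,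
    wderiv 2 v1 - beta%:C *: v2,
    - wderiv 4 w1 + rho2%:C *: wderiv 2 w2)).

Definition forma (U V : state) : R[i] :=
  let: ((u1, v1, w1), (u2, v2, w2)) := U in
  let: ((u1', v1', w1'), (u2', v2', w2')) := V in
  H2dot u2 u1' + L2dot (wderiv 1 v2) (wderiv 1 v1') + H2dot w2 w1'
  - L2dot (wderiv 2 u1) (wderiv 2 u2')
  - rho1%:C * L2dot (wderiv 1 u2) (wderiv 1 u2')
  - beta%:C * L2dot v2 v2'
  - L2dot (wderiv 1 v1) (wderiv 1 v2')
  - L2dot (wderiv 2 w1) (wderiv 2 w2')
  - rho2%:C * L2dot (wderiv 1 w2) (wderiv 1 w2').

Definition weak_transmission (U : state) : Prop :=
  forall V : state, HH V.1 -> HH V.2 -> calHdot (opA U) V = forma U V.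

Definition domA : set state :=
  [set U | [/\ HH U.1, HH U.2,
    (let: (u1, v1, w1) := U.1 in
      [/\ has_wderiv 4 u1, has_wderiv 2 v1 & has_wderiv 4 w1]) &
    weak_transmission U]].

End Operator.

Definition energy (S : R -> state -> state) (U0 : state) (t : R) : R :=
  2^-1 * calHnorm (S t U0) ^+ 2.

End System.

Arguments calH {R l0 l1 l2 l3} _.
Arguments calHnorm {R l0 l1 l2 l3} _.

(* Main.v *)
Require Import Defs.
From HB Require Import structures.
From mathcomp Require Import all_boot all_order all_algebra.
From mathcomp Require Import generic_quotient ring_quotient complex.
From mathcomp Require Import all_classical all_reals all_analysis.
From mathcomp Require Import measurable_realfun.
From mathcomp Require Import ring lra.

(** The two beams carry no damping, so their energy has to reach the string,
    where it is dissipated at the rate beta |v_t|^2. A Lyapunov form makes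
    this quantitative: a real bilinear form b on the energy space, with
    b(U, U) comparable to |U|^2 and

      b(A U, U) + b(U, A U) <= - kap b(U, U)   for U in the domain of A.

    Along orbits b(U, U) then decays like exp(- kap t) ([semigroup_decay]).

    The form b is a large multiple of the energy, whose growth rate is
    -2 beta |v_t|^2, plus a combination [lyapunov] of four multiplier terms,
    where u, v, w are the positions of beam, string and beam:

    - the integrals of u_t (x - l0) u_x and w_t (x - l3) w_x. Their growth rate
      is negative in the energy of the beams, up to the traces of v_x and v_t
      at the junctions l1 and l2 ([form_beams_le]);

    - the integral of v_t p v_x with p affine, from 1 to -1. It recovers these
      traces at the price of the integral of v_x^2 ([form_sweep_le]);

    - the integral of v_t (v - theta), where theta is affine with the end
      values of v. It recovers the integral of v_x^2, except for its mean part
      (v(l2) - v(l1))^2 / (l2 - l1) ([form_pinned_le]);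

    - c times the momentum along a fixed static deformation zeta, where zeta
      represents a multiple of v(l2) - v(l1) in the energy space, and c is the
      integral of s v_x with s vanishing at l1 and l2. Then c_t is controlled
      by v_t, and c is close to a multiple of v(l2) - v(l1), so this recovers
      the mean part ([form_zeta_le]).

    The lower order term that is usually removed by a compactness argument is
    thus controlled by the explicit profile zeta.

    The computations are done for real functions and applied to real and
    imaginary parts. They need classical traces: by the lemma of du
    Bois-Reymond ([weak_derivative_AC], [second_weak_derivative_AC]) a function
    with weak derivatives is a primitive, and products of primitives are
    integrated by Fubini ([AC_M]). The transmission conditions u'' = 0 and
    u''' = - v' at l1, and the same for w at l2, come from testing their weak
    form with cubics on the beams and affine functions on the string
    ([domA_regular]). *)

Set Implicit Arguments.
Unset Strict Implicit.
Unset Printing Implicit Defensive.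

Import Order.TTheory GRing.Theory Num.Theory.
Import numFieldNormedType.Exports.

Local Open Scope classical_set_scope.
Local Open Scope quotient_scope.
Local Open Scope complex_scope.
Local Open Scope ring_scope.

Local Notation Re := (@complex.Re _).
Local Notation Im := (@complex.Im _).

(** * Integration over an open interval *)

Section OpenIntervalIntegral.
Context {R : realType}.
Local Notation mu := (@lebesgue_measure R).
Implicit Types (a b c k x y : R) (f g h F G : R -> R).

Definition integrable_oo a b f : Prop := mu.-integrable `]a, b[ (EFin \o f).
Definition integral_oo a b f : R := (\int[mu]_(x in `]a, b[) f x)%R.
Definition measurable_oo a b f : Prop := measurable_fun (`]a, b[%classic : set R) f.
Definition ae_oo a b (P : R -> Prop) : Prop :=
  {ae mu, forall x, `]a, b[%classic x -> P x}.

Lemma ae_oo_filter : Filter (almost_everywhere mu).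
Proof. exact: ae_filter_ringOfSetsType. Qed.

Lemma ae_ooW a b (P : R -> Prop) : (forall x, a < x < b -> P x) -> ae_oo a b P.
Proof. by move=> h; apply: (@aeW _ _ _ mu) => x /= Ix; apply: h; move: Ix; rewrite in_itv. Qed.

Lemma ae_ooS a b (P Q : R -> Prop) : (forall x, a < x < b -> P x -> Q x) ->
  ae_oo a b P -> ae_oo a b Q.
Proof.
move=> PQ; rewrite /ae_oo; apply: (@filterS _ _ ae_oo_filter) => x h Ix.
by apply: PQ (h Ix); move: Ix; rewrite /= in_itv.
Qed.

Lemma ae_ooS2 a b (P Q S : R -> Prop) :
  (forall x, a < x < b -> P x -> Q x -> S x) ->
  ae_oo a b P -> ae_oo a b Q -> ae_oo a b S.
Proof.
move=> PQ; rewrite /ae_oo; apply: (@filterS2 _ _ ae_oo_filter) => x h h' Ix.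
by apply: PQ (h Ix) (h' Ix); move: Ix; rewrite /= in_itv.
Qed.

Lemma integrable_oo_measurable a b f : integrable_oo a b f -> measurable_oo a b f.
Proof. by move/(measurable_int mu)/measurable_EFinP. Qed.

Lemma integrable_oo0 a b : integrable_oo a b (fun=> 0).
Proof.
by rewrite /integrable_oo (_ : EFin \o _ = cst 0%E)//; exact: integrable0.
Qed.

Lemma integrable_ooD a b f g : integrable_oo a b f -> integrable_oo a b g ->
  integrable_oo a b (fun x => f x + g x).
Proof.
move=> hf hg; rewrite /integrable_oo (_ : _ \o _ = (EFin \o f) \+ (EFin \o g))%E//.
exact: integrableD.
Qed.

Lemma integrable_ooZ a b k f : integrable_oo a b f -> integrable_oo a b (fun x => k * f x).
Proof.
move=> hf; rewrite /integrable_oo (_ : _ \o _ = fun x => (k%:E * (EFin \o f) x)%E)//.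
exact: integrableZl.
Qed.

Lemma integrable_ooN a b f : integrable_oo a b f -> integrable_oo a b (fun x => - f x).
Proof.
move=> /(integrable_ooZ (-1)); rewrite /integrable_oo; congr (_.-integrable _ _).
by apply/funext => x /=; rewrite mulN1r.
Qed.

Lemma integrable_ooB a b f g : integrable_oo a b f -> integrable_oo a b g ->
  integrable_oo a b (fun x => f x - g x).
Proof. by move=> hf hg; apply: integrable_ooD => //; exact: integrable_ooN. Qed.

Lemma le_integrable_oo a b f g : measurable_oo a b f -> (forall x, a < x < b -> `|f x| <= g x) ->
  integrable_oo a b g -> integrable_oo a b f.
Proof.
move=> mf fg; apply: le_integrable => //.
  exact/measurable_EFinP.
move=> x /=; rewrite in_itv /= => xab; rewrite lee_fin (le_trans (fg _ xab))//.
exact: ler_norm.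
Qed.

Lemma integrable_oo_cst a b k : integrable_oo a b (fun=> k).
Proof.
apply: measurable_bounded_integrable => //.
  by rewrite /= lebesgue_measure_itv/=; case: ifP => // _; rewrite ltry.
by exists `|k|; split => // M kM x _ /=; exact: ltW.
Qed.

Lemma integrable_ooM a b k f g : integrable_oo a b f -> measurable_oo a b g ->
  (forall x, a < x < b -> `|g x| <= k) -> integrable_oo a b (fun x => f x * g x).
Proof.
move=> hf mg gk.
apply: (@le_integrable_oo _ _ _ (fun x => k * `|f x|)).
- by apply: measurable_funM => //; exact: integrable_oo_measurable.
- by move=> x xab; rewrite normrM mulrC ler_wpM2r// gk.
- apply: integrable_ooZ; rewrite /integrable_oo.
  by have := integrable_norm hf.
Qed.

Lemma integrable_ooS a b c d f : a <= c -> d <= b -> integrable_oo a b f -> integrable_oo c d f.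
Proof.
move=> ac db; apply: integrableS => // x /=; rewrite !in_itv/= => /andP[cx xd].
by rewrite (le_lt_trans ac)//= (lt_le_trans xd).
Qed.

Lemma integral_oo_ext a b f g : (forall x, a < x < b -> f x = g x) ->
  integral_oo a b f = integral_oo a b g.
Proof.
by move=> fg; apply: eq_Rintegral => x; rewrite inE/= in_itv/=; exact: fg.
Qed.

Lemma integrable_oo_ext a b f g : (forall x, a < x < b -> f x = g x) -> integrable_oo a b f ->
  integrable_oo a b g.
Proof.
by move=> fg; apply: eq_integrable => // x; rewrite inE/= in_itv/= => /fg ->.
Qed.

Lemma integral_ooD a b f g : integrable_oo a b f -> integrable_oo a b g ->
  integral_oo a b (fun x => f x + g x) = integral_oo a b f + integral_oo a b g.
Proof. by move=> hf hg; exact: RintegralD. Qed.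

Lemma integral_ooB a b f g : integrable_oo a b f -> integrable_oo a b g ->
  integral_oo a b (fun x => f x - g x) = integral_oo a b f - integral_oo a b g.
Proof. by move=> hf hg; exact: RintegralB. Qed.

Lemma integral_ooZ a b k f : integrable_oo a b f -> integral_oo a b (fun x => k * f x) =
  k * integral_oo a b f.
Proof. by move=> hf; exact: RintegralZl. Qed.

Lemma integral_ooN a b f : integrable_oo a b f -> integral_oo a b (fun x => - f x) = -
  integral_oo a b f.
Proof.
by move=> hf; rewrite -mulN1r -integral_ooZ//; apply: integral_oo_ext => x _; rewrite mulN1r.
Qed.

Lemma integral_oo0 a b : integral_oo a b (fun=> 0) = 0.
Proof. by rewrite /integral_oo /Rintegral integral0. Qed.

Lemma integral_oo_cst a b k : a <= b -> integral_oo a b (fun=> k) = k * (b - a).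
Proof.
move=> ab; rewrite /integral_oo Rintegral_cst//= lebesgue_measure_itv/= lte_fin.
by case: ltgtP ab => // -> _; rewrite subrr.
Qed.

Lemma integral_oo_ae a b f g : measurable_oo a b f -> measurable_oo a b g ->
  ae_oo a b (fun x => f x = g x) -> integral_oo a b f = integral_oo a b g.
Proof.
move=> mf mg fg; rewrite /integral_oo /Rintegral; congr fine.
apply: ae_eq_integral => //; [exact/measurable_EFinP..|].
by apply: (@filterS _ _ ae_oo_filter) fg => x h /h ->.
Qed.

Lemma integrable_oo_ae a b f g : integrable_oo a b f -> measurable_oo a b g ->
  ae_oo a b (fun x => f x = g x) -> integrable_oo a b g.
Proof.
move=> hf mg fg; apply/integrableP; split; first exact/measurable_EFinP.
case/integrableP: hf => mf; apply: le_lt_trans.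
rewrite (@ae_eq_integral _ _ _ mu _ (fun x => `|(EFin \o f) x|)%E)//.
- by apply: measurableT_comp => //; exact/measurable_EFinP.
- exact: measurableT_comp.
- by apply: (@filterS _ _ ae_oo_filter) fg => x h /h /= ->.
Qed.

Lemma integral_oo_ge0 a b f : (forall x, a < x < b -> 0 <= f x) -> 0 <= integral_oo a b f.
Proof. by move=> f0; apply: Rintegral_ge0 => x /=; rewrite in_itv; exact: f0. Qed.

Lemma le_integral_oo a b f g : integrable_oo a b f -> integrable_oo a b g ->
  (forall x, a < x < b -> f x <= g x) -> integral_oo a b f <= integral_oo a b g.
Proof.
by move=> hf hg fg; apply: le_Rintegral => // x /=; rewrite in_itv; exact: fg.
Qed.

Lemma integral_oo_point a f : integral_oo a a f = 0.
Proof. by rewrite /integral_oo set_itv_ge ?bnd_simp ?ltxx// Rintegral_set0. Qed.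

(** End points are null sets; closing the interval gives access to the
    continuity and differentiability of integrals with a variable bound, which
    are stated for closed intervals. *)
Lemma integrable_oo_oc a b f : integrable_oo a b f -> mu.-integrable `]a, b] (EFin \o f).
Proof.
move=> hf; have [ab|ba] := ltP a b; last first.
  by rewrite set_itv_ge ?bnd_simp -?leNgt//; exact: integrable_set0.
have e : `]a, b] `\` [set b] = `]a, b[%classic.
  apply/seteqP; split => x /=; rewrite !in_itv/=.
    by move=> [/andP[-> xb] /eqP nxb]; rewrite lt_neqAle nxb.
  by move=> /andP[-> xb]; rewrite (ltW xb); split=> // /eqP; rewrite lt_eqF.
apply/(@negligible_integrable _ _ _ mu _ [set b]) => //.
- rewrite -(setDUK (_ : [set b] `<=` `]a, b])); last first.
    by move=> x /= ->; rewrite in_itv/= ab lexx.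
  apply/measurable_funU => //; first exact: measurableD.
  split; first exact: measurable_fun_set1.
  by rewrite e; apply/measurable_EFinP; exact: integrable_oo_measurable hf.
- exact: lebesgue_measure_set1.
- by rewrite e.
Qed.

Lemma integrable_oo_cc a b f : integrable_oo a b f -> mu.-integrable `[a, b] (EFin \o f).
Proof.
move=> /integrable_oo_oc hf; have [ab|ba] := leP a b; last first.
  by rewrite set_itv_ge ?bnd_simp -?ltNge//; exact: integrable_set0.
have e : `[a, b] `\` [set a] = `]a, b]%classic.
  apply/seteqP; split => x /=; rewrite !in_itv/=.
    by move=> [/andP[xa ->] /eqP nxb]; rewrite lt_neqAle eq_sym nxb xa.
  by move=> /andP[xb ->]; rewrite (ltW xb); split=> // /eqP; rewrite gt_eqF.
apply/(@negligible_integrable _ _ _ mu _ [set a]) => //.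
- rewrite -(setDUK (_ : [set a] `<=` `[a, b])); last first.
    by move=> x /= ->; rewrite in_itv/= lexx ab.
  apply/measurable_funU => //; first exact: measurableD.
  split; first exact: measurable_fun_set1.
  by rewrite e; exact: measurable_int hf.
- exact: lebesgue_measure_set1.
- by rewrite e.
Qed.

Lemma integral_oo_cc a b f : integrable_oo a b f ->
  integral_oo a b f = (\int[mu]_(x in `[a, b]) f x)%R.
Proof.
move=> hf; rewrite /integral_oo -Rintegral_itv_obnd_cbnd; last exact: integrable_oo_oc.
by rewrite Rintegral_itv_bndo_bndc.
Qed.

Lemma integrable_cc_oo a b f : mu.-integrable `[a, b] (EFin \o f) -> integrable_oo a b f.
Proof. by apply: integrableS => //; exact: subset_itv_oo_cc. Qed.

Lemma integral_oo_split a b c f : a <= c <= b -> integrable_oo a b f ->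
  integral_oo a b f = integral_oo a c f + integral_oo c b f.
Proof.
move=> /andP[ac cb] hf.
have hac : integrable_oo a c f by apply: integrable_ooS hf.
have hcb : integrable_oo c b f by apply: integrable_ooS hf.
apply/eqP; rewrite addrC -subr_eq; apply/eqP.
rewrite (integral_oo_cc hf) (integral_oo_cc hac).
have := @Rintegral_itvB R f (BLeft a) (BRight b) c (integrable_oo_cc hf).
rewrite !bnd_simp => /(_ ac cb) ->.
by rewrite /integral_oo -Rintegral_itv_bndo_bndc// ; exact: hcb.
Qed.

End OpenIntervalIntegral.

(** * Absolutely continuous functions *)

Section AbsolutelyContinuous.
Context {R : realType}.
Local Notation mu := (@lebesgue_measure R).
Implicit Types (a b c k x y : R) (f g h F G : R -> R).

Lemma integral_ooE a b f (D : set R) : D = `]a, b[%classic -> integrable_oo a b f ->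
  (\int[mu]_(x in D) (f x)%:E = (integral_oo a b f)%:E)%E.
Proof.
move=> -> hf; rewrite /integral_oo /Rintegral fineK//.
exact: (integrable_fin_num _ hf).
Qed.

(** Fubini on the triangle t < s of the square with side ]a, b[. *)
Lemma integral_oo_triangle a b f g : integrable_oo a b f -> integrable_oo a b g ->
  integral_oo a b (fun s => f s * integral_oo a s g) =
    integral_oo a b (fun t => g t * integral_oo t b f).
Proof.
move=> hf hg.
pose I := `]a, b[%classic : set R.
pose Ff := f \_ I; pose Gg := g \_ I.
have iF : mu.-integrable setT (EFin \o Ff).
  have mI : measurable I by exact: measurable_itv.
  rewrite /Ff -restrict_EFin.
  by have [h _] := integrable_mkcond (mu := mu) (EFin \o f) mI; exact: h.
have iG : mu.-integrable setT (EFin \o Gg).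
  have mI : measurable I by exact: measurable_itv.
  rewrite /Gg -restrict_EFin.
  by have [h _] := integrable_mkcond (mu := mu) (EFin \o g) mI; exact: h.
have mF : measurable_fun setT Ff by move: iF => /(measurable_int mu)/measurable_EFinP.
have mG : measurable_fun setT Gg by move: iG => /(measurable_int mu)/measurable_EFinP.
pose K (z : R * R) : R := if z.2 < z.1 then Ff z.1 * Gg z.2 else 0.
have mK : measurable_fun setT K.
  apply: measurable_fun_ifT.
  - by apply: measurable_fun_ltr => //.
  - apply: measurable_funM; exact: measurableT_comp.
  - exact: measurable_cst.
have K1 s : (\int[mu]_t (K (s, t))%:E =
    (((fun s => f s * integral_oo a s g) \_ I) s)%:E)%E.
  rewrite patchE; case: ifPn => sI.
    have := sI; rewrite inE /I/= in_itv/= => /andP[sa sb].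
    have hgs : integrable_oo a s g by apply: integrable_ooS hg => //; exact: ltW.
    rewrite -integral_ooZ// -(integral_ooE (erefl _)); last exact: integrable_ooZ.
    rewrite [RHS]integral_mkcond; apply: eq_integral => t _.
    rewrite patchE mem_setE in_itv/= /K/=.
    case: (ltP t s) => [ts|_]; last by rewrite andbF.
    rewrite andbT /Ff patchE sI /Gg patchE mem_setE in_itv/=.
    rewrite (lt_trans ts sb) andbT.
    by case: ifPn => // _; rewrite mulr0.
  under eq_integral do rewrite /K /= /Ff patchE (negbTE sI) mul0r if_same.
  by rewrite integral0.
have K2 t : (\int[mu]_s (K (s, t))%:E =
    (((fun t => g t * integral_oo t b f) \_ I) t)%:E)%E.
  rewrite patchE; case: ifPn => tI.
    have := tI; rewrite inE /I/= in_itv/= => /andP[ta tb].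
    have hfs : integrable_oo t b f by apply: integrable_ooS hf => //; exact: ltW.
    rewrite -integral_ooZ// -(integral_ooE (erefl _)); last exact: integrable_ooZ.
    rewrite [RHS]integral_mkcond; apply: eq_integral => s _.
    rewrite patchE mem_setE in_itv/= /K/=.
    case: (ltP t s) => [ts|_] //=.
    rewrite /Gg patchE tI /Ff patchE mem_setE in_itv/=.
    rewrite (lt_trans ta ts) /=.
    by case: ifPn => _; rewrite ?mul0r// mulrC.
  under eq_integral do rewrite /K /= /Gg patchE (negbTE tI) mulr0 if_same.
  by rewrite integral0.
have iK : (mu \x mu)%E.-integrable setT (EFin \o K).
  apply/integrable12ltyP; first exact/measurable_EFinP.
  pose M := (\int[mu]_t `|(Gg t)%:E|)%E.
  have Mfin : (M < +oo)%E by case/integrableP: iG.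
  have M0 : (0 <= M)%E by apply: integral_ge0.
  apply: (@le_lt_trans _ _ (\int[mu]_s (M * `|(Ff s)%:E|))%E).
    apply: ge0_le_integral => //.
    - by move=> s _; exact: integral_ge0.
    - apply: (@measurable_fun_fubini_tonelli_F _ _ _ _ _ mu
        (fun z => `|(K z)%:E|%E)) => //.
      by apply: measurableT_comp => //; exact/measurable_EFinP.
    - apply: emeasurable_funM => //; apply: measurableT_comp => //.
      exact/measurable_EFinP.
    move=> s _; rewrite muleC -ge0_integralZl//; last first.
      by apply: measurableT_comp => //; exact/measurable_EFinP.
    apply: ge0_le_integral => //.
    - apply: measurableT_comp => //; apply/measurable_EFinP.
      exact: (measurableT_comp mK).
    - apply: emeasurable_funM => //; apply: measurableT_comp => //.
      exact/measurable_EFinP.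
    move=> t _; rewrite /K/=; case: ifPn => _.
      by rewrite normrM EFinM.
    by rewrite normr0 lee_fin mulr_ge0.
  rewrite ge0_integralZl//; last first.
    by apply: measurableT_comp => //; exact/measurable_EFinP.
  by rewrite lte_mul_pinfty ?ge0_fin_numE//; case/integrableP: iF.
rewrite /integral_oo /Rintegral; congr fine.
transitivity (\int[mu]_s \int[mu]_t (EFin \o K) (s, t))%E.
  rewrite integral_mkcond; apply: eq_integral => s _.
  by rewrite -[RHS]/(\int[mu]_t (K (s, t))%:E)%E K1 restrict_EFin.
rewrite (Fubini iK) [RHS]integral_mkcond; apply: eq_integral => t _.
by rewrite -[LHS]/(\int[mu]_s (K (s, t))%:E)%E K2 restrict_EFin.
Qed.

(** F is absolutely continuous on [a, b] with derivative f. The definition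
    through the integral makes f matter only up to null sets, so the same F
    may be used with any representative of its weak derivative. *)
Definition AC a b F f : Prop :=
  integrable_oo a b f /\ forall x, a <= x <= b -> F x = F a + integral_oo a x f.

Lemma AC_continuous a b F f : a <= b -> AC a b F f -> {within `[a, b], continuous F}.
Proof.
move=> ab [hf FE].
have hc := parameterized_integral_continuous ab (integrable_oo_cc hf).
have hc' : {within `[a, b], continuous (fun x => F a + (\int[mu]_(t in `[a, x]) f t)%R)}.
  by move=> x; apply: cvgD; [exact: cvg_cst|exact: hc].
move: hc'; apply: subspace_eq_continuous => x.
rewrite inE/= in_itv/= => /andP[ax xb]; rewrite /from_subspace (FE x) ?ax//.
by congr (_ + _); rewrite integral_oo_cc//; exact: integrable_ooS hf.
Qed.

Lemma continuous_bounded a b F : a <= b -> {within `[a, b], continuous F} ->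
  exists k, forall x, a <= x <= b -> `|F x| <= k.
Proof.
move=> ab cF.
have [c _ hc] := EVT_max ab cF; have [d _ hd] := EVT_min ab cF.
exists (`|F c| + `|F d|) => x xab.
have := hc x; have := hd x; rewrite in_itv/= => /(_ xab) h1 /(_ xab) h2.
rewrite ler_norml; apply/andP; split.
  rewrite (le_trans _ h1)// lerNl (le_trans (ler_norm _))// normrN.
  by rewrite lerDr.
by rewrite (le_trans h2)// (le_trans (ler_norm _))// lerDl.
Qed.

Lemma continuous_measurable_oo a b F : {within `[a, b], continuous F} -> measurable_oo a b F.
Proof.
move=> cF; apply: (@measurable_funS _ _ _ _ `[a, b]%classic) => //.
  exact: subset_itv_oo_cc.
exact: subspace_continuous_measurable_fun.
Qed.

Lemma AC_measurable a b F f : AC a b F f -> measurable_oo a b F.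
Proof.
have [ab|ba] := leP a b; last first.
  by move=> _; rewrite /measurable_oo set_itv_ge ?bnd_simp -?leNgt ?ltW//; exact: measurable_fun_set0.
by move=> h; apply: continuous_measurable_oo; exact: AC_continuous h.
Qed.

Lemma AC_bounded a b F f : AC a b F f ->
  exists2 k, 0 <= k & forall x, a <= x <= b -> `|F x| <= k.
Proof.
have [ab|ba] := leP a b; last first.
  by move=> _; exists 0 => // x /andP[ax xb]; have := le_trans ax xb; rewrite leNgt ba.
move=> h; have [k hk] := continuous_bounded ab (AC_continuous ab h); exists k => //.
by apply: le_trans (hk a _); rewrite ?lexx.
Qed.

Lemma AC_integrable a b F f : AC a b F f -> integrable_oo a b F.
Proof.
move=> h; have [k _ hk] := AC_bounded h.
apply: (@le_integrable_oo _ _ _ _ (fun=> k)); first exact: AC_measurable h.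
  by move=> x /andP[xa xb]; apply: hk; rewrite !ltW.
exact: integrable_oo_cst.
Qed.

Lemma AC_integrableM a b F f g : AC a b F f -> integrable_oo a b g ->
  integrable_oo a b (fun x => F x * g x).
Proof.
move=> h hg; have [k _ hk] := AC_bounded h.
apply: (@integrable_oo_ext _ _ _ (fun x => g x * F x)); first by move=> x _; rewrite mulrC.
apply: (@integrable_ooM _ _ _ k) => //; first exact: AC_measurable h.
by move=> x /andP[xa xb]; apply: hk; rewrite !ltW.
Qed.

Lemma ACS a b c d F f : a <= c -> c <= d -> d <= b -> AC a b F f -> AC c d F f.
Proof.
move=> ac cd db [hf FE]; split; first exact: integrable_ooS hf.
move=> x /andP[cx xd].
have xb := le_trans xd db.
rewrite (FE x) ?(le_trans ac cx) ?xb// (FE c) ?ac ?(le_trans cd)//.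
rewrite -addrA -integral_oo_split ?ac//; exact: integrable_ooS hf.
Qed.

Lemma AC_integral a b F f : a <= b -> AC a b F f -> integral_oo a b f = F b - F a.
Proof. by move=> ab [_ /(_ b)]; rewrite ab lexx => /(_ isT) ->; rewrite addrC addKr. Qed.

Lemma AC_primitive a b f k : integrable_oo a b f -> AC a b (fun x => k + integral_oo a x f) f.
Proof. by move=> hf; split => // x _; rewrite integral_oo_point addr0. Qed.

Lemma AC_ext a b F f G g : (forall x, a <= x <= b -> F x = G x) ->
  (forall x, a < x < b -> f x = g x) -> AC a b F f -> AC a b G g.
Proof.
move=> FG fg [hf FE]; split; first exact: integrable_oo_ext hf.
move=> x xab; have /andP[ax xb] := xab.
rewrite -!FG ?lexx ?(le_trans ax)// (FE _ xab); congr (_ + _).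
by apply: integral_oo_ext => y /andP[ay yx]; apply: fg; rewrite ay (lt_le_trans yx).
Qed.

Lemma AC_ae a b F f g : measurable_oo a b g -> ae_oo a b (fun x => f x = g x) ->
  AC a b F f -> AC a b F g.
Proof.
move=> mg fg [hf FE]; split; first exact: integrable_oo_ae fg.
move=> x xab; have /andP[ax xb] := xab.
rewrite (FE _ xab); congr (_ + _).
have sub : `]a, x[ `<=` (`]a, b[%classic : set R).
  move=> y /=; rewrite !in_itv/= => /andP[-> yx].
  by rewrite (lt_le_trans yx).
apply: integral_oo_ae.
- by apply: integrable_oo_measurable; exact: integrable_ooS hf.
- exact: (measurable_funS _ sub).
- rewrite /ae_oo in fg *; apply: (@filterS _ _ ae_oo_filter) fg => y h yx.
  by apply: h; exact: sub.
Qed.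

Lemma AC_cst a b k : AC a b (fun=> k) (fun=> 0).
Proof. by split; [exact: integrable_oo0|move=> x _; rewrite integral_oo0 addr0]. Qed.

Lemma AC_D a b F f G g : AC a b F f -> AC a b G g ->
  AC a b (fun x => F x + G x) (fun x => f x + g x).
Proof.
move=> [hf FE] [hg GE]; split; first exact: integrable_ooD.
move=> x xab; rewrite (FE _ xab) (GE _ xab); have /andP[ax xb] := xab.
by rewrite integral_ooD; [ring| exact: integrable_ooS hf|exact: integrable_ooS hg].
Qed.

Lemma AC_Z a b k F f : AC a b F f -> AC a b (fun x => k * F x) (fun x => k * f x).
Proof.
move=> [hf FE]; split; first exact: integrable_ooZ.
move=> x xab; rewrite (FE _ xab); have /andP[ax xb] := xab.
by rewrite integral_ooZ; [ring| exact: integrable_ooS hf].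
Qed.

(** The product rule when f and g are merely integrable: both sides are
    compared through the double integral of f(s) g(t), which splits along the
    diagonal into the two iterated integrals that appear. *)
Lemma AC_M a b F f G g : AC a b F f -> AC a b G g ->
  AC a b (fun x => F x * G x) (fun x => f x * G x + F x * g x).
Proof.
move=> hF hG; have [hf FE] := hF; have [hg GE] := hG.
have hfG : integrable_oo a b (fun x => f x * G x).
  by apply: (integrable_oo_ext _ (AC_integrableM hG hf)) => x _; rewrite mulrC.
have hFg := AC_integrableM hF hg.
split; first exact: integrable_ooD.
move=> x xab; have /andP[ax xb] := xab.
have {}hf : integrable_oo a x f by exact: integrable_ooS hf.
have {}hg : integrable_oo a x g by exact: integrable_ooS hg.
rewrite integral_ooD; [|exact: integrable_ooS hfG|exact: integrable_ooS hFg].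
have Ha : AC a x (fun s => integral_oo a s f) f.
  by split => // s _; rewrite integral_oo_point add0r.
have Hb : AC a x (fun s => integral_oo a s g) g.
  by split => // s _; rewrite integral_oo_point add0r.
have E1 : integral_oo a x (fun s => f s * G s) =
    G a * integral_oo a x f + integral_oo a x (fun s => f s * integral_oo a s g).
  rewrite -integral_ooZ// -integral_ooD.
  - apply: integral_oo_ext => s /andP[sa sx]; rewrite (GE s); first ring.
    by rewrite (ltW sa) (ltW (lt_le_trans sx xb)).
  - exact: integrable_ooZ.
  - by apply: (integrable_oo_ext _ (AC_integrableM Hb hf)) => s _; rewrite mulrC.
have E2 : integral_oo a x (fun s => F s * g s) =
    F a * integral_oo a x g + integral_oo a x (fun s => g s * integral_oo a s f).
  rewrite -integral_ooZ// -integral_ooD.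
  - apply: integral_oo_ext => s /andP[sa sx]; rewrite (FE s); first ring.
    by rewrite (ltW sa) (ltW (lt_le_trans sx xb)).
  - exact: integrable_ooZ.
  - by apply: (integrable_oo_ext _ (AC_integrableM Ha hg)) => s _; rewrite mulrC.
rewrite E1 E2 integral_oo_triangle//.
(* the integral over s > t is the whole integral minus the one over s < t, so
   that the two triangles cancel *)
have -> : integral_oo a x (fun t => g t * integral_oo t x f) =
    integral_oo a x f * integral_oo a x g - integral_oo a x (fun s => g s * integral_oo a s f).
  rewrite -integral_ooZ// -integral_ooB.
  - apply: integral_oo_ext => s /andP[sa sx].
    rewrite (@integral_oo_split _ a x s f) ?(ltW sa) ?(ltW sx)//; ring.
  - exact: integrable_ooZ.
  - by apply: (integrable_oo_ext _ (AC_integrableM Ha hg)) => s _; rewrite mulrC.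
rewrite (FE x)// (GE x)//; ring.
Qed.

Lemma AC_C1 a b F f : (forall x, derivable F x 1) -> (forall x, F^`()%classic x = f x) ->
  continuous f -> AC a b F f.
Proof.
move=> dF Ff cf.
have hf u v : integrable_oo u v f.
  apply: integrable_cc_oo; apply: continuous_compact_integrable; first exact: segment_compact.
  exact: continuous_subspaceT.
split=> // x /andP[]; rewrite le_eqVlt => /predU1P[<- _|ax xb].
  by rewrite integral_oo_point addr0.
have cF : continuous F.
  by move=> y; apply: differentiable_continuous; exact/derivable1_diffP.
have := @continuous_FTC2 R f F a x ax.
rewrite (_ : (\int[mu]_(x in `[a, x]) (f x)%:E)%E = (integral_oo a x f)%:E); last first.
  rewrite integral_oo_cc// /Rintegral fineK//;
    exact: (integrable_fin_num _ (integrable_oo_cc (hf a x))).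
move=> /(_ _ _ _)/wrap[]; first exact: continuous_subspaceT.
  split => //.
  - exact/cvg_at_right_filter/cF.
  - exact/cvg_at_left_filter/cF.
- by move=> y _.
by rewrite -EFinB => -[->]; rewrite addrC subrK.
Qed.

Lemma AC_poly a b (p : {poly R}) : AC a b (horner p) (horner p^`()).
Proof.
apply: AC_C1 => [x|x|]; first exact: derivable_horner.
- by rewrite derivE.
- exact: continuous_horner.
Qed.

End AbsolutelyContinuous.

(** * Smooth functions *)

Section SmoothFunctions.
Context {R : realType}.
Implicit Types (f g : R -> R) (p : {poly R}).

Definition smooth f : Prop := forall n x, derivable (derive1n n f) x 1.

(** Smoothness by coinduction: every member of a class of differentiable
    functions that is closed under differentiation is smooth. *)
Lemma smooth_class (K : (R -> R) -> Prop) :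
  (forall f, K f -> (forall x, derivable f x 1) /\ K (derive1 f)) ->
  forall f, K f -> smooth f.
Proof.
move=> hK f Kf n; elim: n f Kf => [|n IH] f Kf x.
  by rewrite derive1n0; exact: (hK _ Kf).1.
by rewrite derive1Sn; apply: IH; exact: (hK _ Kf).2.
Qed.

Lemma smooth_derive1 f : smooth f -> smooth (derive1 f).
Proof. by move=> sf n x; rewrite -derive1Sn; exact: sf. Qed.

Lemma smooth_derivable f : smooth f -> forall x, derivable f x 1.
Proof. by move=> /(_ 0%N). Qed.

Lemma smooth_continuous f : smooth f -> continuous f.
Proof.
move=> sf x; apply: differentiable_continuous; apply/derivable1_diffP.
exact: smooth_derivable.
Qed.

(** Closing the smooth functions under sums and products keeps the class
    stable under differentiation; products are therefore smooth, without a
    formula for their higher derivatives. *)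
Inductive smooth_alg : (R -> R) -> Prop :=
| SmoothAlg f : smooth f -> smooth_alg f
| SmoothAlgD f g : smooth_alg f -> smooth_alg g -> smooth_alg (fun x => f x + g x)
| SmoothAlgM f g : smooth_alg f -> smooth_alg g -> smooth_alg (fun x => f x * g x).

Lemma smooth_algP f : smooth_alg f -> smooth f.
Proof.
apply: smooth_class => {}f; elim.
- move=> g sg; split; first exact: smooth_derivable.
  exact/SmoothAlg/smooth_derive1.
- move=> g h _ [dg Kg] _ [dh Kh]; split; first by move=> x; exact: derivableD.
  rewrite (_ : derive1 _ = fun x => derive1 g x + derive1 h x).
    exact: SmoothAlgD.
  by apply/funext => x; rewrite !derive1E deriveD.
- move=> g h gK [dg Kg] hK [dh Kh]; split; first by move=> x; exact: derivableM.
  rewrite (_ : derive1 _ = fun x => g x * derive1 h x + h x * derive1 g x).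
    by apply: SmoothAlgD; exact: SmoothAlgM.
  by apply/funext => x; rewrite !derive1E deriveM.
Qed.

Lemma smoothD f g : smooth f -> smooth g -> smooth (fun x => f x + g x).
Proof. by move=> sf sg; apply/smooth_algP/SmoothAlgD; exact: SmoothAlg. Qed.

Lemma smoothM f g : smooth f -> smooth g -> smooth (fun x => f x * g x).
Proof. by move=> sf sg; apply/smooth_algP/SmoothAlgM; exact: SmoothAlg. Qed.

Lemma smooth_cst (k : R) : smooth (fun=> k).
Proof.
apply: (@smooth_class (fun f => exists k, f = fun=> k)); last by exists k.
move=> f [c ->]; split; first by move=> x; exact: derivable_cst.
by exists 0; apply/funext => x; rewrite derive1_cst.
Qed.

Lemma smooth_affine f (k e : R) : smooth f -> smooth (fun x => f (k * x + e)).
Proof.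
move=> sf.
apply: (@smooth_class (fun g => exists f c, smooth f /\
  g = fun x => c * f (k * x + e))); last first.
  by exists f, 1; split => //; apply/funext => x; rewrite mul1r.
move=> {f sf} _ [f [c [sf ->]]].
have da (x : R) : is_derive x 1 (fun x => k * x + e) k.
  by apply: is_derive_eq; rewrite addr0 [_ *: 1]mulr1.
have dfa (x : R) : is_derive x 1 (fun x => f (k * x + e)) (derive1 f (k * x + e) * k).
  have hf : is_derive (k * x + e) 1 f (derive1 f (k * x + e)).
    rewrite derive1E; apply/derivableP; exact: smooth_derivable.
  exact: (@is_derive1_comp _ f (fun x => k * x + e)).
have dcfa (x : R) :
   is_derive x 1 (fun x => c * f (k * x + e)) (c * k * derive1 f (k * x + e)).
  by apply: is_derive_eq; rewrite /GRing.scale/=; ring.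
split; first by move=> x; exact: (@ex_derive _ _ _ _ _ _ _ (dcfa x)).
exists (derive1 f), (c * k); split; first exact: smooth_derive1.
by apply/funext => x; rewrite derive1E; exact: (@derive_val _ _ _ _ _ _ _ (dcfa x)).
Qed.

(** With t = 1 / x this is p(t) exp(- t). For p = 1 it is the classical smooth
    function that is flat at 0; the polynomials p make the family closed under
    differentiation. *)
Definition flat p (x : R) : R := if 0 < x then p.[x^-1] * expR (- x^-1) else 0.

(** The exponential beats all powers of 1 / x. The induction on p needs the
    bound for all 'X^k p at once. *)
Lemma flat_le p : exists2 C, 0 <= C & forall x, 0 < x -> `|flat p x| <= C * x.
Proof.
suff : forall k, exists2 C, 0 <= C &
    forall t, 0 < t -> `|t ^+ k * p.[t]| * expR (- t) <= C * t^-1.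
  move=> /(_ 0%N)[C C0 hC]; exists C => // x x0.
  rewrite /flat x0 normrM (ger0_norm (expR_ge0 _)).
  by have := hC x^-1; rewrite invr_gt0 invrK mul1r; exact.
elim/poly_ind: p => [|p c IH] k.
  by exists 0 => // t _; rewrite horner0 mulr0 normr0 !mul0r.
have [C C0 hC] := IH k.+1.
exists (C + `|c| * k.+1`!%:R); first by rewrite addr_ge0// mulr_ge0.
move=> t t0; rewrite hornerMXaddC mulrDl.
have -> : t ^+ k * (p.[t] * t + c) = t ^+ k.+1 * p.[t] + t ^+ k * c.
  by rewrite exprS; ring.
apply: (@le_trans _ _ (`|t ^+ k.+1 * p.[t]| * expR (- t) + `|t ^+ k * c| * expR (- t))).
  by rewrite -mulrDl ler_wpM2r ?expR_ge0// ler_normD.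
apply: lerD; first exact: hC.
rewrite normrM (ger0_norm (exprn_ge0 _ (ltW t0))) (mulrC (t ^+ k)) -!mulrA.
apply: ler_wpM2l => //.
rewrite expRN ler_pdivrMr ?expR_gt0// mulrAC ler_pdivlMr//.
have := @expR_ge1Dxn _ t k (ltW t0) => h.
have f0 : (0 : R) < k.+1`!%:R by rewrite ltr0n fact_gt0.
rewrite -exprSr mulrC -ler_pdivrMr//; apply: le_trans h.
by rewrite lerDr ler01.
Qed.

Lemma flat_deriv_pos p (x : R) : 0 < x ->
  is_derive x 1 (flat p) (flat ('X^2 * (p - p^`())) x).
Proof.
move=> x0.
pose g (y : R) := p.[y^-1] * expR (- y^-1).
have dg : is_derive x 1 g (flat ('X^2 * (p - p^`())) x).
  have xn0 : x != 0 by rewrite gt_eqF.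
  have di : is_derive x 1 (fun y : R => y^-1) (- x ^- 2).
    have h := @is_deriveV R (@id R) x 1 1 xn0 (is_derive_id x 1).
    by apply: is_derive_eq; rewrite [_ *: _]mulr1.
  have dp : is_derive x 1 (fun y : R => p.[y^-1]) (p^`().[x^-1] * - x ^- 2).
    exact: (@is_derive1_comp _ (horner p) (fun y => y^-1)).
  have de : is_derive x 1 (fun y : R => expR (- y^-1)) (expR (- x^-1) * x ^- 2).
    have dn : is_derive x 1 (fun y : R => - y^-1) (x ^- 2).
      by apply: is_derive_eq; rewrite opprK.
    exact: (@is_derive1_comp _ (@expR R) (fun y => - y^-1)).
  apply: is_derive_eq; rewrite /flat x0 !hornerE /GRing.scale/=.
  by rewrite -!exprVn; ring.
apply: near_eq_is_derive dg.
near=> y; rewrite /g /flat ifT//; near: y; exact: lt_nbhsr.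
Unshelve. all: by end_near. Qed.

Lemma flat_deriv_neg p (x : R) : x < 0 ->
  is_derive x 1 (flat p) (flat ('X^2 * (p - p^`())) x).
Proof.
move=> x0.
have dg : is_derive x 1 (fun=> 0 : R) (flat ('X^2 * (p - p^`())) x).
  by rewrite /flat ltNge (ltW x0)/=; exact: is_derive_cst.
apply: near_eq_is_derive dg.
near=> y; rewrite /flat ifF//; apply/negbTE; rewrite -leNgt ltW//.
near: y; exact: lt_nbhsl.
Unshelve. all: by end_near. Qed.

(** The difference quotient at 0 is again a flat function, with polynomial 'X
    p, hence it is O(x). *)
Lemma flat_deriv0 p : is_derive (0 : R) 1 (flat p) (flat ('X^2 * (p - p^`())) 0).
Proof.
rewrite {2}/flat ltxx.
have [C C0 hC] := flat_le ('X * p).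
have h : h^-1 *: (flat p (h *: (1 : R) + 0) - flat p 0) @[h --> (0 : R)^'] --> (0 : R).
  apply/cvgrPdist_le => e e0; near=> h.
  rewrite sub0r normrN addr0 [h *: 1]mulr1 {2}/flat ltxx subr0.
  have [h0|h0] := ltP 0 h; last first.
    by rewrite /flat ltNge h0/= scaler0 normr0 ltW.
  have -> : h^-1 *: flat p h = flat ('X * p) h.
    by rewrite /flat h0 !hornerE /GRing.scale/= mulrA.
  apply: (le_trans (hC _ h0)).
  apply: (@le_trans _ _ ((C + 1) * h)); first by rewrite ler_wpM2r ?(ltW h0)// lerDl.
  rewrite mulrC -ler_pdivlMr ?ltr_wpDl//.
  have : `|h| < e / (C + 1).
    by near: h; apply: dnbhs0_lt; rewrite divr_gt0// ltr_wpDl.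
  by move=> /ltW; apply: le_trans; exact: ler_norm.
by split; [apply/cvg_ex; exists 0|exact/cvg_lim].
Unshelve. all: by end_near. Qed.

Lemma flat_deriv p (x : R) : is_derive x 1 (flat p) (flat ('X^2 * (p - p^`())) x).
Proof.
have [x0|x0|->] := ltgtP x 0; first exact: flat_deriv_neg.
- exact: flat_deriv_pos.
- exact: flat_deriv0.
Qed.

Lemma smooth_flat p : smooth (flat p).
Proof.
apply: (@smooth_class (fun f => exists p, f = flat p)); last by exists p.
move=> f [q ->]; split; first by move=> x; exact: (@ex_derive _ _ _ _ _ _ _ (flat_deriv q x)).
exists ('X^2 * (q - q^`())); apply/funext => x; rewrite derive1E.
exact: (@derive_val _ _ _ _ _ _ _ (flat_deriv q x)).
Qed.

End SmoothFunctions.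

(** * Test functions and the lemma of du Bois-Reymond *)

Section TestFunctions.
Context {R : realType}.
Local Notation mu := (@lebesgue_measure R).
Implicit Types (a b c d k x y : R) (f g h F G phi psi : R -> R).

Lemma test_smooth a b phi : test_function a b phi -> smooth phi.
Proof. by case. Qed.

Lemma test_derive1 a b phi : test_function a b phi -> test_function a b (derive1 phi).
Proof.
move=> [sphi [c [d [ac db supp]]]]; split; first exact: smooth_derive1.
exists c, d; split => // x; apply: contraR.
rewrite negb_and -!ltNge => /orP h.
have phi0 : \forall y \near x, (fun=> 0 : R) y = phi y.
  case: h => h; near=> y; apply/esym/eqP; apply: contraT => /supp/andP[cy yd].
    by exfalso; suff : y < c by [rewrite ltNge cy]; near: y; exact: lt_nbhsl.
  by exfalso; suff : d < y by [rewrite ltNge yd]; near: y; exact: lt_nbhsr.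
have h' : is_derive x 1 phi 0.
  by apply: near_eq_is_derive (is_derive_cst _ _ _); exact: phi0.
by rewrite derive1E (@derive_val _ _ _ _ _ _ _ h').
Unshelve. all: by end_near. Qed.

Lemma test_comb a b phi psi k : test_function a b phi -> test_function a b psi ->
  test_function a b (fun x => phi x + k * psi x).
Proof.
move=> [s1 [c1 [d1 [ac1 db1 h1]]]] [s2 [c2 [d2 [ac2 db2 h2]]]]; split.
  by apply: smoothD => //; apply: smoothM => //; exact: smooth_cst.
exists (Num.min c1 c2), (Num.max d1 d2); split.
- by rewrite lt_min ac1.
- by rewrite gt_max db1.
move=> x nz; rewrite ge_min le_max.
have [p0|/h1/andP[-> ->]//] := eqVneq (phi x) 0.
have [q0|/h2/andP[-> ->]] := eqVneq (psi x) 0; last by rewrite !orbT.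
by move: nz; rewrite p0 q0 mulr0 addr0 eqxx.
Qed.

Lemma test_ends a b phi : test_function a b phi -> phi a = 0 /\ phi b = 0.
Proof.
move=> [_ [c [d [ac db h]]]]; split; apply/eqP; apply: contraT => /h/andP[].
  by rewrite leNgt ac.
by move=> _; rewrite leNgt db.
Qed.

Lemma test_AC a b phi u v : test_function a b phi -> AC u v phi (derive1 phi).
Proof.
move=> tp; apply: AC_C1 => //; first exact/smooth_derivable/(test_smooth tp).
exact/smooth_continuous/smooth_derive1/(test_smooth tp).
Qed.

Lemma test_integrableM a b f phi : integrable_oo a b f -> test_function a b phi ->
  integrable_oo a b (fun x => f x * phi x).
Proof.
move=> hf tp; apply: (integrable_oo_ext _ (AC_integrableM (test_AC a b tp) hf)) => x _.
by rewrite mulrC.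
Qed.

Lemma AC_test a b F f phi : a <= b -> AC a b F f -> test_function a b phi ->
  integral_oo a b (fun x => F x * derive1 phi x) = - integral_oo a b (fun x => f x * phi x).
Proof.
move=> ab hF tp; have hp := test_AC a b tp.
have := AC_integral ab (AC_M hF hp); have [-> ->] := test_ends tp.
rewrite !mulr0 subrr integral_ooD; last 2 first.
- by apply: test_integrableM => //; case: hF.
- by apply: AC_integrableM hF _; case: hp.
by move/eqP; rewrite addr_eq0 => /eqP ->; rewrite opprK.
Qed.

(** As n grows, these functions tend to the indicator of ]c, d[ while staying
    between 0 and 1. *)
Definition bump c d (n : nat) x : R :=
  flat 1 (n.+1%:R * (x - c)) * flat 1 (n.+1%:R * (d - x)).

Lemma test_bump a b c d n : a < c -> d < b -> test_function a b (bump c d n).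
Proof.
move=> ac db; split.
  apply: smoothM.
    have := @smooth_affine R _ n.+1%:R (- (n.+1%:R * c)) (@smooth_flat R 1).
    by rewrite /smooth; under eq_fun do rewrite -mulrBr.
  have := @smooth_affine R _ (- n.+1%:R) (n.+1%:R * d) (@smooth_flat R 1).
  by rewrite /smooth; under eq_fun do rewrite mulNr addrC -mulrBr.
exists c, d; split => // x; rewrite /bump /flat.
have n0 : (0 : R) < n.+1%:R by [].
rewrite !pmulr_rgt0// !subr_gt0.
by case: ltP => [/ltW -> |_]; case: ltP => [/ltW -> |_]; rewrite ?mulr0 ?mul0r ?eqxx.
Qed.

Lemma flat1_bound x : 0 <= flat (1 : {poly R}) x <= 1.
Proof.
rewrite /flat; case: ifPn => [x0|_]; last by rewrite lexx ler01.
by rewrite hornerC mul1r expR_ge0 expR_le1 oppr_le0 invr_ge0 ltW.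
Qed.

Lemma flat1_cvg y : 0 < y -> flat (1 : {poly R}) (n.+1%:R * y) @[n --> \oo] --> (1 : R).
Proof.
move=> y0.
have h : (- (n.+1%:R * y)^-1) @[n --> \oo] --> - ((0 : R) * y^-1).
  apply: cvgN.
  under eq_fun do rewrite invfM.
  by apply: cvgM; [exact: cvg_harmonic|exact: cvg_cst].
rewrite [X in _ --> X](_ : 1 = expR (- (0 * y^-1))); last by rewrite mul0r oppr0 expR0.
have -> : (fun n => flat (1 : {poly R}) (n.+1%:R * y)) = (fun n => expR (- (n.+1%:R * y)^-1)).
  by apply/funext => n; rewrite /flat mulr_gt0// hornerC mul1r.
by apply: continuous_cvg => //; exact: continuous_expR.
Qed.

Lemma bump_cvg c d x : bump c d n x @[n --> \oo] --> (\1_`]c, d[ x : R).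
Proof.
rewrite indicE mem_setE in_itv/=.
case: (ltP c x) => [cx|xc] /=; last first.
  rewrite (_ : (fun n => _) = fun=> 0); first exact: cvg_cst.
  apply/funext => n; rewrite /bump {1}/flat pmulr_rgt0// subr_gt0 ltNge xc/=.
  by rewrite mul0r.
case: (ltP x d) => [xd|dx] /=; last first.
  rewrite (_ : (fun n => _) = fun=> 0); first exact: cvg_cst.
  apply/funext => n; rewrite /bump mulrC {1}/flat pmulr_rgt0// subr_gt0 ltNge dx/=.
  by rewrite mul0r.
rewrite -[X in _ --> X](mulr1 1).
by apply: cvgM; apply: flat1_cvg; rewrite subr_gt0.
Qed.

Lemma bump_integral a b c d h : a <= c -> d <= b -> integrable_oo a b h ->
  integral_oo a b (fun x => h x * bump c d n x) @[n --> \oo] --> integral_oo c d h.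
Proof.
move=> ac db hh.
have mb n : measurable_oo a b (bump c d n).
  have [] := @test_bump (c - 1) (d + 1) c d n; rewrite ?gtrDl ?ltrDl ?oppr_lt0//.
  move=> /smooth_continuous cb _; apply: continuous_measurable_oo; exact: continuous_subspaceT.
have sub : `]c, d[ `<=` (`]a, b[%classic : set R).
  by move=> x /=; rewrite !in_itv/= => /andP[cx xd]; rewrite (le_lt_trans ac) ?(lt_le_trans xd).
have mh := integrable_oo_measurable hh.
have := @dominated_convergence _ _ R mu `]a, b[ (measurable_itv _)
  (fun n x => (h x * bump c d n x)%:E) (fun x => (h x * \1_`]c, d[ x)%:E)
  (fun x => `|(h x)%:E|%E).
move=> /(_ _ _ _ _ _)/wrap[].
- by move=> n; apply/measurable_EFinP; apply: measurable_funM; [exact: mh|exact: mb].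
- by apply/measurable_EFinP; apply: measurable_funM; [exact: mh|exact: measurable_indic].
- apply: (@aeW _ _ _ mu) => x _; apply: cvg_EFin; first exact: nearW.
  by apply: cvgM; [exact: cvg_cst|exact: bump_cvg].
- exact: integrable_abse.
- apply: (@aeW _ _ _ mu) => x n _ /=; rewrite lee_fin normrM ler_piMr//.
  rewrite /bump normrM mulr_ile1//.
    by have /andP[h0 h1] := flat1_bound (n.+1%:R * (x - c)); rewrite ger0_norm.
  by have /andP[h0 h1] := flat1_bound (n.+1%:R * (d - x)); rewrite ger0_norm.
move=> [_ _].
have -> : (\int[mu]_(x in `]a, b[) (h x * \1_`]c, d[ x)%:E = (integral_oo c d h)%:E)%E.
  rewrite -(@integral_ooE _ c d h `]c, d[)//; last exact: integrable_ooS hh.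
  rewrite -[in RHS](setIidl sub) setIC integral_mkcondr; apply: eq_integral => x _.
  by rewrite patchE indicE; case: ifP => _; rewrite ?mulr1 ?mulr0.
move/fine_cvg; apply: cvg_trans; apply: near_eq_cvg; apply: nearW => n.
by rewrite /integral_oo.
Qed.

(** The fundamental lemma of the calculus of variations. Approximating
    indicators by bumps, h has integral 0 over all inner intervals, hence a
    constant primitive; Lebesgue differentiation concludes. *)
Lemma test_ae0 a b h : integrable_oo a b h ->
  (forall phi, test_function a b phi -> integral_oo a b (fun x => h x * phi x) = 0) ->
  ae_oo a b (fun x => h x = 0).
Proof.
move=> hh h0.
have z c d : a < c -> d < b -> integral_oo c d h = 0.
  move=> ac db; have := bump_integral (ltW ac) (ltW db) hh.
  have -> : (fun n => integral_oo a b (fun x => h x * bump c d n x)) = fun=> 0.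
    by apply/funext => n; apply: h0; exact: test_bump.
  by move/cvg_lim => <-//; rewrite lim_cst.
pose f := h \_ `]a, b[.
have mI : measurable (`]a, b[%classic : set R) by exact: measurable_itv.
have fT : mu.-integrable setT (EFin \o f).
  rewrite /f -restrict_EFin.
  by have [k _] := integrable_mkcond (mu := mu) (EFin \o h) mI; exact: k.
have fe u v : a <= u -> v <= b -> integral_oo u v f = integral_oo u v h.
  move=> au vb; apply: integral_oo_ext => x /andP[ux xv].
  by rewrite /f patchE mem_setE in_itv/= (le_lt_trans au)// (lt_le_trans xv).
have fi u v : integrable_oo u v f by apply: integrableS fT.
have /(_ _ _)/wrap[||H] := @FTC1 R f (BRight a).
- by move=> y; apply: integrableS fT.
- apply: integrable_locally => //.
rewrite /ae_oo; apply: (@filterS _ _ ae_oo_filter) H => x H xab.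
have /andP[ax xb] : a < x < b by move: xab; rewrite /= in_itv.
have [_] := H ax.
rewrite /f patchE mem_setE in_itv/= ax xb /= => <-.
pose c := (a + x) / 2.
have ac : a < c by rewrite /c; lra.
have cx : c < x by rewrite /c; lra.
have near_cst : \forall y \near x, (fun=> integral_oo a c h) y =
   (\int[mu]_(t in `]a, y]) f t)%R.
  near=> y.
  have cy : c < y by near: y; exact: lt_nbhsr.
  have yb : y < b by near: y; exact: lt_nbhsl.
  rewrite -Rintegral_itv_bndo_bndc; last exact: fi.
  transitivity (integral_oo a y h); last by rewrite -fe// ltW.
  rewrite (@integral_oo_split _ a y c).
  - by rewrite (z c y) ?addr0.
  - by rewrite !ltW.
  - exact: integrable_ooS (lexx _) (ltW yb) hh.
have h' : is_derive x 1 (fun y => (\int[mu]_(t in `]a, y]) (h \_ `]a, b[) t)%R) 0.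
  by apply: near_eq_is_derive (is_derive_cst _ _ _); exact: near_cst.
by rewrite derive1E (@derive_val _ _ _ _ _ _ _ h').
Unshelve. all: by end_near. Qed.

(** The primitive from a is constant beyond the support of psi, and that
    constant is the integral of psi, which is 0. *)
Lemma test_antideriv a b psi : a < b -> test_function a b psi -> integral_oo a b psi = 0 ->
  exists2 phi, test_function a b phi & derive1 phi = psi.
Proof.
move=> ab tpsi psi0; have [spsi [c [d [ac db supp]]]] := tpsi.
have cpsi : continuous psi by exact: smooth_continuous.
have hi u v : integrable_oo u v psi by exact: AC_integrable (test_AC u v tpsi).
have psiz x : ~~ (c <= x <= d) -> psi x = 0.
  by move=> h; apply/eqP; apply: contraNT h; exact: supp.
pose phi x := integral_oo a x psi.
have phiz x : ~~ (c <= x <= d) -> phi x = 0.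
  rewrite negb_and -!ltNge => /orP[xc|dx].
    rewrite /phi (@integral_oo_ext _ a x psi (fun=> 0)) ?integral_oo0// => y /andP[_ yx].
    by apply: psiz; rewrite negb_and -!ltNge (lt_trans yx xc).
  have z u v : d <= u -> integral_oo u v psi = 0.
    move=> du; rewrite (@integral_oo_ext _ u v psi (fun=> 0)) ?integral_oo0// => y /andP[uy _].
    by apply: psiz; rewrite negb_and -!ltNge (le_lt_trans du uy) orbT.
  have [da|ad] := leP d a; first exact: z.
  rewrite /phi (@integral_oo_split _ a x d) ?(ltW ad) ?(ltW dx)//.
  have := psi0; rewrite (@integral_oo_split _ a b d) ?(ltW ad) ?(ltW db)//.
  by rewrite (z d b)// (z d x)// !addr0.
have dphi x : is_derive x 1 phi (psi x).
  have [xc|cx] := ltP x c.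
    rewrite psiz ?negb_and -?ltNge ?xc//.
    apply: near_eq_is_derive (is_derive_cst _ _ _).
    near=> y; rewrite phiz// negb_and -!ltNge; apply/orP; left.
    by near: y; exact: lt_nbhsl.
  have ax : a < x by exact: lt_le_trans cx.
  have x1 : x < x + 1 by rewrite ltrDl.
  have [|dF F'] := @continuous_FTC1 R psi (BRight a) x (x + 1) x1 _ ax (cpsi x).
    exact: integrable_oo_oc.
  have E : (fun y => (\int[mu]_(t in `]a, y]) psi t)%R) = phi.
    by apply/funext => y; rewrite -Rintegral_itv_bndo_bndc//; exact: hi.
  rewrite E in dF F'; rewrite -F' derive1E; exact/derivableP.
have phi' : derive1 phi = psi.
  by apply/funext => x; rewrite derive1E; exact: (@derive_val _ _ _ _ _ _ _ (dphi x)).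
exists phi => //; split; last first.
  by exists c, d; split => // x; apply: contraR => /phiz ->.
case=> [|n] x; first exact: (@ex_derive _ _ _ _ _ _ _ (dphi x)).
by rewrite derive1Sn phi'; exact: spsi.
Unshelve. all: by end_near. Qed.

Lemma test_unit a b : a < b -> exists2 rho, test_function a b rho & integral_oo a b rho = 1.
Proof.
move=> ab.
pose c := (2 * a + b) / 3; pose d := (a + 2 * b) / 3.
have ac : a < c by rewrite /c; lra.
have cd : c < d by rewrite /c /d; lra.
have db : d < b by rewrite /d; lra.
have h := bump_integral (ltW ac) (ltW db) (integrable_oo_cst a b 1).
have [n hn] : exists n, integral_oo a b (fun x => 1 * bump c d n x) != 0.
  apply: contrapT => /forallNP z.
  have E : (fun n => integral_oo a b (fun x => 1 * bump c d n x)) = fun=> 0.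
    by apply/funext => n; apply/eqP; apply: contraT => /z.
  move: h; rewrite E => /cvg_lim; rewrite lim_cst// => /(_ (@Rhausdorff R)) /esym/eqP.
  by rewrite integral_oo_cst ?(ltW cd)// mul1r subr_eq0 gt_eqF.
set k := integral_oo a b _ in hn.
have tb : test_function a b (bump c d n) by exact: test_bump.
exists (fun x => 0 + k^-1 * bump c d n x).
  apply: test_comb => //; split; first exact: smooth_cst.
  by exists c, d; split => // x; rewrite eqxx.
under eq_fun do rewrite add0r.
rewrite integral_ooZ; last exact: AC_integrable (test_AC a b tb).
by rewrite -[RHS](mulVf hn); congr (_ * _); apply: integral_oo_ext => x _; rewrite mul1r.
Qed.

(** With rho a test function of integral 1, the difference of psi and
    (integral of psi) rho is the derivative of a test function, so T does not
    see it. *)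
Lemma test_functional a b (T : (R -> R) -> R) : a < b ->
  (forall phi psi k, test_function a b phi -> test_function a b psi ->
    T (fun x => phi x + k * psi x) = T phi + k * T psi) ->
  (forall phi, test_function a b phi -> T (derive1 phi) = 0) ->
  exists C, forall psi, test_function a b psi -> T psi = C * integral_oo a b psi.
Proof.
move=> ab Tlin T0; have [rho trho rho1] := test_unit ab.
exists (T rho) => psi tpsi.
have tt := test_comb (- integral_oo a b psi) tpsi trho.
have hi phi : test_function a b phi -> integrable_oo a b phi.
  by move=> tp; exact: AC_integrable (test_AC a b tp).
have [|phi tphi phi'] := test_antideriv ab tt.
  rewrite integral_ooD; [|exact: hi|exact/integrable_ooZ/hi].
  by rewrite integral_ooZ ?rho1 ?mulr1 ?subrr//; exact: hi.
have := T0 _ tphi; rewrite phi' Tlin// mulNr => /eqP; rewrite subr_eq0 => /eqP ->.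
exact: mulrC.
Qed.

(** The lemma of du Bois-Reymond: f minus a primitive of g kills all
    derivatives of test functions, hence is constant. *)
Lemma weak_derivative_AC a b f g : a < b -> integrable_oo a b f -> integrable_oo a b g ->
  (forall phi, test_function a b phi ->
    integral_oo a b (fun x => f x * derive1 phi x) = - integral_oo a b (fun x => g x * phi x)) ->
  exists2 F, AC a b F g & ae_oo a b (fun x => F x = f x).
Proof.
move=> ab hf hg fg.
pose G x := 0 + integral_oo a x g; have hG : AC a b G g by exact: AC_primitive.
have hfG : integrable_oo a b (fun x => f x - G x) by apply: integrable_ooB => //;
  exact: AC_integrable hG.
have [|phi tphi|C hC] := @test_functional a b
    (fun psi => integral_oo a b (fun x => (f x - G x) * psi x)) ab.
- move=> phi psi k tp tq; rewrite -integral_ooZ; last exact: test_integrableM.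
  rewrite -integral_ooD; [|exact: test_integrableM|exact/integrable_ooZ/test_integrableM].
  by apply: integral_oo_ext => x _; ring.
- under eq_fun do rewrite mulrBl.
  have td := test_derive1 tphi.
  rewrite integral_ooB; [|exact: test_integrableM|exact: test_integrableM (AC_integrable hG) td].
  by rewrite fg// (AC_test (ltW ab) hG tphi) subrr.
exists (fun x => C + integral_oo a x g); first exact: AC_primitive.
have hfGC : integrable_oo a b (fun x => f x - G x - C) by apply: integrable_ooB => //;
  exact: integrable_oo_cst.
have := test_ae0 hfGC; move=> /(_ _)/wrap[phi tphi|].
  have hp : integrable_oo a b phi by exact: AC_integrable (test_AC a b tphi).
  under eq_fun do rewrite mulrBl.
  rewrite integral_ooB; [|exact: test_integrableM|exact: integrable_ooZ].
  by rewrite hC// integral_ooZ// subrr.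
by apply: ae_ooS => x _ /eqP; rewrite /G add0r => /eqP h; lra.
Qed.

(** A second weak derivative forces a first one. If G is a primitive of g then
    psi |-> int f psi' + int G psi kills all derivatives of test functions,
    hence equals C int psi, and G - C is a first weak derivative of f. This
    gives the third derivative of a beam from the second and the fourth one. *)
Lemma second_weak_derivative_AC a b f g : a < b -> integrable_oo a b f -> integrable_oo a b g ->
  (forall phi, test_function a b phi ->
    integral_oo a b (fun x => f x * derive1 (derive1 phi) x) =
    integral_oo a b (fun x => g x * phi x)) ->
  exists2 G, AC a b G g & forall phi, test_function a b phi ->
    integral_oo a b (fun x => f x * derive1 phi x) = - integral_oo a b (fun x => G x * phi x).
Proof.
move=> ab hf hg fg.
pose G x := 0 + integral_oo a x g; have hG : AC a b G g by exact: AC_primitive.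
have iG := AC_integrable hG.
have [|phi tphi|C hC] := @test_functional a b
    (fun psi => integral_oo a b (fun x => f x * derive1 psi x) +
      integral_oo a b (fun x => G x * psi x)) ab.
- move=> phi psi k tp tq.
  have tp' := test_derive1 tp; have tq' := test_derive1 tq.
  have E : derive1 (fun x => phi x + k * psi x) = fun x => derive1 phi x + k * derive1 psi x.
    have dp := smooth_derivable (test_smooth tp); have dq := smooth_derivable (test_smooth tq).
    apply/funext => x; rewrite !derive1E deriveD//; last exact: derivableM.
    by rewrite deriveM// derive_cst scaler0 addr0.
  rewrite E mulrDr -!integral_ooZ; [|exact: test_integrableM|exact: test_integrableM].
  rewrite [RHS]addrACA; congr (_ + _); (rewrite -integral_ooD; [apply: integral_oo_ext => x _; ring|..]);
    by [exact: test_integrableM|exact/integrable_ooZ/test_integrableM].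
- have td := test_derive1 tphi.
  by rewrite fg// (AC_test (ltW ab) hG tphi) subrr.
exists (fun x => - C + integral_oo a x g); first exact: AC_primitive.
move=> phi tphi; have := hC _ tphi.
have hp : integrable_oo a b phi by exact: AC_integrable (test_AC a b tphi).
have -> : integral_oo a b (fun x => (- C + integral_oo a x g) * phi x) =
   integral_oo a b (fun x => G x * phi x) - integral_oo a b (fun x => C * phi x).
  rewrite -integral_ooB; [|exact: test_integrableM|exact: integrable_ooZ].
  by apply: integral_oo_ext => x _; rewrite /G; ring.
rewrite integral_ooZ//; lra.
Qed.

End TestFunctions.

(** * Square integrable functions *)

Section SquareIntegrable.
Context {R : realType}.
Local Notation mu := (@lebesgue_measure R).
Implicit Types (a b k x : R) (f g h F G : R -> R).

Definition sqr_integrable a b f : Prop := measurable_oo a b f /\ integrable_oo a b (fun x => f x ^+ 2).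

Lemma sqr_integrableM a b f g : sqr_integrable a b f -> sqr_integrable a b g ->
  integrable_oo a b (fun x => f x * g x).
Proof.
move=> [mf hf] [mg hg]; apply: (@le_integrable_oo _ _ _ _ (fun x => f x ^+ 2 + g x ^+ 2)).
- exact: measurable_funM.
- move=> x _; rewrite normrM -(real_normK (num_real (f x))) -(real_normK (num_real (g x))).
  have := sqr_ge0 (`|f x| - `|g x|); have := normr_ge0 (f x); have := normr_ge0 (g x).
  by move: `|f x| `|g x| => u v *; nra.
- exact: integrable_ooD.
Qed.

Lemma sqr_integrableD a b f g : sqr_integrable a b f -> sqr_integrable a b g ->
  sqr_integrable a b (fun x => f x + g x).
Proof.
move=> hf hg; split; first by apply: measurable_funD; [case: hf|case: hg].
apply: (@integrable_oo_ext _ _ _ (fun x => f x ^+ 2 + (2 * (f x * g x) + g x ^+ 2))).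
  by move=> x _; ring.
apply: integrable_ooD; first by case: hf.
by apply: integrable_ooD; [exact/integrable_ooZ/sqr_integrableM|case: hg].
Qed.

Lemma sqr_integrableZ a b k f : sqr_integrable a b f -> sqr_integrable a b (fun x => k * f x).
Proof.
move=> [mf hf]; split; first exact: measurable_funM.
by apply: (integrable_oo_ext _ (integrable_ooZ (k ^+ 2) hf)) => x _; ring.
Qed.

Lemma sqr_integrable_cst a b k : sqr_integrable a b (fun=> k).
Proof. by split; [exact: measurable_cst|exact: integrable_oo_cst]. Qed.

Lemma sqr_integrable_integrable a b f : sqr_integrable a b f -> integrable_oo a b f.
Proof.
by move=> /(sqr_integrableM (sqr_integrable_cst a b 1)); apply: integrable_oo_ext => x _;
  rewrite mul1r.
Qed.

Lemma AC_sqr_integrableM a b K (k : R -> R) f : AC a b K k -> sqr_integrable a b f ->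
  sqr_integrable a b (fun x => K x * f x).
Proof.
move=> hK [mf hf]; split.
  by apply: measurable_funM => //; exact: AC_measurable hK.
by apply: (integrable_oo_ext _ (AC_integrableM (AC_M hK hK) hf)) => x _; ring.
Qed.

Lemma AC_sqr_integrable a b F f : AC a b F f -> sqr_integrable a b F.
Proof. by move=> /AC_sqr_integrableM/(_ (sqr_integrable_cst a b 1));
  under eq_fun do rewrite mulr1. Qed.

Lemma sqr_integrableP a b f : sqr_integrable a b f <-> f \_ `]a, b[ \in Lfun mu 2%:E.
Proof.
have mI : measurable (`]a, b[%classic : set R) by exact: measurable_itv.
have E : (fun x => (f x ^+ 2)%:E) \_ `]a, b[ = EFin \o (fun x => (f \_ `]a, b[) x ^+ 2).
  by apply/funext => x /=; rewrite !patchE; case: ifP => // _; rewrite expr0n.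
split.
  move=> [mf hf]; rewrite inE; apply/andP; split; rewrite inE/=.
    by apply/(measurable_restrictT _ _).1.
  rewrite /finite_norm unlock poweR_lty//.
  have /integrableP[_] : mu.-integrable setT (EFin \o (fun x => (f \_ `]a, b[) x ^+ 2)).
    rewrite -E.
    by have [k _] := integrable_mkcond (mu := mu) (fun x => (f x ^+ 2)%:E) mI; exact: k.
  congr (_ < _)%E; apply: eq_integral => x _.
  by rewrite /= powR_mulrn// ger0_norm ?sqr_ge0// real_normK ?num_real.
move=> hf; split.
  move: hf; rewrite inE => /andP[]; rewrite inE/= => mf _.
  by have [_ k] := measurable_restrictT f mI; exact: k.
have := Lfun2_integrable_sqr hf; rewrite -E => h.
by have [_ k] := integrable_mkcond (mu := mu) (fun x => (f x ^+ 2)%:E) mI; exact: k.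
Qed.

(** Inside, a nonzero value would persist on an open interval, which is not
    negligible; the end points follow by continuity. *)
Lemma continuous_ae0 a b (f : R -> R) : a < b -> {within `[a, b], continuous f} ->
  ae_oo a b (fun x => f x = 0) -> forall x, a <= x <= b -> f x = 0.
Proof.
move=> ab /continuous_within_itvP -/(_ ab)[fin fa fb] f0.
have int x : a < x < b -> f x = 0.
  move=> xab; have cx : {for x, continuous f} by apply: fin; rewrite in_itv.
  apply/eqP; apply: contraT => fx.
  have /nbhs_ballP[e /= e0 he] : \forall y \near x, [/\ a < y, y < b & f y != 0].
    have /andP[ax xb] := xab.
    near=> y; split; near: y; [exact: lt_nbhsr|exact: lt_nbhsl|].
    exact: (cvgr_neq0 (f x)).
  have [N [mN N0 subN]] := f0.
  have sub : `]x - e, x + e[ `<=` N.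
    move=> y /=; rewrite in_itv/= => /andP[y1 y2]; apply: subN => /= h.
    have [|ay yb /eqP] := he y; first by rewrite /ball/= distrC ltr_distl y1.
    by apply; apply: h; rewrite in_itv/= ay.
  pose J : set R := `]x - e, x + e[%classic.
  have : (mu J <= mu N)%E.
    by apply: le_measure => //; rewrite inE //; exact: measurable_itv.
  rewrite N0 /J lebesgue_measure_itv/= lte_fin ifT; last by lra.
  by rewrite lee_fin; lra.
move=> x /andP[]; rewrite le_eqVlt => /predU1P[<- _|ax].
  have : f x @[x --> a^'+] --> (0 : R).
    apply: cvg_near_cst; near=> y; apply/int/andP; split.
      by near: y; exact: nbhs_right_gt.
    by near: y; exact: nbhs_right_lt.
  by move: fa => /cvg_lim <-// /cvg_lim <-.
rewrite le_eqVlt => /predU1P[->|xb]; last by apply: int; rewrite ax.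
have : f x @[x --> b^'-] --> (0 : R).
  apply: cvg_near_cst; near=> y; apply/int/andP; split.
    by near: y; exact: nbhs_left_gt.
  by near: y; exact: nbhs_left_lt.
by move: fb => /cvg_lim <-// /cvg_lim <-.
Unshelve. all: by end_near. Qed.

End SquareIntegrable.

(** * Real and imaginary parts of elements of the space L2 *)

Section ComplexL2.
Context {R : realType}.
Local Notation mu := (@lebesgue_measure R).
Implicit Types (a b k x : R) (s : bool).

(** The flag [true] selects the imaginary part. *)
Definition part s (z : R[i]) : R := if s then Im z else Re z.

Lemma partP (z w : R[i]) : (forall s, part s z = part s w) -> z = w.
Proof.
by move=> h; apply/eqP; rewrite eq_complex -[Re z]/(part false z) -[Im z]/(part true z) !h !eqxx.
Qed.

Lemma partD s (z w : R[i]) : part s (z + w) = part s z + part s w.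
Proof. by case: s; case: z w => [? ?] [? ?]. Qed.

Lemma partZ s k (z : R[i]) : part s (k%:C * z) = k * part s z.
Proof. by case: s; case: z => [u v] /=; rewrite mul0r ?addr0 ?subr0. Qed.

Lemma part0 s : part s 0 = 0. Proof. by case: s. Qed.

Definition part_fun a b s (u : L2 a b) : R -> R := fun x => part s (u x).

Lemma L2_sqr_integrable a b (u : L2 a b) s : sqr_integrable a b (part_fun s u).
Proof.
have := L2valP (repr u); rewrite inE => /andP[hr hi].
by apply/sqr_integrableP; case: s.
Qed.

Lemma L2_eqP a b (u v : L2 a b) :
  (forall s, ae_oo a b (fun x => part_fun s u x = part_fun s v x)) <-> u = v.
Proof.
split=> [h|-> s]; last by apply: ae_ooW.
rewrite -[u]reprK -[v]reprK; apply/L2_piP.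
have := ae_ooS2 _ (h false) (h true); apply => x _ e1 e2.
by apply: partP => -[]; [exact: e2|exact: e1].
Qed.

Lemma L2_pi a b (f : L2fun a b) s : ae_oo a b (fun x => part_fun s (\pi_(L2 a b) f : L2 a b) x = part s (f x)).
Proof.
have : \pi_(L2 a b) (repr (\pi_(L2 a b) f)) = \pi_(L2 a b) f by rewrite reprK.
by move/L2_piP; apply: ae_ooS => x _ /= h; rewrite /part_fun /L2_to_fun h.
Qed.

Lemma L2_partD a b (u v : L2 a b) s :
  ae_oo a b (fun x => part_fun s (u + v) x = part_fun s u x + part_fun s v x).
Proof.
have E : u + v = \pi_(L2 a b) (repr u + repr v).
  by rewrite -[in LHS](reprK u) -[in LHS](reprK v); exact/esym/Quotient.pi_add.
have := L2_pi (repr u + repr v) s; rewrite -E.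
by apply: ae_ooS => x _ ->; exact: partD.
Qed.

Lemma L2_partZ a b k (u : L2 a b) s :
  ae_oo a b (fun x => part_fun s (k%:C *: u) x = k * part_fun s u x).
Proof.
have := L2_pi (k%:C *: repr u) s.
by apply: ae_ooS => x _ ->; rewrite -partZ.
Qed.

Lemma L2_partN a b (u : L2 a b) s :
  ae_oo a b (fun x => part_fun s (- u) x = - part_fun s u x).
Proof.
have E : - u = (-1)%:C *: u by rewrite rmorphN1 scaleN1r.
by rewrite E; apply: ae_ooS (L2_partZ (-1) u s) => x _ ->; rewrite mulN1r.
Qed.

Lemma L2_of_parts a b (f : bool -> R -> R) : (forall s, sqr_integrable a b (f s)) ->
  exists u : L2 a b, forall s, ae_oo a b (fun x => part_fun s u x = f s x).
Proof.
move=> hf.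
pose g : R -> R[i]^o := fun x => (f false x) +i* (f true x).
have hg : g \in L2pred a b.
  by rewrite inE; apply/andP; split; apply/sqr_integrableP; exact: hf.
exists (\pi_(L2 a b) (MkL2fun hg)) => s.
by apply: ae_ooS (L2_pi (MkL2fun hg) s) => x _ ->; case: s.
Qed.

Definition part_dot a b (u v : L2 a b) s : R :=
  integral_oo a b (fun x => part_fun s u x * part_fun s v x).

Lemma L2dot_Re a b (u v : L2 a b) : Re (L2dot u v) = part_dot u v false + part_dot u v true.
Proof.
rewrite /L2dot /Cintegral /= -integral_ooD; last 2 first.
- by apply: sqr_integrableM; exact: L2_sqr_integrable.
- by apply: sqr_integrableM; exact: L2_sqr_integrable.
apply: integral_oo_ext => x _; rewrite /part_fun /part.
by case: (L2_to_fun u x) (L2_to_fun v x) => [? ?] [? ?] /=; rewrite mulrN opprK.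
Qed.

Lemma is_wderivP a b n (u g : L2 a b) : is_wderiv n u g <->
  forall phi s, test_function a b phi ->
    integral_oo a b (fun x => part_fun s u x * derive1n n phi x) =
    (-1) ^+ n * integral_oo a b (fun x => part_fun s g x * phi x).
Proof.
have E (w : L2 a b) (psi : R -> R) s :
    part s (Cintegral `]a, b[ (fun x => w x * (psi x)%:C)) =
    integral_oo a b (fun x => part_fun s w x * psi x).
  case: s; apply: integral_oo_ext => x _; rewrite /part_fun /part;
  by case: (L2_to_fun w x) => [? ?] /=; rewrite mulr0 ?subr0 ?add0r ?addr0.
have sgn : (-1) ^+ n = ((-1) ^+ n)%:C :> R[i] by rewrite rmorphXn rmorphN1.
split=> [h phi s tphi|h phi tphi].
  by rewrite -!E (h _ tphi) sgn partZ.
by apply: partP => s; rewrite sgn partZ !E; exact: h.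
Qed.

End ComplexL2.

(** * Weak derivatives and continuous representatives *)

Section WeakDerivatives.
Context {R : realType}.
Local Notation mu := (@lebesgue_measure R).
Implicit Types (a b k x : R) (s : bool) (m n : nat).

Lemma test_derive1n a b n (phi : R -> R) :
  test_function a b phi -> test_function a b (derive1n n phi).
Proof.
move=> tphi; elim: n => [|n IH]; first by rewrite derive1n0.
by rewrite derive1nS; exact: test_derive1.
Qed.

Lemma test_L2_integrable a b (u : L2 a b) s (phi : R -> R) : test_function a b phi ->
  integrable_oo a b (fun x => part_fun s u x * phi x).
Proof. by move=> tphi; apply: test_integrableM => //;
  exact/sqr_integrable_integrable/L2_sqr_integrable. Qed.

Lemma integral_L2_ae a b (u : L2 a b) s (f phi : R -> R) : measurable_oo a b f ->
  test_function a b phi -> ae_oo a b (fun x => part_fun s u x = f x) ->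
  integral_oo a b (fun x => part_fun s u x * phi x) = integral_oo a b (fun x => f x * phi x).
Proof.
move=> mf tphi uf; have mphi := AC_measurable (test_AC a b tphi).
apply: integral_oo_ae.
- by apply: measurable_funM => //; case: (L2_sqr_integrable u s).
- exact: measurable_funM.
- by apply: ae_ooS uf => x _ ->.
Qed.

Lemma is_wderiv_unique a b n (u g g' : L2 a b) :
  is_wderiv n u g -> is_wderiv n u g' -> g = g'.
Proof.
move=> /is_wderivP h /is_wderivP h'; apply/L2_eqP => s.
have hg := sqr_integrable_integrable (L2_sqr_integrable g s); have hg' :=
  sqr_integrable_integrable (L2_sqr_integrable g' s).
have := test_ae0 (integrable_ooB hg hg'); move=> /(_ _)/wrap[phi tphi|].
  under eq_fun do rewrite mulrBl.
  rewrite integral_ooB; [|exact: test_L2_integrable|exact: test_L2_integrable].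
  have := h phi s tphi; rewrite (h' phi s tphi) => /(congr1 (fun z => (-1) ^+ n * z)).
  by rewrite !mulrA -!exprMn mulrNN mulr1 expr1n !mul1r => ->; rewrite subrr.
by apply: ae_ooS => x _ /eqP; rewrite subr_eq0 => /eqP.
Qed.

Lemma has_wderivP a b n (u : L2 a b) : has_wderiv n u -> is_wderiv n u (wderiv n u).
Proof. by move=> h; exact: (@xgetPex _ 0 [set g | is_wderiv n u g] h). Qed.

Lemma wderivE a b n (u g : L2 a b) : is_wderiv n u g -> wderiv n u = g.
Proof.
move=> h; have hu : has_wderiv n u by exists g.
exact: is_wderiv_unique (has_wderivP hu) h.
Qed.

Lemma is_wderiv_comb a b n k (u v g h : L2 a b) : is_wderiv n u g -> is_wderiv n v h ->
  is_wderiv n (u + k%:C *: v) (g + k%:C *: h).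
Proof.
move=> /is_wderivP ug /is_wderivP vh; apply/is_wderivP => phi s tphi.
have E (w z : L2 a b) (psi : R -> R) : test_function a b psi ->
    integral_oo a b (fun x => part_fun s (w + k%:C *: z) x * psi x) =
    integral_oo a b (fun x => part_fun s w x * psi x) +
      k * integral_oo a b (fun x => part_fun s z x * psi x).
  move=> tpsi; rewrite -integral_ooZ; last exact: test_L2_integrable.
  rewrite -integral_ooD; [|exact: test_L2_integrable|exact/integrable_ooZ/test_L2_integrable].
  rewrite (@integral_L2_ae _ _ _ _ (fun x => part_fun s w x + k * part_fun s z x) psi)//.
  - by apply: integral_oo_ext => x _; ring.
  - apply: measurable_funD; first by case: (L2_sqr_integrable w s).
    by apply: measurable_funM => //; case: (L2_sqr_integrable z s).
  - by apply: ae_ooS2 (L2_partD w (k%:C *: z) s) (L2_partZ k z s) => x _ -> ->.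
rewrite !E//; last exact: test_derive1n.
by rewrite ug// vh//; ring.
Qed.

Lemma wderiv_comb a b n k (u v : L2 a b) : has_wderiv n u -> has_wderiv n v ->
  wderiv n (u + k%:C *: v) = wderiv n u + k%:C *: wderiv n v.
Proof. by move=> /has_wderivP hu /has_wderivP hv; apply: wderivE; exact: is_wderiv_comb. Qed.

Lemma AC_is_wderiv a b (u g : L2 a b) (F f : bool -> R -> R) : a <= b ->
  (forall s, AC a b (F s) (f s)) ->
  (forall s, ae_oo a b (fun x => part_fun s u x = F s x)) ->
  (forall s, ae_oo a b (fun x => part_fun s g x = f s x)) -> is_wderiv 1 u g.
Proof.
move=> ab hF uF gf; apply/is_wderivP => phi s tphi.
rewrite expr1 mulN1r derive1n1 (integral_L2_ae _ _ (uF s)); last 2 first.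
- exact: AC_measurable (hF s).
- exact: test_derive1.
rewrite (integral_L2_ae _ _ (gf s))//; last by apply: integrable_oo_measurable; case: (hF s).
exact: AC_test.
Qed.

Lemma derive1n_add m n (phi : R -> R) : derive1n m (derive1n n phi) = derive1n (m + n) phi.
Proof. by rewrite /derive1n iterD. Qed.

Lemma is_wderiv_comp a b m n (u g h : L2 a b) :
  is_wderiv m u g -> is_wderiv n g h -> is_wderiv (m + n) u h.
Proof.
move=> /is_wderivP ug /is_wderivP gh; apply/is_wderivP => phi s tphi.
rewrite -derive1n_add ug; last exact: test_derive1n.
by rewrite gh// mulrA -exprD.
Qed.

(** Test functions are stable under differentiation, so a weak derivative of
    order m + n can be tested against derivatives of order n only. *)
Lemma is_wderiv_quot a b m n (u g h : L2 a b) :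
  is_wderiv m u g -> is_wderiv (m + n) u h -> is_wderiv n g h.
Proof.
move=> /is_wderivP ug /is_wderivP uh; apply/is_wderivP => phi s tphi.
have := uh phi s tphi; rewrite -derive1n_add ug; last exact: test_derive1n.
rewrite exprD -mulrA => /(congr1 (fun z => (-1) ^+ m * z)).
by rewrite !mulrA -!exprMn mulrNN mulr1 expr1n !mul1r.
Qed.

(** Two continuous functions that agree almost everywhere agree on the closed
    interval, so any continuous representative computes [crepr]. *)
Lemma crepr_eq a b (u : L2 a b) (F : bool -> R -> R) : a < b ->
  (forall s, {within `[a, b], continuous (F s)}) ->
  (forall s, ae_oo a b (fun x => F s x = part_fun s u x)) ->
  forall s x, a <= x <= b -> part s (crepr u x) = F s x.
Proof.
move=> ab cF Fu.
have : [set f : R -> R[i] |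
    [/\ {within `[a, b], continuous (Re \o f)},
        {within `[a, b], continuous (Im \o f)} &
        {ae mu, forall x, `]a, b[%classic x -> f x = u x}]]
    (fun x => F false x +i* F true x).
  split; [exact: cF|exact: cF|].
  apply: ae_ooS2 (Fu false) (Fu true) => x _ e1 e2.
  by apply: partP => -[].
move=> /(@xgetI _ (fun=> 0))[]; rewrite -/(crepr u) => cR cI uE s x xab.
apply/eqP; rewrite -subr_eq0; apply/eqP.
apply: (@continuous_ae0 _ a b (fun x => part s (crepr u x) - F s x)) => //.
  by move=> y; apply: cvgB; [case: s; [exact: cI|exact: cR]|exact: cF].
apply: ae_ooS2 (Fu s) uE => y _ -> ->.
by rewrite /part_fun subrr.
Qed.

Lemma wderiv1_AC a b (u g : L2 a b) s : a < b -> is_wderiv 1 u g ->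
  AC a b (fun x => part s (crepr u x)) (part_fun s g) /\
  ae_oo a b (fun x => part s (crepr u x) = part_fun s u x).
Proof.
move=> ab /is_wderivP ug.
have h t : exists F, AC a b F (part_fun t g) /\ ae_oo a b (fun x => F x = part_fun t u x).
  have [||phi tphi|F h1 h2] := @weak_derivative_AC R a b (part_fun t u) (part_fun t g) ab.
  - exact/sqr_integrable_integrable/L2_sqr_integrable.
  - exact/sqr_integrable_integrable/L2_sqr_integrable.
  - by have := ug phi t tphi; rewrite derive1n1 expr1 mulN1r.
  - by exists F.
have [F0 [h0 e0]] := h false; have [F1 [h1 e1]] := h true.
pose F t := if t then F1 else F0.
have hF t : AC a b (F t) (part_fun t g) by case: t.
have eF t : ae_oo a b (fun x => F t x = part_fun t u x) by case: t.
have E := @crepr_eq a b u F ab (fun t => AC_continuous (ltW ab) (hF t)) eF.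
split.
  by apply: AC_ext (hF s) => // x xab; rewrite E.
apply: ae_ooS (eF s) => x /andP[ax xb] <-.
by rewrite E// !ltW.
Qed.

Lemma is_wderiv2_split a b (u h : L2 a b) : a < b -> is_wderiv 2 u h ->
  exists2 g, is_wderiv 1 u g & is_wderiv 1 g h.
Proof.
move=> ab uh; have /is_wderivP uh' := uh.
have H t : exists G, AC a b G (part_fun t h) /\ forall phi, test_function a b phi ->
    integral_oo a b (fun x => part_fun t u x * derive1 phi x) = -
      integral_oo a b (fun x => G x * phi x).
  have [||phi tphi|G h1 h2] := @second_weak_derivative_AC R a b (part_fun t u) (part_fun t h) ab.
  - exact/sqr_integrable_integrable/L2_sqr_integrable.
  - exact/sqr_integrable_integrable/L2_sqr_integrable.
  - have := uh' phi t tphi; rewrite sqrrN expr1n mul1r.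
    by rewrite (derive1nS phi 1) derive1n1.
  - by exists G.
have [G0 [h0 e0]] := H false; have [G1 [h1 e1]] := H true.
pose G t := if t then G1 else G0.
have hG t : AC a b (G t) (part_fun t h) by case: t.
have eG t phi : test_function a b phi ->
    integral_oo a b (fun x => part_fun t u x * derive1 phi x) = -
      integral_oo a b (fun x => G t x * phi x).
  by case: t => tphi; [exact: e1|exact: e0].
have [g gE] := L2_of_parts (fun t => AC_sqr_integrable (hG t)).
have ug : is_wderiv 1 u g.
  apply/is_wderivP => phi t tphi; rewrite derive1n1 expr1 mulN1r eG//.
  by rewrite (integral_L2_ae _ _ (gE t))//; exact: AC_measurable (hG t).
by exists g => //; exact: (@is_wderiv_quot a b 1 1 u).
Qed.

End WeakDerivatives.

(** * Integral inequalities and explicit profiles *)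

Section IntegralInequalities.
Context {R : realType}.
Implicit Types (a b k x : R) (f g h F G : R -> R).

(** The discriminant of a quadratic that is nonnegative everywhere; when C =
    0, an affine function that is bounded below must be constant. *)
Lemma quad_discr (A B C : R) : 0 <= C ->
  (forall t, 0 <= A + 2 * t * B + t ^+ 2 * C) -> B ^+ 2 <= A * C.
Proof.
move=> C0 h; have [C1|C1] := eqVneq C 0; last first.
  have := h (- B / C); have Cp : 0 < C by rewrite lt_neqAle eq_sym C1.
  have -> : A + 2 * (- B / C) * B + (- B / C) ^+ 2 * C = (A * C - B ^+ 2) / C.
    by field.
  by rewrite pmulr_lge0 ?invr_gt0// subr_ge0.
have A0 : 0 <= A by have := h 0; rewrite mulr0 mul0r expr0n/= mul0r !addr0.
have [B0|B0] := eqVneq B 0; first by rewrite B0 expr0n/= mulr_ge0.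
have := h (- (A + 1) / (2 * B)).
rewrite C1 mulr0 addr0.
have -> : A + 2 * (- (A + 1) / (2 * B)) * B = - 1 by field.
by rewrite oppr_ge0 ler10.
Qed.

Lemma integral_sqr_ge0 a b f : 0 <= integral_oo a b (fun x => f x ^+ 2).
Proof. by apply: integral_oo_ge0 => x _; exact: sqr_ge0. Qed.

Lemma cauchy_schwarz a b f g : sqr_integrable a b f -> sqr_integrable a b g ->
  integral_oo a b (fun x => f x * g x) ^+ 2 <=
  integral_oo a b (fun x => f x ^+ 2) * integral_oo a b (fun x => g x ^+ 2).
Proof.
move=> hf hg; have hfg := sqr_integrableM hf hg; have [_ f2] := hf; have [_ g2] := hg.
apply: quad_discr; first exact: integral_sqr_ge0.
move=> t; rewrite -!integral_ooZ// -integral_ooD//; last exact: integrable_ooZ.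
rewrite -integral_ooD; [|by apply: integrable_ooD => //; exact: integrable_ooZ|exact: integrable_ooZ].
apply: integral_oo_ge0 => x _.
have -> : f x ^+ 2 + 2 * t * (f x * g x) + t ^+ 2 * g x ^+ 2 = (f x + t * g x) ^+ 2.
  by ring.
exact: sqr_ge0.
Qed.

Lemma sqr_integral_le a b f : a <= b -> sqr_integrable a b f ->
  integral_oo a b f ^+ 2 <= (b - a) * integral_oo a b (fun x => f x ^+ 2).
Proof.
move=> ab hf; have := cauchy_schwarz (sqr_integrable_cst a b 1) hf.
by rewrite integral_oo_cst// expr1n mul1r; congr (_ ^+ 2 <= _); apply: integral_oo_ext => x _;
  rewrite mul1r.
Qed.

Lemma young k (x y : R) : 0 < k -> x * y <= k * x ^+ 2 + (4 * k)^-1 * y ^+ 2.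
Proof.
move=> k0; rewrite -subr_ge0.
have -> : k * x ^+ 2 + (4 * k)^-1 * y ^+ 2 - x * y =
   k * (x - (2 * k)^-1 * y) ^+ 2 by field; rewrite gt_eqF.
by rewrite mulr_ge0 ?sqr_ge0// ltW.
Qed.

Lemma AC_id a b : AC a b (fun x => x) (fun=> 1).
Proof.
apply: AC_ext (AC_poly a b 'X) => x _; first by rewrite hornerX.
by rewrite derivX hornerC.
Qed.

Lemma AC_sub a b k : AC a b (fun x => x - k) (fun=> 1).
Proof. by apply: AC_ext (AC_D (AC_id a b) (AC_cst a b (- k))) => x _ //=; rewrite addr0. Qed.

Lemma AC_N a b F f : AC a b F f -> AC a b (fun x => - F x) (fun x => - f x).
Proof. by move=> h; apply: AC_ext (AC_Z (-1) h) => x _; rewrite mulN1r. Qed.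

Lemma AC_B a b F f G g : AC a b F f -> AC a b G g ->
  AC a b (fun x => F x - G x) (fun x => f x - g x).
Proof. by move=> hF hG; exact: AC_D hF (AC_N hG). Qed.

Lemma AC_X2 a b F f : AC a b F f -> AC a b (fun x => F x ^+ 2) (fun x => 2 * (F x * f x)).
Proof. by move=> h; apply: AC_ext (AC_M h h) => x _; ring. Qed.

(** The cubics that vanish to second order at the clamped end e. They are used
    both to test the weak transmission conditions and as static profiles;
    [clamped_cubic1] and [clamped_cubic2] are the first two derivatives. *)
Definition clamped_cubic e A B x : R := A * (x - e) ^+ 3 + B * (x - e) ^+ 2.
Definition clamped_cubic1 e A B x : R := 3 * A * (x - e) ^+ 2 + 2 * B * (x - e).
Definition clamped_cubic2 e A B x : R := 6 * A * (x - e) + 2 * B.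

Lemma AC_clamped_cubic a b e A B : AC a b (clamped_cubic e A B) (clamped_cubic1 e A B).
Proof.
have h2 := AC_X2 (AC_sub a b e); have h3 := AC_M h2 (AC_sub a b e).
by apply: AC_ext (AC_D (AC_Z A h3) (AC_Z B h2)) => x _; rewrite /clamped_cubic /clamped_cubic1; ring.
Qed.

Lemma AC_clamped_cubic1 a b e A B : AC a b (clamped_cubic1 e A B) (clamped_cubic2 e A B).
Proof.
have h1 := AC_sub a b e; have h2 := AC_X2 h1.
by apply: AC_ext (AC_D (AC_Z (3 * A) h2) (AC_Z (2 * B) h1)) => x _;
  rewrite /clamped_cubic1 /clamped_cubic2; ring.
Qed.

Lemma AC_clamped_cubic2 a b e A B : AC a b (clamped_cubic2 e A B) (fun=> 6 * A).
Proof.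
by apply: AC_ext (AC_D (AC_Z (6 * A) (AC_sub a b e)) (AC_cst a b (2 * B))) => x _;
  rewrite /clamped_cubic2; ring.
Qed.

Definition affine a b A B x : R := A + (B - A) / (b - a) * (x - a).

Lemma AC_affine a b A B : AC a b (affine a b A B) (fun=> (B - A) / (b - a)).
Proof.
by apply: AC_ext (AC_D (AC_cst a b A) (AC_Z ((B - A) / (b - a)) (AC_sub a b a))) => x _;
  rewrite /affine ?add0r ?mulr1.
Qed.

End IntegralInequalities.

(** * Multipliers on a beam *)

Section BeamIdentities.
Context {R : realType}.
Variables (a b e : R) (f0 f1 f2 f3 f4 y0 y1 : R -> R).
Hypotheses (ab : a <= b) (h0 : AC a b f0 f1) (h1 : AC a b f1 f2)
  (h2 : AC a b f2 f3) (h3 : AC a b f3 (fun x => - f4 x)) (hy : AC a b y0 y1).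

Lemma beam_load_integrable : integrable_oo a b f4.
Proof.
by case: h3 => + _ => /integrable_ooN; apply: integrable_oo_ext => x _; rewrite opprK.
Qed.

(** The multiplier (x - e) f1 for the beam equation: H collects the boundary
    terms of the integrations by parts, and what remains is negative in both
    the bending and the kinetic energy. *)
Lemma beam_multiplier :
  let H x := - (f3 x * ((x - e) * f1 x)) + f2 x * f1 x
    + ((x - e) * f2 x ^+ 2) / 2 + (x - e) * y0 x ^+ 2 / 2 in
  integral_oo a b (fun x => f4 x * ((x - e) * f1 x)) +
  integral_oo a b (fun x => y0 x * ((x - e) * y1 x)) =
  H b - H a - 3 / 2 * integral_oo a b (fun x => f2 x ^+ 2) -
    1 / 2 * integral_oo a b (fun x => y0 x ^+ 2).
Proof.
move=> H.
have hq := AC_sub a b e.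
have hH := AC_D (AC_D (AC_D (AC_N (AC_M h3 (AC_M hq h1))) (AC_M h2 h1))
  (AC_Z 2^-1 (AC_M hq (AC_X2 h2)))) (AC_Z 2^-1 (AC_M hq (AC_X2 hy))).
have {}hH : AC a b H (fun x => f4 x * ((x - e) * f1 x) + y0 x * ((x - e) * y1 x)
    + (3 / 2 * f2 x ^+ 2 + 1 / 2 * y0 x ^+ 2)).
  by apply: AC_ext hH => x _; rewrite /H; field.
have i1 : integrable_oo a b (fun x => f4 x * ((x - e) * f1 x)).
  by apply: (integrable_oo_ext _ (AC_integrableM (AC_M hq h1) beam_load_integrable)) => x _; ring.
have i2 : integrable_oo a b (fun x => y0 x * ((x - e) * y1 x)).
  case: hy => iy1 _.
  by apply: (integrable_oo_ext _ (AC_integrableM (AC_M hq hy) iy1)) => x _; ring.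
have i3 : integrable_oo a b (fun x => f2 x ^+ 2) by case: (AC_sqr_integrable h2).
have i4 : integrable_oo a b (fun x => y0 x ^+ 2) by case: (AC_sqr_integrable hy).
have := AC_integral ab hH; rewrite integral_ooD;
  [|exact: integrable_ooD|by apply: integrable_ooD; exact: integrable_ooZ].
rewrite integral_ooD// integral_ooD; [|exact: integrable_ooZ|exact: integrable_ooZ].
by rewrite !integral_ooZ// => <-; ring.
Qed.

Lemma beam_test A B :
  let H x := - (f3 x * clamped_cubic e A B x) + f2 x * clamped_cubic1 e A B x in
  integral_oo a b (fun x => f4 x * clamped_cubic e A B x) +
    integral_oo a b (fun x => f2 x * clamped_cubic2 e A B x) = H b - H a.
Proof.
move=> H.
have hc := AC_clamped_cubic a b e A B; have hc1 := AC_clamped_cubic1 a b e A B; have hc2 :=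
  AC_clamped_cubic2 a b e A B.
have i1 : integrable_oo a b (fun x => f4 x * clamped_cubic e A B x).
  by apply: (integrable_oo_ext _ (AC_integrableM hc beam_load_integrable)) => x _; ring.
have i2 : integrable_oo a b (fun x => f2 x * clamped_cubic2 e A B x) by exact: AC_integrable (AC_M h2 hc2).
rewrite -integral_ooD//; apply: AC_integral => //.
apply: AC_ext (AC_D (AC_N (AC_M h3 hc)) (AC_M h2 hc1)) => x _; rewrite /H //; ring.
Qed.

Lemma beam_clamped_cubic2 A B :
  let H x := f1 x * clamped_cubic2 e A B x - 6 * A * f0 x in
  integral_oo a b (fun x => f2 x * clamped_cubic2 e A B x) = H b - H a.
Proof.
move=> H; apply: AC_integral => //; have hc2 := AC_clamped_cubic2 a b e A B.
by apply: AC_ext (AC_B (AC_M h1 hc2) (AC_Z (6 * A) h0)) => x _; rewrite /H //; ring.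
Qed.

End BeamIdentities.

Section BeamEstimates.
Context {R : realType}.
Variables (a b : R) (f0 f1 f2 f3 f4 y0 y1 : R -> R).
Hypotheses (ab : a < b) (h1 : AC a b f1 f2)
  (h2 : AC a b f2 f3) (h3 : AC a b f3 (fun x => - f4 x)) (hy : AC a b y0 y1).

(** Serves to absorb half of the bending energy w when t is the slope at the
    free end. *)
Lemma trace_young (t w : R) : t ^+ 2 <= (b - a) * w -> forall g : R,
  (b - a) * (g * t) <= 1 / 2 * w + (b - a) ^+ 3 / 2 * g ^+ 2.
Proof.
move=> tw g; have ba : 0 < b - a by rewrite subr_gt0.
have h2' : (b - a) * (g * t) <= (b - a) ^+ 3 / 2 * g ^+ 2 + t ^+ 2 / (2 * (b - a)).
  have E1 : (b - a) * (g * t) = (b - a) ^+ 2 * (g * (t / (b - a))).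
    by field; rewrite gt_eqF.
  have k0 : 0 < (b - a) / 2 by rewrite divr_gt0.
  have := @young R ((b - a) / 2) g (t / (b - a)) k0.
  move=> /(ler_wpM2l (sqr_ge0 (b - a))); rewrite -E1 => /le_trans; apply.
  by rewrite le_eqVlt; apply/orP; left; apply/eqP; field; rewrite gt_eqF.
apply: (le_trans h2'); rewrite addrC lerD2r ler_pdivrMr ?mulr_gt0//.
by apply: (le_trans tw); rewrite le_eqVlt; apply/orP; left; apply/eqP; field.
Qed.

(** The factor x - a kills the boundary terms at the clamped end, except the
    one with f1, which vanishes there. At the free end, f2 b = 0 leaves the
    shear force f3 b against the slope f1 b, and the latter is controlled by
    the bending energy. *)
Lemma beam_left : f1 a = 0 -> f2 b = 0 ->
  integral_oo a b (fun x => f4 x * ((x - a) * f1 x)) +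
  integral_oo a b (fun x => y0 x * ((x - a) * y1 x)) <=
  - integral_oo a b (fun x => f2 x ^+ 2) - 1 / 2 * integral_oo a b (fun x => y0 x ^+ 2)
  + (b - a) ^+ 3 / 2 * f3 b ^+ 2 + (b - a) / 2 * y0 b ^+ 2.
Proof.
move=> f1a f2b; rewrite (beam_multiplier a (ltW ab) h1 h2 h3 hy) /=.
rewrite f1a f2b subrr !mulr0 !mul0r expr0n/= !mulr0 !mul0r oppr0 !addr0 subr0.
have tr : f1 b ^+ 2 <= (b - a) * integral_oo a b (fun x => f2 x ^+ 2).
  have -> : f1 b = integral_oo a b f2 by rewrite (AC_integral (ltW ab) h1) f1a subr0.
  exact: sqr_integral_le (ltW ab) (AC_sqr_integrable h2).
have := trace_young tr (- f3 b).
by rewrite sqrrN mulNr; lra.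
Qed.

Lemma beam_right : f1 b = 0 -> f2 a = 0 ->
  integral_oo a b (fun x => f4 x * ((x - b) * f1 x)) +
  integral_oo a b (fun x => y0 x * ((x - b) * y1 x)) <=
  - integral_oo a b (fun x => f2 x ^+ 2) - 1 / 2 * integral_oo a b (fun x => y0 x ^+ 2)
  + (b - a) ^+ 3 / 2 * f3 a ^+ 2 + (b - a) / 2 * y0 a ^+ 2.
Proof.
move=> f1b f2a; rewrite (beam_multiplier b (ltW ab) h1 h2 h3 hy) /=.
rewrite f1b f2a subrr !mulr0 !mul0r expr0n/= !mulr0 !mul0r oppr0 !addr0 add0r.
have tr : f1 a ^+ 2 <= (b - a) * integral_oo a b (fun x => f2 x ^+ 2).
  have -> : f1 a = - integral_oo a b f2 by rewrite (AC_integral (ltW ab) h1) f1b sub0r opprK.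
  by rewrite sqrrN; exact: sqr_integral_le (ltW ab) (AC_sqr_integrable h2).
have := trace_young tr (- f3 a).
by rewrite sqrrN mulNr; lra.
Qed.

End BeamEstimates.

(** * Multipliers on the damped string *)

Section WaveEstimates.
Context {R : realType}.
Variables (a b beta : R) (v0 v1 dv z0 z1 : R -> R).
Hypotheses (ab : a < b) (h0 : AC a b v0 v1)
  (h1 : AC a b v1 (fun x => dv x + beta * z0 x)) (hz : AC a b z0 z1).

(** Equal to 1 at a and to -1 at b, which gives the boundary terms at both
    ends the favourable sign. *)
Definition sweep x : R := (a + b - 2 * x) / (b - a).

(** For g = v' this is v minus the affine function with the same values at a
    and b. *)
Definition pinned_primitive (g : R -> R) x : R :=
  integral_oo a x g - (x - a) / (b - a) * integral_oo a b g.

(** It vanishes at a and b, so that the moment of the derivative of the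
    velocity against it is controlled by the velocity itself. *)
Definition hump x : R := (x - a) * (b - x).

Let ba0 : 0 < b - a. Proof. by rewrite subr_gt0. Qed.
Let ban0 : b - a != 0. Proof. by rewrite gt_eqF. Qed.
Local Notation P := (integral_oo a b (fun x => v1 x ^+ 2)).
Local Notation X := (integral_oo a b (fun x => z0 x ^+ 2)).
Local Notation delta := (v0 b - v0 a).
Local Notation P' := (P - delta ^+ 2 / (b - a)).

Lemma AC_sweep : AC a b sweep (fun=> - 2 / (b - a)).
Proof.
apply: AC_ext (AC_Z (- 2 / (b - a)) (AC_sub a b ((a + b) / 2))) => x _.
  by rewrite /sweep; field.
by rewrite mulr1.
Qed.

Lemma wave_load_integrable : integrable_oo a b dv.
Proof.
case: h1 => h _; apply: (integrable_oo_ext _ (integrable_ooB h (integrable_ooZ beta (AC_integrable hz)))) => x _.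
by rewrite addrK.
Qed.

Lemma velocity_derivative_integrable : integrable_oo a b z1. Proof. by case: hz. Qed.

Lemma sweep_bound x : a < x < b -> sweep x ^+ 2 <= 1.
Proof.
move=> /andP[ax xb]; rewrite /sweep expr_div_n ler_pdivrMr ?exprn_gt0//.
by nra.
Qed.

(** The boundary terms of the multiplier [sweep] v' have a good sign, at the
    price of the potential energy P, which the other multipliers recover. *)
Lemma wave_sweep :
  integral_oo a b (fun x => dv x * (sweep x * v1 x)) +
    integral_oo a b (fun x => z0 x * (sweep x * z1 x)) <=
  - 1 / 2 * (v1 a ^+ 2 + v1 b ^+ 2 + z0 a ^+ 2 + z0 b ^+ 2)
  + ((b - a)^-1 + 1 / 2) * P + ((b - a)^-1 + beta ^+ 2 / 2) * X.
Proof.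
have hs := AC_sweep.
have hs1 := AC_M hs h1; have hsz := AC_M hs hz.
have iP : integrable_oo a b (fun x => v1 x ^+ 2) by case: (AC_sqr_integrable h1).
have iX : integrable_oo a b (fun x => z0 x ^+ 2) by case: (AC_sqr_integrable hz).
have i1 : integrable_oo a b (fun x => dv x * (sweep x * v1 x)).
  by apply: (integrable_oo_ext _ (AC_integrableM hs1 wave_load_integrable)) => x _; ring.
have i2 : integrable_oo a b (fun x => z0 x * (sweep x * z1 x)).
  by apply: (integrable_oo_ext _ (AC_integrableM hsz velocity_derivative_integrable)) => x _; ring.
have i3 : integrable_oo a b (fun x => beta * z0 x * (sweep x * v1 x)).
  by apply: (integrable_oo_ext _ (integrable_ooZ beta (AC_integrable (AC_M hs1 hz)))) => x _; ring.
have hH := AC_Z (1 / 2) (AC_M hs (AC_D (AC_X2 h1) (AC_X2 hz))).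
have E := AC_integral (ltW ab) hH.
have : integral_oo a b (fun x => dv x * (sweep x * v1 x) + z0 x * (sweep x * z1 x)
     + (beta * z0 x * (sweep x * v1 x)
     - (b - a)^-1 * (v1 x ^+ 2 + z0 x ^+ 2))) = -
       1 / 2 * (v1 a ^+ 2 + v1 b ^+ 2 + z0 a ^+ 2 + z0 b ^+ 2).
  rewrite -[RHS](_ : 1 / 2 * (sweep b * (v1 b ^+ 2 + z0 b ^+ 2)) -
    1 / 2 * (sweep a * (v1 a ^+ 2 + z0 a ^+ 2)) = _); last first.
    by rewrite /sweep; field.
  by rewrite -E; apply: integral_oo_ext => x _; field.
rewrite integral_ooD; [|exact: integrable_ooD|by apply: integrable_ooB => //;
  apply: integrable_ooZ; exact: integrable_ooD].
rewrite integral_ooD// integral_ooB//; last by apply: integrable_ooZ; exact: integrable_ooD.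
rewrite integral_ooZ; [rewrite integral_ooD//|exact: integrable_ooD].
have : - integral_oo a b (fun x => beta * z0 x * (sweep x * v1 x)) <= 1 / 2 * P + beta ^+ 2 / 2 * X.
  rewrite -integral_ooN// -!integral_ooZ// -integral_ooD;
    [|exact: integrable_ooZ|exact: integrable_ooZ].
  apply: le_integral_oo; [exact: integrable_ooN|by apply: integrable_ooD; exact: integrable_ooZ|].
  move=> x /sweep_bound; set s := sweep x => s1.
  have := sqr_ge0 (beta * z0 x + s * v1 x); have := sqr_ge0 (v1 x).
  by move: (v1 x) (z0 x) => u w *; nra.
by lra.
Qed.

(** The mean of v1 over the interval is (v0 b - v0 a) / (b - a). *)
Lemma integral_deviation : integral_oo a b (fun x => (v1 x - delta / (b - a)) ^+ 2) = P'.
Proof.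
have iP : integrable_oo a b (fun x => v1 x ^+ 2) by case: (AC_sqr_integrable h1).
have i1 : integrable_oo a b v1 by exact: AC_integrable h1.
transitivity (integral_oo a b (fun x => v1 x ^+ 2 + ((- 2 * (delta / (b - a))) * v1 x + (delta / (b - a)) ^+ 2))).
  by apply: integral_oo_ext => x _; ring.
rewrite integral_ooD//; last by apply: integrable_ooD;
  [exact: integrable_ooZ|exact: integrable_oo_cst].
rewrite integral_ooD//; [|exact: integrable_ooZ|exact: integrable_oo_cst].
rewrite integral_ooZ// integral_oo_cst ?(ltW ab)// (AC_integral (ltW ab) h0); by field.
Qed.

Lemma deviation_ge0 : 0 <= P'.
Proof. by rewrite -integral_deviation; exact: integral_sqr_ge0. Qed.

Lemma deviation_sqr_integrable : sqr_integrable a b (fun x => v1 x - delta / (b - a)).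
Proof. exact: AC_sqr_integrable (AC_B h1 (AC_cst a b _)). Qed.

Lemma AC_pinned_primitive g : integrable_oo a b g ->
  AC a b (pinned_primitive g) (fun x => g x - integral_oo a b g / (b - a)).
Proof.
move=> hg; have := AC_B (AC_primitive 0 hg) (AC_Z (integral_oo a b g / (b - a)) (AC_sub a b a)).
by apply: AC_ext => x _; rewrite /pinned_primitive; [ring|rewrite mulr1].
Qed.

Lemma pinned_primitive_AC g g' G : AC a b G g -> AC a b g g' ->
  AC a b (pinned_primitive g) (fun x => g x - (G b - G a) / (b - a)).
Proof. by move=> hG hg; rewrite -(AC_integral (ltW ab) hG);
  exact: AC_pinned_primitive (AC_integrable hg). Qed.

Lemma pinned_primitive_left g : pinned_primitive g a = 0.
Proof. by rewrite /pinned_primitive integral_oo_point subrr !mul0r subr0. Qed.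

Lemma pinned_primitive_right g : pinned_primitive g b = 0.
Proof. by rewrite /pinned_primitive divff// mul1r subrr. Qed.

(** The multiplier is v minus its affine interpolant, so no boundary term with
    v' appears, and what it controls is the deviation of v' from its mean. The
    time derivative of the interpolant involves the boundary velocities, which
    enter with an arbitrarily small factor because they are multiplied by the
    velocity, and this is damped. *)
Lemma wave_pinned : forall eps, 0 < eps ->
  integral_oo a b (fun x => dv x * pinned_primitive v1 x) +
    integral_oo a b (fun x => z0 x * pinned_primitive z1 x) <=
  - 1 / 2 * P' + eps * (z0 a ^+ 2 + z0 b ^+ 2)
  + (beta ^+ 2 * (b - a) ^+ 2 / 2 + 1 + (b - a) / (4 * eps)) * X.
Proof.
move=> eps eps0.
have hJ := pinned_primitive_AC h0 h1.
have iX : integrable_oo a b (fun x => z0 x ^+ 2) by case: (AC_sqr_integrable hz).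
have [_ iJ2] := AC_sqr_integrable hJ.
have sqz := AC_sqr_integrable hz.
have i1 : integrable_oo a b (fun x => dv x * pinned_primitive v1 x).
  by apply: (integrable_oo_ext _ (AC_integrableM hJ wave_load_integrable)) => x _; ring.
have i2 : integrable_oo a b (fun x => beta * (z0 x * pinned_primitive v1 x)).
  by apply: integrable_ooZ; exact: AC_integrable (AC_M hz hJ).
have i3 : integrable_oo a b (fun x => v1 x * (v1 x - delta / (b - a))).
  exact: AC_integrable (AC_M h1 (AC_B h1 (AC_cst a b _))).
have E1 : integral_oo a b (fun x => dv x * pinned_primitive v1 x) =
    - P' - integral_oo a b (fun x => beta * (z0 x * pinned_primitive v1 x)).
  have := AC_integral (ltW ab) (AC_M h1 hJ).
  rewrite pinned_primitive_left pinned_primitive_right !mulr0 subrr.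
  have -> : integral_oo a b (fun x => (dv x + beta * z0 x) * pinned_primitive v1 x +
    v1 x * (v1 x - delta / (b - a))) =
     integral_oo a b (fun x => dv x * pinned_primitive v1 x) +
       integral_oo a b (fun x => beta * (z0 x * pinned_primitive v1 x))
     + integral_oo a b (fun x => v1 x * (v1 x - delta / (b - a))).
    rewrite -!integral_ooD//; last exact: integrable_ooD.
    by apply: integral_oo_ext => x _; ring.
  have -> : integral_oo a b (fun x => v1 x * (v1 x - delta / (b - a))) = P'.
    have iP : integrable_oo a b (fun x => v1 x ^+ 2) by case: (AC_sqr_integrable h1).
    have iv1 : integrable_oo a b v1 by exact: AC_integrable h1.
    transitivity (integral_oo a b (fun x => v1 x ^+ 2 - (delta / (b - a)) * v1 x)).
      by apply: integral_oo_ext => x _; ring.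
    rewrite integral_ooB//; last exact: integrable_ooZ.
    by rewrite integral_ooZ// (AC_integral (ltW ab) h0); field.
  by lra.
(* pointwise bound of the multiplier by the deviation of v1 from its mean *)
have J2 x : a < x < b -> pinned_primitive v1 x ^+ 2 <= (b - a) * P'.
  move=> /andP[ax xb].
  have hJx : AC a x (pinned_primitive v1) (fun x => v1 x - delta / (b - a)).
    by apply: ACS hJ => //; exact: ltW.
  have sqx : sqr_integrable a x (fun x => v1 x - delta / (b - a)).
    exact: AC_sqr_integrable (ACS (lexx a) (ltW ax) (ltW xb) (AC_B h1 (AC_cst a b _))).
  have -> : pinned_primitive v1 x = integral_oo a x (fun x => v1 x - delta / (b - a)).
    by rewrite (AC_integral (ltW ax) hJx) pinned_primitive_left subr0.
  apply: (le_trans (sqr_integral_le (ltW ax) sqx)).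
  have [_ dsq] := deviation_sqr_integrable.
  have split2 := @integral_oo_split _ a b x (fun x => (v1 x - delta / (b - a)) ^+ 2).
  rewrite -integral_deviation split2 ?(ltW ax) ?(ltW xb)//.
  have := integral_sqr_ge0 a x (fun x => v1 x - delta / (b - a)).
  have := integral_sqr_ge0 x b (fun x => v1 x - delta / (b - a)).
  move: (integral_oo a x _) (integral_oo x b _) => p q q0 p0.
  have xa0 : 0 <= x - a by lra.
  have bx0 : 0 <= b - x by lra.
  have := mulr_ge0 bx0 p0; have := mulr_ge0 bx0 q0; have := mulr_ge0 xa0 q0.
  by nra.
have E2 : - integral_oo a b (fun x => beta * (z0 x * pinned_primitive v1 x)) <=
    1 / 2 * P' + beta ^+ 2 * (b - a) ^+ 2 / 2 * X.
  have -> : 1 / 2 * P' = integral_oo a b (fun=> P' / (2 * (b - a))).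
    by rewrite integral_oo_cst ?(ltW ab)//; field.
  rewrite -integral_ooN// -integral_ooZ// -integral_ooD;
    [|exact: integrable_oo_cst|exact: integrable_ooZ].
  apply: le_integral_oo; [exact: integrable_ooN|by apply: integrable_ooD;
    [exact: integrable_oo_cst|exact: integrable_ooZ]|].
  move=> x xab.
  have k0 : 0 < (2 * (b - a) ^+ 2)^-1 by rewrite invr_gt0 mulr_gt0 ?exprn_gt0.
  have := @young R (2 * (b - a) ^+ 2)^-1 (pinned_primitive v1 x) (- (beta * z0 x)) k0.
  rewrite mulrN mulrCA (mulrC (pinned_primitive _ _)) => /le_trans; apply; apply: lerD.
    apply: (@le_trans _ _ ((2 * (b - a) ^+ 2)^-1 * ((b - a) * P'))).
      by rewrite ler_wpM2l ?(ltW k0)//; exact: J2.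
    by rewrite le_eqVlt; apply/orP; left; apply/eqP; field.
  by rewrite le_eqVlt; apply/orP; left; apply/eqP; field.
have sqJz : integral_oo a b (fun x => z0 x * pinned_primitive z1 x) <=
   eps * (z0 a ^+ 2 + z0 b ^+ 2) + (1 + (b - a) / (4 * eps)) * X.
  have -> : eps * (z0 a ^+ 2 + z0 b ^+ 2) =
    integral_oo a b (fun=> eps / (b - a) * (z0 a ^+ 2 + z0 b ^+ 2)).
    by rewrite integral_oo_cst ?(ltW ab)//; field.
  have hJz : forall x, a < x < b -> pinned_primitive z1 x =
    z0 x - ((b - x) / (b - a) * z0 a + (x - a) / (b - a) * z0 b).
    move=> x /andP[ax xb]; rewrite /pinned_primitive.
    have hzx : AC a x z0 z1 by apply: ACS hz => //; exact: ltW.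
    rewrite (AC_integral (ltW ab) hz) (AC_integral (ltW ax) hzx); by field.
  have hK : AC a b (fun x => z0 x - ((b - x) / (b - a) * z0 a + (x - a) / (b - a) * z0 b))
      (fun x => z1 x - (z0 b - z0 a) / (b - a)).
    have h := AC_B hz (AC_D (AC_cst a b (z0 a)) (AC_Z ((z0 b - z0 a) / (b - a)) (AC_sub a b a))).
    by apply: AC_ext h => x _; field.
  rewrite -integral_ooZ// -integral_ooD; [|exact: integrable_oo_cst|exact: integrable_ooZ].
  apply: le_integral_oo.
  - by apply: integrable_oo_ext (AC_integrable (AC_M hz hK)) => x xab; rewrite hJz.
  - by apply: integrable_ooD; [exact: integrable_oo_cst|exact: integrable_ooZ].
  move=> x xab; rewrite hJz//; have /andP[ax xb] := xab.
  set t := (x - a) / (b - a).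
  have t0 : 0 <= t by rewrite divr_ge0 ?ltW// subr_gt0.
  have t1 : 0 <= 1 - t.
    rewrite (_ : 1 - t = (b - x) / (b - a)); last by rewrite /t; field.
    by rewrite divr_ge0 ?ltW// subr_gt0.
  have -> : (b - x) / (b - a) = 1 - t by rewrite /t; field.
  set th := (1 - t) * z0 a + t * z0 b.
  (* convexity of the square: th lies between the two boundary velocities *)
  have th2 : th ^+ 2 <= z0 a ^+ 2 + z0 b ^+ 2.
    rewrite /th; move: (z0 a) (z0 b) => p q.
    have e1 : 0 <= t * (1 - t) by exact: mulr_ge0.
    have e2 := mulr_ge0 e1 (sqr_ge0 (p - q)).
    have e3 := mulr_ge0 t0 (sqr_ge0 p); have e4 := mulr_ge0 t1 (sqr_ge0 q).
    by nra.
  have k0 : 0 < eps / (b - a) by rewrite divr_gt0.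
  have := @young R (eps / (b - a)) th (- z0 x) k0.
  have := ler_wpM2l (ltW k0) th2.
  rewrite sqrrN.
  have -> : (4 * (eps / (b - a)))^-1 = (b - a) / (4 * eps) by field; rewrite ban0 gt_eqF.
  by move: (z0 x) => z; nra.
by rewrite E1; lra.
Qed.

Lemma AC_hump : AC a b hump (fun x => a + b - 2 * x).
Proof.
have h := AC_M (AC_sub a b a) (AC_N (AC_sub a b b)).
by apply: AC_ext h => x _; rewrite /hump; ring.
Qed.

Lemma integral_hump : integral_oo a b hump = (b - a) ^+ 3 / 6.
Proof.
have h := AC_clamped_cubic a b a (- 1 / 3) ((b - a) / 2).
transitivity (integral_oo a b (clamped_cubic1 a (- 1 / 3) ((b - a) / 2))).
  by apply: integral_oo_ext => x _; rewrite /hump /clamped_cubic1; field.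
by rewrite (AC_integral (ltW ab) h) /clamped_cubic; field.
Qed.

(** The moment of v1 against [hump] sees the mean of v1, up to the deviation
    from the mean. *)
Lemma hump_moment : (integral_oo a b (fun x => hump x * v1 x) - (b - a) ^+ 2 / 6 * delta) ^+ 2
  <= (b - a) ^+ 5 * P'.
Proof.
have hh := AC_hump.
have -> : integral_oo a b (fun x => hump x * v1 x) - (b - a) ^+ 2 / 6 * delta =
    integral_oo a b (fun x => hump x * (v1 x - delta / (b - a))).
  have -> : (b - a) ^+ 2 / 6 * delta = (delta / (b - a)) * integral_oo a b hump.
    by rewrite integral_hump; field.
  rewrite -integral_ooZ; last exact: AC_integrable hh.
  rewrite -integral_ooB; [|exact: AC_integrable (AC_M hh h1)|exact/integrable_ooZ/(AC_integrable hh)].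
  by apply: integral_oo_ext => x _; ring.
apply: (le_trans (cauchy_schwarz (AC_sqr_integrable hh) deviation_sqr_integrable)).
rewrite integral_deviation; apply: ler_wpM2r; first exact: deviation_ge0.
have [_ ih2] := AC_sqr_integrable hh.
apply: (@le_trans _ _ (integral_oo a b (fun=> (b - a) ^+ 4))).
  apply: le_integral_oo => //; first exact: integrable_oo_cst.
  move=> x /andP[ax xb]; rewrite /hump exprMn.
  have -> : (b - a) ^+ 4 = (b - a) ^+ 2 * (b - a) ^+ 2 by ring.
  by apply: ler_pM; rewrite ?sqr_ge0// lerXn2r// ?nnegrE ?subr_ge0 ?(ltW ax) ?(ltW xb)//; lra.
by rewrite integral_oo_cst ?(ltW ab)// le_eqVlt; apply/orP; left; apply/eqP; ring.
Qed.

Lemma hump_velocity : integral_oo a b (fun x => hump x * z1 x) =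
  integral_oo a b (fun x => (2 * x - (a + b)) * z0 x).
Proof.
have hh := AC_hump; have := AC_integral (ltW ab) (AC_M hh hz).
rewrite /hump !subrr mul0r mulr0 !mul0r subrr => E.
have hl : AC a b (fun x => 2 * x - (a + b)) (fun=> 2).
  by apply: AC_ext (AC_B (AC_Z 2 (AC_id a b)) (AC_cst a b (a + b))) => x _; ring.
have il : integrable_oo a b (fun x => (2 * x - (a + b)) * z0 x) by exact: AC_integrable (AC_M hl hz).
apply/eqP; rewrite -subr_eq0; apply/eqP; rewrite -[RHS]E -integral_ooB//; last first.
  exact: AC_integrableM hh velocity_derivative_integrable.
by apply: integral_oo_ext => x _; rewrite /hump; ring.
Qed.

Lemma hump_velocity_sqr : integral_oo a b (fun x => hump x * z1 x) ^+ 2 <= (b - a) ^+ 3 * X.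
Proof.
have hl : AC a b (fun x => 2 * x - (a + b)) (fun=> 2).
  by apply: AC_ext (AC_B (AC_Z 2 (AC_id a b)) (AC_cst a b (a + b))) => x _; ring.
rewrite hump_velocity; apply: (le_trans (cauchy_schwarz (AC_sqr_integrable hl) (AC_sqr_integrable hz))).
apply: ler_wpM2r; first exact: integral_sqr_ge0.
have [_ il] := AC_sqr_integrable hl.
apply: (@le_trans _ _ (integral_oo a b (fun=> (b - a) ^+ 2))).
  apply: le_integral_oo => //; first exact: integrable_oo_cst.
  by move=> x /andP[ax xb]; nra.
by rewrite integral_oo_cst ?(ltW ab)// le_eqVlt; apply/orP; left; apply/eqP; ring.
Qed.

Lemma wave_affine (A B : R) :
  integral_oo a b (fun x => dv x * affine a b A B x) =
  v1 b * B - v1 a * A - (B - A) / (b - a) * delta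
  - beta * integral_oo a b (fun x => affine a b A B x * z0 x).
Proof.
have qb : affine a b A B b = B by rewrite /affine; field.
have qa : affine a b A B a = A by rewrite /affine subrr mulr0 addr0.
have hq := AC_affine a b A B.
move: (affine a b A B) qa qb hq => q qa qb hq.
have i1 : integrable_oo a b (fun x => dv x * q x).
  by apply: (integrable_oo_ext _ (AC_integrableM hq wave_load_integrable)) => x _; ring.
have i2 : integrable_oo a b (fun x => q x * z0 x) by exact: AC_integrable (AC_M hq hz).
have := AC_integral (ltW ab) (AC_M h1 hq).
have -> : integral_oo a b (fun x => (dv x + beta * z0 x) * q x + v1 x * ((B - A) / (b - a))) =
   integral_oo a b (fun x => dv x * q x) + beta * integral_oo a b (fun x => q x * z0 x)
   + (B - A) / (b - a) * integral_oo a b v1.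
  have iv : integrable_oo a b v1 by exact: AC_integrable h1.
  rewrite -!integral_ooZ// -!integral_ooD//; [by apply: integral_oo_ext => x _; ring|..];
    by [exact: integrable_ooZ|apply: integrable_ooD => //; exact: integrable_ooZ].
rewrite (AC_integral (ltW ab) h0).
rewrite qa qb.
by lra.
Qed.

End WaveEstimates.

(** * The Lyapunov form *)

(** The functions through which a state enters the forms: derivatives of the
    three positions, indexed by x, and the three velocities, indexed by t. *)
Inductive component := Ux | Uxx | Vx | Wx | Wxx | Ut | Vt | Wt.

Section LyapunovForm.
Context {R : realType}.
Variables l0 l1 l2 l3 beta : R.

Definition profile := component -> R -> R.
Implicit Types c d : profile.

(** The triple [zetaU], [zetaV], [zetaW] is a static deformation, continuous
    at the junctions, whose product in the energy space with any (u, v, w) is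
    a positive multiple of v l2 - v l1. *)
Definition zetaU : R -> R := clamped_cubic l0 1 (- 3 * (l1 - l0)).
Definition zetaW : R -> R := clamped_cubic l3 1 (- 3 * (l2 - l3)).
Definition zetaV : R -> R := affine l1 l2 (zetaU l1) (zetaW l2).

Definition form_beams c d : R :=
  integral_oo l0 l1 (fun x => c Ut x * ((x - l0) * d Ux x)) +
  integral_oo l2 l3 (fun x => c Wt x * ((x - l3) * d Wx x)).
Definition form_sweep c d : R :=
  integral_oo l1 l2 (fun x => c Vt x * (sweep l1 l2 x * d Vx x)).
Definition form_pinned c d : R :=
  integral_oo l1 l2 (fun x => c Vt x * pinned_primitive l1 l2 (d Vx) x).
(** A form of rank one: the moment of v' against [hump] times the momentum
    along the static deformation. Its growth rate contains minus the product
    of that moment and v l2 - v l1, which is the part of the string energy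
    that [form_pinned] misses, since the moment is close to a multiple of v l2
    - v l1. *)
Definition form_zeta c d : R :=
  integral_oo l1 l2 (fun x => hump l1 l2 x * d Vx x) *
  (integral_oo l0 l1 (fun x => zetaU x * c Ut x) + integral_oo l1 l2 (fun x => zetaV x * c Vt x)
   + integral_oo l2 l3 (fun x => zetaW x * c Wt x)).

Definition bendingU c : R := integral_oo l0 l1 (fun x => c Uxx x ^+ 2).
Definition stretchV c : R := integral_oo l1 l2 (fun x => c Vx x ^+ 2).
Definition bendingW c : R := integral_oo l2 l3 (fun x => c Wxx x ^+ 2).
Definition kineticU c : R := integral_oo l0 l1 (fun x => c Ut x ^+ 2).
Definition kineticV c : R := integral_oo l1 l2 (fun x => c Vt x ^+ 2).
Definition kineticW c : R := integral_oo l2 l3 (fun x => c Wt x ^+ 2).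
Definition profile_energy c : R :=
  bendingU c + stretchV c + bendingW c + kineticU c + kineticV c + kineticW c.

(** What an element of the domain satisfies, for one of its two parts: c is
    its profile, d the profile of its image under the operator, and f0, f3,
    v0, w0, w3 are the derivatives, of order 0 or 3, that profiles leave out. *)
Record regular c d (f0 f3 v0 w0 w3 : R -> R) : Prop := {
  reg_f0 : AC l0 l1 f0 (c Ux);
  reg_f1 : AC l0 l1 (c Ux) (c Uxx);
  reg_f2 : AC l0 l1 (c Uxx) f3;
  reg_f3 : AC l0 l1 f3 (fun x => - d Ut x);
  reg_y : AC l0 l1 (c Ut) (d Ux);
  reg_v0 : AC l1 l2 v0 (c Vx);
  reg_v1 : AC l1 l2 (c Vx) (fun x => d Vt x + beta * c Vt x);
  reg_z : AC l1 l2 (c Vt) (d Vx);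
  reg_w0 : AC l2 l3 w0 (c Wx);
  reg_w1 : AC l2 l3 (c Wx) (c Wxx);
  reg_w2 : AC l2 l3 (c Wxx) w3;
  reg_w3 : AC l2 l3 w3 (fun x => - d Wt x);
  reg_r : AC l2 l3 (c Wt) (d Wx);
  reg_f0_clamped : f0 l0 = 0;
  reg_f1_clamped : c Ux l0 = 0;
  reg_w0_clamped : w0 l3 = 0;
  reg_w1_clamped : c Wx l3 = 0;
  reg_uv : f0 l1 = v0 l1;
  reg_vw : w0 l2 = v0 l2;
  reg_uv_t : c Ut l1 = c Vt l1;
  reg_vw_t : c Wt l2 = c Vt l2;
  reg_f2_free : c Uxx l1 = 0;
  reg_w2_free : c Wxx l2 = 0;
  reg_f3_trans : f3 l1 = - c Vx l1;
  reg_w3_trans : w3 l2 = - c Vx l2 }.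

Hypotheses (l01 : l0 < l1) (l12 : l1 < l2) (l23 : l2 < l3).

Let L1 : 0 < l1 - l0. Proof. by rewrite subr_gt0. Qed.
Let L2 : 0 < l2 - l1. Proof. by rewrite subr_gt0. Qed.
Let L3 : 0 < l3 - l2. Proof. by rewrite subr_gt0. Qed.

Definition traces c : R := c Vx l1 ^+ 2 + c Vx l2 ^+ 2 + c Vt l1 ^+ 2 + c Vt l2 ^+ 2.

Definition trace_constant : R := ((l1 - l0) ^+ 3 + (l3 - l2) ^+ 3 + (l1 - l0) + (l3 - l2)) / 2.

Lemma trace_constant_gt0 : 0 < trace_constant.
Proof.
by rewrite /trace_constant divr_gt0// addr_gt0// addr_gt0// addr_gt0// exprn_gt0.
Qed.

Lemma form_beams_le c d f0 f3 v0 w0 w3 : regular c d f0 f3 v0 w0 w3 ->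
  form_beams c d + form_beams d c <=
  - bendingU c - bendingW c - 1 / 2 * (kineticU c + kineticW c) + trace_constant * traces c.
Proof.
move=> h.
have hL := beam_left l01 (reg_f1 h) (reg_f2 h) (reg_f3 h) (reg_y h)
  (reg_f1_clamped h) (reg_f2_free h).
have hR := beam_right l23 (reg_w1 h) (reg_w2 h) (reg_w3 h) (reg_r h)
  (reg_w1_clamped h) (reg_w2_free h).
rewrite (reg_f3_trans h) (reg_uv_t h) sqrrN in hL.
rewrite (reg_w3_trans h) (reg_vw_t h) sqrrN in hR.
rewrite /form_beams /bendingU /bendingW /kineticU /kineticW.
have : (l1 - l0) ^+ 3 / 2 * c Vx l1 ^+ 2 + (l1 - l0) / 2 * c Vt l1 ^+ 2 +
  ((l3 - l2) ^+ 3 / 2 * c Vx l2 ^+ 2 + (l3 - l2) / 2 * c Vt l2 ^+ 2) <= trace_constant * traces c.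
  rewrite /trace_constant /traces.
  have c1 : 0 <= (l1 - l0) ^+ 3 by rewrite exprn_ge0// ltW.
  have c3 : 0 <= (l3 - l2) ^+ 3 by rewrite exprn_ge0// ltW.
  move: c1 c3 (ltW L1) (ltW L3) (sqr_ge0 (c Vx l1)) (sqr_ge0 (c Vx l2)) (sqr_ge0 (c Vt l1)) (sqr_ge0 (c Vt l2)).
  move: ((l1 - l0) ^+ 3) ((l3 - l2) ^+ 3) (l1 - l0) (l3 - l2) (c Vx l1 ^+ 2) (c Vx l2 ^+ 2) (c Vt l1 ^+ 2) (c Vt l2 ^+ 2).
  move=> p q r s x y z w p0 q0 r0 s0 x0 y0 z0 ww0.
  have H (u v : R) : 0 <= u -> 0 <= v -> 0 <= u * v by exact: mulr_ge0.
  have := H _ _ p0 y0; have := H _ _ p0 z0; have := H _ _ p0 ww0.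
  have := H _ _ q0 x0; have := H _ _ q0 z0; have := H _ _ q0 ww0.
  have := H _ _ r0 x0; have := H _ _ r0 y0; have := H _ _ r0 ww0.
  have := H _ _ s0 x0; have := H _ _ s0 y0; have := H _ _ s0 z0.
  by lra.
by lra.
Qed.

Lemma form_sweep_le c d f0 f3 v0 w0 w3 : regular c d f0 f3 v0 w0 w3 ->
  form_sweep c d + form_sweep d c <= - 1 / 2 * traces c
  + ((l2 - l1)^-1 + 1 / 2) * stretchV c + ((l2 - l1)^-1 + beta ^+ 2 / 2) * kineticV c.
Proof.
move=> h; have := wave_sweep l12 (reg_v1 h) (reg_z h).
by rewrite /form_sweep /traces /stretchV /kineticV addrC.
Qed.

(** The traces come with an arbitrarily small factor [eps]; the potential
    energy of the string is controlled except for its mean part. *)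
Lemma form_pinned_le c d f0 f3 v0 w0 w3 eps : regular c d f0 f3 v0 w0 w3 -> 0 < eps ->
  form_pinned c d + form_pinned d c <=
  - 1 / 2 * (stretchV c - (v0 l2 - v0 l1) ^+ 2 / (l2 - l1)) + eps * traces c
  + (beta ^+ 2 * (l2 - l1) ^+ 2 / 2 + 1 + (l2 - l1) / (4 * eps)) * kineticV c.
Proof.
move=> h eps0; have := wave_pinned l12 (reg_v0 h) (reg_v1 h) (reg_z h) eps0.
rewrite /form_pinned /traces /stretchV /kineticV addrC => /le_trans; apply.
rewrite lerD2r lerD2l ler_wpM2l ?(ltW eps0)//.
by have := sqr_ge0 (c Vx l1); have := sqr_ge0 (c Vx l2); lra.
Qed.

Lemma zeta_slope_gt0 : 0 < 6 + (zetaW l2 - zetaU l1) / (l2 - l1).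
Proof.
rewrite addr_gt0// divr_gt0//.
have -> : zetaW l2 - zetaU l1 = 2 * (l3 - l2) ^+ 3 + 2 * (l1 - l0) ^+ 3.
  by rewrite /zetaW /zetaU /clamped_cubic; ring.
by rewrite addr_gt0// mulr_gt0// exprn_gt0.
Qed.

Lemma AC_zetaV : AC l1 l2 zetaV (fun=> (zetaW l2 - zetaU l1) / (l2 - l1)).
Proof. exact: AC_affine. Qed.

(** Integration by parts against the static deformation. The shear forces of
    the beams and of the string cancel at the junctions. *)
Lemma zeta_static c d f0 f3 v0 w0 w3 : regular c d f0 f3 v0 w0 w3 ->
  integral_oo l0 l1 (fun x => zetaU x * d Ut x) + integral_oo l1 l2 (fun x => zetaV x * d Vt x)
   + integral_oo l2 l3 (fun x => zetaW x * d Wt x) =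
  - (6 + (zetaW l2 - zetaU l1) / (l2 - l1)) * (v0 l2 - v0 l1)
  - beta * integral_oo l1 l2 (fun x => zetaV x * c Vt x).
Proof.
move=> h.
have swap a b (f g : R -> R) : integral_oo a b (fun x => f x * g x) =
  integral_oo a b (fun x => g x * f x).
  by apply: integral_oo_ext => x _; rewrite mulrC.
rewrite (swap l0) (swap l1 l2 zetaV) (swap l2).
have := beam_test l0 (ltW l01) (reg_f2 h) (reg_f3 h) 1 (- 3 * (l1 - l0)).
have := beam_clamped_cubic2 l0 (ltW l01) (reg_f0 h) (reg_f1 h) 1 (- 3 * (l1 - l0)).
have := beam_test l3 (ltW l23) (reg_w2 h) (reg_w3 h) 1 (- 3 * (l2 - l3)).
have := beam_clamped_cubic2 l3 (ltW l23) (reg_w0 h) (reg_w1 h) 1 (- 3 * (l2 - l3)).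
have := wave_affine l12 (reg_v0 h) (reg_v1 h) (reg_z h) (zetaU l1) (zetaW l2).
rewrite /= -/zetaV.
have -> : clamped_cubic l0 1 (- 3 * (l1 - l0)) l0 = 0 by rewrite /clamped_cubic subrr; ring.
have -> : clamped_cubic1 l0 1 (- 3 * (l1 - l0)) l0 = 0 by rewrite /clamped_cubic1 subrr; ring.
have -> : clamped_cubic2 l0 1 (- 3 * (l1 - l0)) l1 = 0 by rewrite /clamped_cubic2; ring.
have -> : clamped_cubic l3 1 (- 3 * (l2 - l3)) l3 = 0 by rewrite /clamped_cubic subrr; ring.
have -> : clamped_cubic1 l3 1 (- 3 * (l2 - l3)) l3 = 0 by rewrite /clamped_cubic1 subrr; ring.
have -> : clamped_cubic2 l3 1 (- 3 * (l2 - l3)) l2 = 0 by rewrite /clamped_cubic2; ring.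
rewrite (reg_f0_clamped h) (reg_f1_clamped h) (reg_w0_clamped h) (reg_w1_clamped h).
rewrite (reg_f2_free h) (reg_w2_free h) (reg_f3_trans h) (reg_w3_trans h).
rewrite (reg_uv h) (reg_vw h) -/zetaU -/zetaW -/(zetaU l1) -/(zetaW l2).
by lra.
Qed.

(** The moment cm splits into g delta + e, where e is controlled by the
    deviation of v' from its mean. All other products contain the velocity of
    the string and are split by Young's inequality. *)
Lemma form_zeta_le : exists kap cZ : R, 0 < kap /\ 0 < cZ /\
  forall eps : R, 0 < eps -> exists cX : R, forall c d f0 f3 v0 w0 w3,
  regular c d f0 f3 v0 w0 w3 ->
  form_zeta c d + form_zeta d c <= - kap * (v0 l2 - v0 l1) ^+ 2
  + cZ * (stretchV c - (v0 l2 - v0 l1) ^+ 2 / (l2 - l1))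
  + eps * (kineticU c + kineticW c) + cX * kineticV c.
Proof.
set m := 6 + (zetaW l2 - zetaU l1) / (l2 - l1).
have m0 : 0 < m by exact: zeta_slope_gt0.
pose g := (l2 - l1) ^+ 2 / 6.
have g0 : 0 < g by rewrite divr_gt0// exprn_gt0.
pose E5 := (l2 - l1) ^+ 5.
have E50 : 0 < E5 by rewrite exprn_gt0.
exists (m * g / 2), (E5 * (m / g + m / (4 * g))); split; first by rewrite divr_gt0// mulr_gt0.
split.
  by rewrite mulr_gt0// addr_gt0// divr_gt0// mulr_gt0.
move=> eps eps0.
pose ZU := integral_oo l0 l1 (fun x => zetaU x ^+ 2).
pose ZV := integral_oo l1 l2 (fun x => zetaV x ^+ 2).
pose ZW := integral_oo l2 l3 (fun x => zetaW x ^+ 2).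
have ZU0 : 0 <= ZU by exact: integral_sqr_ge0.
have ZV0 : 0 <= ZV by exact: integral_sqr_ge0.
have ZW0 : 0 <= ZW by exact: integral_sqr_ge0.
(* ZU, ZV, ZW bound the momentum along the static deformation *)
pose e' := eps / (ZU + ZV + ZW + 1).
have Z1 : 0 < ZU + ZV + ZW + 1 by lra.
have e'0 : 0 < e' by rewrite divr_gt0.
exists (2 * g * beta ^+ 2 / m * ZV + eps + 3 * (4 * e')^-1 * (l2 - l1) ^+ 3).
move=> c d f0 f3 v0 w0 w3 h.
have sqzU : sqr_integrable l0 l1 zetaU by exact: AC_sqr_integrable (AC_clamped_cubic l0 l1 l0 _ _).
have sqzV : sqr_integrable l1 l2 zetaV by exact: AC_sqr_integrable AC_zetaV.
have sqzW : sqr_integrable l2 l3 zetaW by exact: AC_sqr_integrable (AC_clamped_cubic l2 l3 l3 _ _).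
rewrite /form_zeta (zeta_static h) -/m.
set delta := v0 l2 - v0 l1.
have := hump_moment l12 (reg_v0 h) (reg_v1 h); rewrite -/(stretchV c) -/delta -/g -/E5.
set P' := stretchV c - _.
have P'0 : 0 <= P' by exact: deviation_ge0 (reg_v0 h) (reg_v1 h).
have := hump_velocity_sqr l12 (reg_z h); rewrite -/(kineticV c).
set cm := integral_oo l1 l2 (fun x => hump l1 l2 x * c Vx x).
set ct := integral_oo l1 l2 (fun x => hump l1 l2 x * d Vx x).
have := cauchy_schwarz sqzU (AC_sqr_integrable (reg_y h)); rewrite -/ZU -/(kineticU c).
have := cauchy_schwarz sqzV (AC_sqr_integrable (reg_z h)); rewrite -/ZV -/(kineticV c).
have := cauchy_schwarz sqzW (AC_sqr_integrable (reg_r h)); rewrite -/ZW -/(kineticW c).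
set IU := integral_oo l0 l1 _; set IV := integral_oo l1 l2 _; set IW := integral_oo l2 l3 _.
have kU0 : 0 <= kineticU c by exact: integral_sqr_ge0.
have kV0 : 0 <= kineticV c by exact: integral_sqr_ge0.
have kW0 : 0 <= kineticW c by exact: integral_sqr_ge0.
move: (kineticU c) (kineticV c) (kineticW c) kU0 kV0 kW0 => TU X TW TU0 X0 TW0.
move=> hIW hIV hIU hct hcm.
pose e := cm - g * delta.
have cmE : cm = g * delta + e by rewrite /e; ring.
have {}hcm : e ^+ 2 <= E5 * P' by [].
have t1 : - (m * e * delta) <= m * g / 4 * delta ^+ 2 + m / g * e ^+ 2.
  rewrite -subr_ge0.
  have -> : m * g / 4 * delta ^+ 2 + m / g * e ^+ 2 - - (m * e * delta) =
    m / g * (g / 2 * delta + e) ^+ 2 by field; rewrite gt_eqF.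
  by rewrite mulr_ge0 ?sqr_ge0// divr_ge0// ltW.
have t2 : - (beta * cm * IV) <= m / (8 * g) * cm ^+ 2 + 2 * g * beta ^+ 2 / m * IV ^+ 2.
  rewrite -subr_ge0.
  have -> : m / (8 * g) * cm ^+ 2 + 2 * g * beta ^+ 2 / m * IV ^+ 2 - - (beta * cm * IV) =
    m / (8 * g) * (cm + 4 * g * beta / m * IV) ^+ 2 by field; rewrite !gt_eqF.
  by rewrite mulr_ge0 ?sqr_ge0// divr_ge0 ?mulr_ge0// ltW.
have t3 : cm ^+ 2 <= 2 * g ^+ 2 * delta ^+ 2 + 2 * e ^+ 2.
  by rewrite cmE; have := sqr_ge0 (g * delta - e); lra.
have t3' : m / (8 * g) * cm ^+ 2 <= m * g / 4 * delta ^+ 2 + m / (4 * g) * e ^+ 2.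
  have k0 : 0 <= m / (8 * g) by rewrite divr_ge0 ?mulr_ge0// ltW.
  apply: (le_trans (ler_wpM2l k0 t3)).
  by rewrite le_eqVlt; apply/orP; left; apply/eqP; field; rewrite gt_eqF.
have t4 : 2 * g * beta ^+ 2 / m * IV ^+ 2 <= 2 * g * beta ^+ 2 / m * ZV * X.
  rewrite -[leRHS]mulrA; apply: ler_wpM2l => //.
  by rewrite divr_ge0 ?(ltW m0)// mulr_ge0 ?sqr_ge0// mulr_ge0// ltW.
have t5 : (m / g + m / (4 * g)) * e ^+ 2 <= E5 * (m / g + m / (4 * g)) * P'.
  rewrite mulrAC [leRHS]mulrC; apply: ler_wpM2l => //.
  by rewrite addr_ge0// divr_ge0 ?mulr_ge0// ltW.
have y1 := @young _ e' IU ct e'0; have y2 := @young _ e' IV ct e'0; have y3 := @young _ e' IW ct e'0.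
have i4 : 0 <= (4 * e')^-1 by rewrite invr_ge0 mulr_ge0// ltW.
have t6 : 3 * (4 * e')^-1 * ct ^+ 2 <= 3 * (4 * e')^-1 * (l2 - l1) ^+ 3 * X.
  by rewrite -[leRHS]mulrA; apply: ler_wpM2l => //; rewrite mulr_ge0.
have t7 : e' * IU ^+ 2 + e' * IV ^+ 2 + e' * IW ^+ 2 <= eps * (TU + TW + X).
  rewrite -!mulrDr.
  apply: (@le_trans _ _ (e' * ((ZU + ZV + ZW + 1) * (TU + TW + X)))).
    apply: ler_wpM2l; first exact: ltW.
    have H (u v : R) : 0 <= u -> 0 <= v -> 0 <= u * v by exact: mulr_ge0.
    have := H _ _ ZU0 TW0; have := H _ _ ZU0 X0; have := H _ _ ZV0 TU0; have := H _ _ ZV0 TW0.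
    have := H _ _ ZW0 TU0; have := H _ _ ZW0 X0.
    by lra.
  by rewrite mulrA /e' divfK// gt_eqF.
have E : cm * (- m * delta - beta * IV) = - m * g * delta ^+ 2 + - (m * e * delta) +
  - (beta * cm * IV).
  by rewrite {1}cmE; rewrite cmE; ring.
rewrite [X in _ + X]E.
have E2 : ct * (IU + IV + IW) = IU * ct + IV * ct + IW * ct by ring.
rewrite E2.
by lra.
Qed.

Definition lyapunov (a KD KZ : R) c d : R :=
  form_beams c d + a * form_sweep c d + KD * form_pinned c d + KZ * form_zeta c d.

(** The coefficients are chosen one after the other: the beams need the
    traces, the sweep recovers the traces from the potential energy of the
    string, and the last two forms recover the two parts of that energy. *)
Theorem lyapunov_le : exists a KD KZ C : R,
  forall c d f0 f3 v0 w0 w3, regular c d f0 f3 v0 w0 w3 ->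
  lyapunov a KD KZ c d + lyapunov a KD KZ d c <= - (1 / 4) * profile_energy c + C * kineticV c.
Proof.
have c40 := trace_constant_gt0.
have [kap [cZ [kap0 [cZ0 hZ]]]] := form_zeta_le.
pose c5 := (l2 - l1)^-1 + 1 / 2.
have c50 : 0 < c5 by rewrite addr_gt0// invr_gt0.
(* the sweep has to dominate the traces left by the beams *)
pose a := 4 * trace_constant.
have a0 : 0 < a by rewrite mulr_gt0.
(* dominates the mean part of the potential energy used by the sweep *)
pose KZ := (a * c5 + 1) / ((l2 - l1) * kap).
have ac5 : 0 < a * c5 + 1 by rewrite addr_gt0// mulr_gt0.
have KZ0 : 0 < KZ by rewrite divr_gt0// mulr_gt0.
(* dominates the deviation part, including the one spent by [form_zeta] *)
pose KD := 2 * (a * c5 + 1 + KZ * cZ).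
have KD0 : 0 < KD by rewrite mulr_gt0// addr_gt0// mulr_gt0.
have e20 : 0 < (4 * KZ)^-1 by rewrite invr_gt0 mulr_gt0.
have [cX {}hZ] := hZ _ e20.
have e10 : 0 < trace_constant / KD by rewrite divr_gt0.
pose c6 := (l2 - l1)^-1 + beta ^+ 2 / 2.
pose cD := beta ^+ 2 * (l2 - l1) ^+ 2 / 2 + 1 + (l2 - l1) / (4 * (trace_constant / KD)).
exists a, KD, KZ, (a * c6 + KD * cD + KZ * cX + 1 / 4) => c d f0 f3 v0 w0 w3 h.
have hF := form_beams_le h.
have := form_sweep_le h; rewrite -/c5 -/c6 => /(ler_wpM2l (ltW a0)) hV.
have := form_pinned_le h e10; rewrite -/cD => /(ler_wpM2l (ltW KD0)) hD.
have /(ler_wpM2l (ltW KZ0)) {}hZ := hZ _ _ _ _ _ _ _ h.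
set q := (v0 l2 - v0 l1) ^+ 2 / (l2 - l1) in hD hZ.
have {}hV : a * (form_sweep c d + form_sweep d c) <=
    - 2 * trace_constant * traces c + a * c5 * stretchV c + a * c6 * kineticV c.
  apply: (le_trans hV); rewrite le_eqVlt; apply/orP; left; apply/eqP.
  by rewrite (_ : - 2 * trace_constant = - (a / 2)); [field|rewrite /a; field].
have {}hD : KD * (form_pinned c d + form_pinned d c) <=
    - (a * c5 + 1 + KZ * cZ) * (stretchV c - q) + trace_constant * traces c + KD * cD * kineticV c.
  apply: (le_trans hD); rewrite le_eqVlt; apply/orP; left; apply/eqP.
  have -> : KD * (- 1 / 2 * (stretchV c - q) + trace_constant / KD * traces c + cD * kineticV c) =
    - (KD / 2) * (stretchV c - q) + trace_constant * traces c + KD * cD * kineticV c.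
    by field; rewrite gt_eqF.
  by congr (- _ * _ + _ + _); rewrite /KD; field.
have {}hZ : KZ * (form_zeta c d + form_zeta d c) <=
    - (a * c5 + 1) * q + KZ * cZ * (stretchV c - q) + 1 / 4 * (kineticU c + kineticW c)
    + KZ * cX * kineticV c.
  apply: (le_trans hZ); rewrite le_eqVlt; apply/orP; left; apply/eqP.
  have -> : - kap * (v0 l2 - v0 l1) ^+ 2 = - (kap * (l2 - l1)) * q.
    by rewrite /q; field; rewrite gt_eqF.
  have -> : - (a * c5 + 1) * q = - (KZ * (kap * (l2 - l1))) * q.
    by congr (- _ * _); rewrite /KZ; field; rewrite !gt_eqF.
  by field; rewrite gt_eqF.
have kU0 : 0 <= kineticU c by exact: integral_sqr_ge0.
have kW0 : 0 <= kineticW c by exact: integral_sqr_ge0.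
have eU0 : 0 <= bendingU c by exact: integral_sqr_ge0.
have eW0 : 0 <= bendingW c by exact: integral_sqr_ge0.
have eV0 : 0 <= stretchV c by exact: integral_sqr_ge0.
rewrite /lyapunov /profile_energy.
by lra.
Qed.

End LyapunovForm.

(** * Bounded bilinear forms on profiles *)

Section BoundedForms.
Context {R : realType}.
Variables l0 l1 l2 l3 : R.
Hypotheses (l01 : l0 < l1) (l12 : l1 < l2) (l23 : l2 < l3).
Implicit Types (c d : @profile R) (n m : component).

Definition itv_left n : R := match n with
  Ux | Uxx | Ut => l0 | Vx | Vt => l1 | Wx | Wxx | Wt => l2 end.
Definition itv_right n : R := match n with
  Ux | Uxx | Ut => l1 | Vx | Vt => l2 | Wx | Wxx | Wt => l3 end.

Definition profile_L2 c : Prop := forall n, sqr_integrable (itv_left n) (itv_right n) (c n).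
Definition profile_ae_eq c d : Prop :=
  forall n, ae_oo (itv_left n) (itv_right n) (fun x => c n x = d n x).
Definition profile_comb c (k : R) d : @profile R := fun n x => c n x + k * d n x.

Local Notation energy c := (profile_energy l0 l1 l2 l3 c).

(** The slopes of the beams are not part of the energy. For clamped beams they
    are controlled by it, which makes the forms bounded. *)
Definition poincare c : Prop :=
  integral_oo l0 l1 (fun x => c Ux x ^+ 2) <= (l1 - l0) ^+ 2 * bendingU l0 l1 c /\
  integral_oo l2 l3 (fun x => c Wx x ^+ 2) <= (l3 - l2) ^+ 2 * bendingW l2 l3 c.

Lemma profile_L2_comb c k d : profile_L2 c -> profile_L2 d -> profile_L2 (profile_comb c k d).
Proof. by move=> hc hd n; apply: sqr_integrableD => //; exact: sqr_integrableZ. Qed.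

Lemma profile_energy_ge0 c : 0 <= energy c.
Proof. by rewrite /profile_energy !addr_ge0//; exact: integral_sqr_ge0. Qed.

(** Profiles of states are additive only almost everywhere, hence the first
    clause; the squared bound in the last one is stable under sums. *)
Record bilinear_bounded (Q : @profile R -> @profile R -> R) : Prop := {
  bil_ae : forall c c' d d', profile_L2 c -> profile_L2 c' -> profile_L2 d -> profile_L2 d' ->
    profile_ae_eq c c' -> profile_ae_eq d d' -> Q c d = Q c' d';
  bil_left : forall c c' d k, profile_L2 c -> profile_L2 c' -> profile_L2 d ->
    Q (profile_comb c k c') d = Q c d + k * Q c' d;
  bil_right : forall c d d' k, profile_L2 c -> profile_L2 d -> profile_L2 d' ->
    Q c (profile_comb d k d') = Q c d + k * Q c d';
  bil_bound : exists2 C, 0 <= C & forall c d, profile_L2 c -> profile_L2 d ->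
    poincare c -> poincare d -> Q c d ^+ 2 <= C * (energy c * energy d) }.

Lemma bilinear_boundedD Q Q' : bilinear_bounded Q -> bilinear_bounded Q' ->
  bilinear_bounded (fun c d => Q c d + Q' c d).
Proof.
move=> [ae le ri [C C0 bo]] [ae' le' ri' [C' C'0 bo']]; split.
- by move=> c c' d d' *; rewrite (ae c c' d d')// (ae' c c' d d').
- by move=> c c' d k *; rewrite le// le'//; ring.
- by move=> c d d' k *; rewrite ri// ri'//; ring.
- exists (2 * C + 2 * C'); first by rewrite addr_ge0// mulr_ge0.
  move=> c d hc hd pc pd; have := bo c d hc hd pc pd; have := bo' c d hc hd pc pd.
  have := sqr_ge0 (Q c d - Q' c d).
  by move: (energy c * energy d) => E; nra.
Qed.

Lemma bilinear_boundedZ k Q : bilinear_bounded Q -> bilinear_bounded (fun c d => k * Q c d).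
Proof.
move=> [ae le ri [C C0 bo]]; split.
- by move=> c c' d d' *; rewrite (ae c c' d d').
- by move=> c c' d h *; rewrite le//; ring.
- by move=> c d d' h *; rewrite ri//; ring.
- exists (k ^+ 2 * C); first by rewrite mulr_ge0// sqr_ge0.
  move=> c d hc hd pc pd; rewrite exprMn -[leRHS]mulrA.
  by apply: ler_wpM2l; [exact: sqr_ge0|exact: bo].
Qed.

Lemma component_energy n : exists2 C, 0 <= C & forall c, poincare c ->
  integral_oo (itv_left n) (itv_right n) (fun x => c n x ^+ 2) <= C * energy c.
Proof.
have E c : [/\ 0 <= bendingU l0 l1 c, 0 <= stretchV l1 l2 c, 0 <= bendingW l2 l3 c,
    0 <= kineticU l0 l1 c & 0 <= kineticV l1 l2 c /\ 0 <= kineticW l2 l3 c].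
  by split; [exact: integral_sqr_ge0..|split; exact: integral_sqr_ge0].
have e1 : 0 <= (l1 - l0) ^+ 2 by exact: sqr_ge0.
have e3 : 0 <= (l3 - l2) ^+ 2 by exact: sqr_ge0.
have B c k u : poincare c -> 0 <= k -> u <= energy c -> k * u <= k * energy c.
  by move=> _ k0 ue; apply: ler_wpM2l.
case: n => /=; [exists ((l1 - l0) ^+ 2)|exists 1|exists 1|exists ((l3 - l2) ^+ 2)|
  exists 1|exists 1|exists 1|exists 1] => // c [p1 p2];
  have [? ? ? ? [? ?]] := E c; rewrite ?mul1r.
- apply: (le_trans p1); apply: ler_wpM2l => //.
  by rewrite /profile_energy; lra.
- by rewrite /profile_energy -/(bendingU l0 l1 c); lra.
- by rewrite /profile_energy -/(stretchV l1 l2 c); lra.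
- apply: (le_trans p2); apply: ler_wpM2l => //.
  by rewrite /profile_energy; lra.
- by rewrite /profile_energy -/(bendingW l2 l3 c); lra.
- by rewrite /profile_energy -/(kineticU l0 l1 c); lra.
- by rewrite /profile_energy -/(kineticV l1 l2 c); lra.
- by rewrite /profile_energy -/(kineticW l2 l3 c); lra.
Qed.

Lemma bilinear_bounded_product n m (K k : R -> R) : itv_left n = itv_left m -> itv_right n =
  itv_right m ->
  AC (itv_left n) (itv_right n) K k ->
  bilinear_bounded (fun c d => integral_oo (itv_left n) (itv_right n) (fun x => c n x * (K x * d m x))).
Proof.
move=> enl enr hK.
have sK d : profile_L2 d -> sqr_integrable (itv_left n) (itv_right n) (fun x => K x * d m x).
  by move=> hd; apply: AC_sqr_integrableM hK _; rewrite enl enr; exact: hd.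
have ip c d : profile_L2 c -> profile_L2 d ->
  integrable_oo (itv_left n) (itv_right n) (fun x => c n x * (K x * d m x)).
  by move=> hc hd; apply: sqr_integrableM; [exact: hc|exact: sK].
split.
- move=> c c' d d' hc hc' hd hd' ec ed; apply: integral_oo_ae.
  + by apply: integrable_oo_measurable; exact: ip.
  + by apply: integrable_oo_measurable; exact: ip.
  + have := ed m; rewrite -enl -enr => ed'.
    by apply: ae_ooS2 (ec n) ed' => x _ -> ->.
- move=> c c' d h hc hc' hd; rewrite -integral_ooZ; last exact: ip.
  rewrite -integral_ooD; [|exact: ip|exact/integrable_ooZ/ip].
  by apply: integral_oo_ext => x _; rewrite /profile_comb; ring.
- move=> c d d' h hc hd hd'; rewrite -integral_ooZ; last exact: ip.
  rewrite -integral_ooD; [|exact: ip|exact/integrable_ooZ/ip].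
  by apply: integral_oo_ext => x _; rewrite /profile_comb; ring.
- have [Cn Cn0 hn] := component_energy n; have [Cm Cm0 hm] := component_energy m.
  have [M M0 hM] := AC_bounded hK.
  exists (Cn * (M ^+ 2 * Cm)); first by rewrite !mulr_ge0// sqr_ge0.
  move=> c d hc hd pc pd; apply: (le_trans (cauchy_schwarz (hc n) (sK d hd))).
  have -> : Cn * (M ^+ 2 * Cm) * (energy c * energy d) =
     (Cn * energy c) * (M ^+ 2 * (Cm * energy d)) by ring.
  apply: ler_pM; [exact: integral_sqr_ge0|exact: integral_sqr_ge0|exact: hn|].
  apply: (@le_trans _ _ (M ^+ 2 * integral_oo (itv_left n) (itv_right n) (fun x => d m x ^+ 2)));
    last first.
    by apply: ler_wpM2l; [exact: sqr_ge0|rewrite enl enr; exact: hm].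
  have i2 : integrable_oo (itv_left n) (itv_right n) (fun x => d m x ^+ 2) by rewrite enl enr;
    case: (hd m).
  rewrite -integral_ooZ//; apply: le_integral_oo; [by case: (sK d hd)|exact: integrable_ooZ|].
  move=> x /andP[ax xb]; rewrite exprMn; apply: ler_wpM2r; first exact: sqr_ge0.
  rewrite -(real_normK (num_real (K x))) lerXn2r ?nnegrE//.
  by apply: hM; rewrite !ltW.
Qed.

Lemma linear_functional_bounded n (K : R -> R) : sqr_integrable (itv_left n) (itv_right n) K ->
  let F c := integral_oo (itv_left n) (itv_right n) (fun x => K x * c n x) in
  [/\ forall c c', profile_L2 c -> profile_L2 c' -> profile_ae_eq c c' -> F c = F c',
      forall c d k, profile_L2 c -> profile_L2 d -> F (profile_comb c k d) = F c + k * F d &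
      exists2 C, 0 <= C & forall c, profile_L2 c -> poincare c -> F c ^+ 2 <= C * energy c].
Proof.
move=> hK F.
have ip c : profile_L2 c -> integrable_oo (itv_left n) (itv_right n) (fun x => K x * c n x).
  by move=> hc; apply: sqr_integrableM; [exact: hK|exact: hc].
split.
- move=> c c' hc hc' ec; apply: integral_oo_ae;
  [by apply: integrable_oo_measurable; exact: ip|by apply: integrable_oo_measurable; exact: ip|].
  by apply: ae_ooS (ec n) => x _ ->.
- move=> c d k hc hd; rewrite -integral_ooZ; last exact: ip.
  rewrite -integral_ooD; [|exact: ip|exact/integrable_ooZ/ip].
  by apply: integral_oo_ext => x _; rewrite /profile_comb; ring.
- have [Cn Cn0 hn] := component_energy n.
  exists (integral_oo (itv_left n) (itv_right n) (fun x => K x ^+ 2) * Cn).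
    by rewrite mulr_ge0//; exact: integral_sqr_ge0.
  move=> c hc pc; apply: (le_trans (cauchy_schwarz hK (hc n))).
  by rewrite -mulrA; apply: ler_wpM2l; [exact: integral_sqr_ge0|exact: hn].
Qed.

Lemma bilinear_bounded_rank1 n m (K K' : R -> R) : sqr_integrable (itv_left n) (itv_right n) K ->
  sqr_integrable (itv_left m) (itv_right m) K' ->
  bilinear_bounded (fun c d => integral_oo (itv_left m) (itv_right m) (fun x => K' x * d m x) *
    integral_oo (itv_left n) (itv_right n) (fun x => K x * c n x)).
Proof.
move=> hK hK'; have [aF lF [C C0 bF]] := linear_functional_bounded hK.
have [aG lG [C' C'0 bG]] := linear_functional_bounded hK'.
split.
- by move=> c c' d d' hc hc' hd hd' ec ed; rewrite (aF c c')// (aG d d').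
- by move=> c c' d k hc hc' hd; rewrite lF//; ring.
- by move=> c d d' k hc hd hd'; rewrite lG//; ring.
- exists (C * C'); first exact: mulr_ge0.
  move=> c d hc hd pc pd; rewrite exprMn.
  have -> : C * C' * (energy c * energy d) = (C' * energy d) * (C * energy c) by ring.
  by apply: ler_pM; [exact: sqr_ge0|exact: sqr_ge0|exact: bG|exact: bF].
Qed.

Lemma pinned_primitive_bound (a b : R) (g : R -> R) : a < b -> sqr_integrable a b g ->
  integral_oo a b (fun x => pinned_primitive a b g x ^+ 2) <=
    4 * (b - a) ^+ 2 * integral_oo a b (fun x => g x ^+ 2).
Proof.
move=> ab hg; have [_ g2] := hg; have ba : 0 < b - a by rewrite subr_gt0.
have -> : 4 * (b - a) ^+ 2 * integral_oo a b (fun x => g x ^+ 2) =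
   integral_oo a b (fun=> 4 * (b - a) * integral_oo a b (fun x => g x ^+ 2)).
  by rewrite integral_oo_cst ?(ltW ab)//; ring.
apply: le_integral_oo; [by case: (AC_sqr_integrable (AC_pinned_primitive (sqr_integrable_integrable hg)))|exact: integrable_oo_cst|].
move=> x /andP[ax xb]; rewrite /pinned_primitive.
have h2 := sqr_integral_le (ltW ab) hg.
have sgx : sqr_integrable a x g.
  split; first by apply: integrable_oo_measurable;
    apply: integrable_ooS (sqr_integrable_integrable hg) => //; exact: ltW.
  by apply: integrable_ooS g2 => //; exact: ltW.
have h1 := sqr_integral_le (ltW ax) sgx.
have h3 : integral_oo a x (fun x => g x ^+ 2) <= integral_oo a b (fun x => g x ^+ 2).
  rewrite (@integral_oo_split _ a b x (fun x => g x ^+ 2)) ?(ltW ax) ?(ltW xb)//.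
  by rewrite lerDl; exact: integral_sqr_ge0.
have p0 := integral_sqr_ge0 a x g.
set t := (x - a) / (b - a).
have t0 : 0 <= t by rewrite divr_ge0// ltW// subr_gt0.
have t1 : t <= 1 by rewrite ler_pdivrMr// mul1r; lra.
have h1' : integral_oo a x g ^+ 2 <= (b - a) * integral_oo a b (fun x => g x ^+ 2).
  apply: (le_trans h1); apply: ler_pM => //; lra.
have h2' : (t * integral_oo a b g) ^+ 2 <= (b - a) * integral_oo a b (fun x => g x ^+ 2).
  rewrite exprMn; apply: le_trans h2; rewrite ler_piMl ?sqr_ge0//.
  by rewrite expr_le1.
have := sqr_ge0 (integral_oo a x g + t * integral_oo a b g).
by lra.
Qed.

Lemma bilinear_bounded_pinned : bilinear_bounded (form_pinned l1 l2).
Proof.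
have hJ d : profile_L2 d -> sqr_integrable l1 l2 (pinned_primitive l1 l2 (d Vx)).
  by move=> hd; apply: AC_sqr_integrable (AC_pinned_primitive _);
    apply: sqr_integrable_integrable; exact: hd Vx.
have ip c d : profile_L2 c -> profile_L2 d ->
  integrable_oo l1 l2 (fun x => c Vt x * pinned_primitive l1 l2 (d Vx) x).
  by move=> hc hd; apply: sqr_integrableM; [exact: hc Vt|exact: hJ].
have iV d : profile_L2 d -> integrable_oo l1 l2 (d Vx) by move=> hd;
  apply: sqr_integrable_integrable; exact: hd Vx.
have iVx d x : profile_L2 d -> l1 < x < l2 -> integrable_oo l1 x (d Vx).
  by move=> hd /andP[ax xb]; apply: integrable_ooS (iV d hd) => //; exact: ltW.
split.
- move=> c c' d d' hc hc' hd hd' ec ed; apply: integral_oo_ae.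
  + by apply: integrable_oo_measurable; exact: ip.
  + by apply: integrable_oo_measurable; exact: ip.
  + apply: ae_ooS (ec Vt) => x xab -> ; congr (_ * _); rewrite /pinned_primitive.
    rewrite (@integral_oo_ae _ l1 l2 (d Vx) (d' Vx));
      [|by apply: integrable_oo_measurable; exact: iV|by apply: integrable_oo_measurable;
        exact: iV|exact: ed Vx].
    congr (_ - _); have /andP[ax xb] := xab.
    apply: integral_oo_ae; [by apply: integrable_oo_measurable;
      exact: iVx|by apply: integrable_oo_measurable; exact: iVx|].
    have := ed Vx; rewrite /ae_oo; apply: (@filterS _ _ ae_oo_filter) => y h /= yx.
    apply: h; move: yx; rewrite /= !in_itv/= => /andP[-> yx].
    exact: lt_trans xb.
- move=> c c' d h hc hc' hd; rewrite /form_pinned -integral_ooZ; last exact: ip.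
  rewrite -integral_ooD; [|exact: ip|exact/integrable_ooZ/ip].
  by apply: integral_oo_ext => x _; rewrite /profile_comb; ring.
- move=> c d d' h hc hd hd'; rewrite /form_pinned -integral_ooZ; last exact: ip.
  rewrite -integral_ooD; [|exact: ip|exact/integrable_ooZ/ip].
  apply: integral_oo_ext => x xab; rewrite /pinned_primitive /profile_comb.
  rewrite integral_ooD; [|exact: iVx|exact/integrable_ooZ/iVx]; rewrite integral_ooD;
    [|exact: iV|exact/integrable_ooZ/iV].
  rewrite integral_ooZ; last exact: iVx.
  by rewrite integral_ooZ; [ring|exact: iV].
- have [Cn Cn0 hn] := component_energy Vt; have [Cm Cm0 hm] := component_energy Vx.
  exists (Cn * (4 * (l2 - l1) ^+ 2 * Cm)).
    by rewrite mulr_ge0// mulr_ge0// mulr_ge0// sqr_ge0.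
  move=> c d hc hd pc pd; apply: (le_trans (cauchy_schwarz (hc Vt) (hJ d hd))).
  have -> : Cn * (4 * (l2 - l1) ^+ 2 * Cm) * (energy c * energy d) =
     (Cn * energy c) * (4 * (l2 - l1) ^+ 2 * (Cm * energy d)) by ring.
  apply: ler_pM; [exact: integral_sqr_ge0|exact: integral_sqr_ge0|exact: hn|].
  apply: (le_trans (pinned_primitive_bound l12 (hd Vx))).
  by apply: ler_wpM2l; [rewrite mulr_ge0// sqr_ge0|exact: hm].
Qed.

Definition form_energy (c d : @profile R) : R :=
  integral_oo l0 l1 (fun x => c Uxx x * d Uxx x) + integral_oo l1 l2 (fun x => c Vx x * d Vx x)
  + integral_oo l2 l3 (fun x => c Wxx x * d Wxx x) + integral_oo l0 l1 (fun x => c Ut x * d Ut x)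
  + integral_oo l1 l2 (fun x => c Vt x * d Vt x) + integral_oo l2 l3 (fun x => c Wt x * d Wt x).

Lemma form_energy_diag c : form_energy c c = energy c.
Proof. by rewrite /form_energy /profile_energy; congr (_ + _ + _ + _ + _ + _);
  apply: integral_oo_ext => x _; rewrite expr2. Qed.

Lemma bilinear_bounded_energy : bilinear_bounded form_energy.
Proof.
have H n : bilinear_bounded (fun c d => integral_oo (itv_left n) (itv_right n) (fun x => c n x * d n x)).
  have -> : (fun c d => integral_oo (itv_left n) (itv_right n) (fun x => c n x * d n x)) =
     (fun c d => integral_oo (itv_left n) (itv_right n) (fun x => c n x * ((fun=> 1) x * d n x))).
    by apply/funext => c; apply/funext => d; apply: integral_oo_ext => x _; rewrite mul1r.
  exact: bilinear_bounded_product (AC_cst _ _ 1).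
exact: bilinear_boundedD (bilinear_boundedD (bilinear_boundedD (bilinear_boundedD (bilinear_boundedD (H Uxx) (H Vx)) (H Wxx)) (H Ut)) (H Vt)) (H Wt).
Qed.

Lemma bilinear_bounded_lyapunov a KD KZ : bilinear_bounded (lyapunov l0 l1 l2 l3 a KD KZ).
Proof.
have hF : bilinear_bounded (form_beams l0 l1 l2 l3).
  apply: bilinear_boundedD.
    exact: (@bilinear_bounded_product Ut Ux _ _ erefl erefl (AC_sub l0 l1 l0)).
  exact: (@bilinear_bounded_product Wt Wx _ _ erefl erefl (AC_sub l2 l3 l3)).
have hV : bilinear_bounded (form_sweep l1 l2).
  exact: (@bilinear_bounded_product Vt Vx _ _ erefl erefl (AC_sweep l12)).
have hZ : bilinear_bounded (form_zeta l0 l1 l2 l3).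
  have sh : sqr_integrable l1 l2 (hump l1 l2) by exact: AC_sqr_integrable (AC_hump l1 l2).
  have sU : sqr_integrable l0 l1 (zetaU l0 l1) by exact: AC_sqr_integrable (AC_clamped_cubic l0 l1 l0 _ _).
  have sV : sqr_integrable l1 l2 (zetaV l0 l1 l2 l3) by exact: AC_sqr_integrable (AC_zetaV l0 l1 l2 l3).
  have sW : sqr_integrable l2 l3 (zetaW l2 l3) by exact: AC_sqr_integrable (AC_clamped_cubic l2 l3 l3 _ _).
  have := bilinear_boundedD (bilinear_boundedD (@bilinear_bounded_rank1 Ut Vx _ _ sU sh) (@bilinear_bounded_rank1 Vt Vx _ _ sV sh))
     (@bilinear_bounded_rank1 Wt Vx _ _ sW sh).
  congr bilinear_bounded; apply/funext => c; apply/funext => d.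
  by rewrite /form_zeta /=; ring.
exact: bilinear_boundedD (bilinear_boundedD (bilinear_boundedD hF (bilinear_boundedZ a hV)) (bilinear_boundedZ KD bilinear_bounded_pinned)) (bilinear_boundedZ KZ hZ).
Qed.

End BoundedForms.

(** * States and their profiles *)

Section States.
Context {R : realType}.
Variables l0 l1 l2 l3 : R.
Hypotheses (l01 : l0 < l1) (l12 : l1 < l2) (l23 : l2 < l3).
Implicit Types (s t : bool) (k x : R).
Local Notation LL := (LL l0 l1 l2 l3).
Local Notation state := (state l0 l1 l2 l3).

Lemma sobolev_wderiv (a b : R) m n (u : L2 a b) : (n <= m)%N -> sobolev m u ->
  is_wderiv n u (wderiv n u).
Proof. by move=> nm hu; apply: has_wderivP; exact: hu. Qed.

(** Membership in H2 provides both derivatives of u; the second is the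
    derivative of the first. *)
Lemma sobolev2_wderiv (a b : R) (u : L2 a b) : sobolev 2 u ->
  is_wderiv 1 (wderiv 1 u) (wderiv 2 u).
Proof.
move=> hu; apply: (@is_wderiv_quot _ a b 1 1 u).
  exact: sobolev_wderiv hu.
exact: (@sobolev_wderiv _ _ 2 2).
Qed.

Lemma sobolev_comb (a b : R) m k (u v : L2 a b) : sobolev m u -> sobolev m v ->
  sobolev m (u + k%:C *: v).
Proof.
move=> hu hv n nm; exists (wderiv n u + k%:C *: wderiv n v).
by apply: is_wderiv_comb; exact: sobolev_wderiv nm _.
Qed.

Lemma crepr_comb (a b : R) k (u v : L2 a b) x : a < b -> has_wderiv 1 u -> has_wderiv 1 v ->
  a <= x <= b -> crepr (u + k%:C *: v) x = crepr u x + k%:C * crepr v x.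
Proof.
move=> ab /has_wderivP hu /has_wderivP hv xab; apply: partP => s; rewrite partD partZ.
apply: (@crepr_eq _ a b _ (fun s x => part s (crepr u x) + k * part s (crepr v x))) => //.
- move=> t; have [h1 _] := wderiv1_AC t ab hu; have [h2 _] := wderiv1_AC t ab hv.
  exact: AC_continuous (ltW ab) (AC_D h1 (AC_Z k h2)).
- move=> t; have [_ h1] := wderiv1_AC t ab hu; have [_ h2] := wderiv1_AC t ab hv.
  apply: (ae_ooS2 _ (L2_partD u (k%:C *: v) t)
    (ae_ooS2 (S := fun x => part t (crepr u x) + k * part t (crepr v x) = part_fun t u x +
      part_fun t (k%:C *: v) x) _ h1
      (ae_ooS2 (S := fun x => k * part t (crepr v x) = part_fun t (k%:C *: v) x) _ h2 (L2_partZ k v t)))).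
  + by move=> y _ -> ->.
  + by move=> y _ -> ->.
  + by move=> y _ -> ->.
Qed.

Lemma HH_comb k (U V : LL) : HH U -> HH V -> HH (U + k%:C *: V).
Proof.
case: U V => [[u v] w] [[u' v'] w'].
move=> [[su u0 u0'] sv [sw w0 w0'] uv vw] [[su' u'0 u'0'] sv' [sw' w'0 w'0'] uv' vw'].
have hu := su 1%N isT; have hu' := su' 1%N isT.
have hv := sv 1%N isT; have hv' := sv' 1%N isT.
have hw := sw 1%N isT; have hw' := sw' 1%N isT.
have d1 (a b : R) (z : L2 a b) : sobolev 2 z -> has_wderiv 1 (wderiv 1 z).
  by move=> sz; exists (wderiv 2 z); exact: sobolev2_wderiv.
split.
- split; first exact: sobolev_comb.
    by rewrite crepr_comb ?lexx ?ltW// u0 u'0 mulr0 addr0.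
  rewrite wderiv_comb// crepr_comb ?lexx ?ltW//; [|exact: d1|exact: d1].
  by rewrite u0' u'0' mulr0 addr0.
- exact: sobolev_comb.
- split; first exact: sobolev_comb.
    by rewrite crepr_comb ?lexx ?ltW// w0 w'0 mulr0 addr0.
  rewrite wderiv_comb// crepr_comb ?lexx ?ltW//; [|exact: d1|exact: d1].
  by rewrite w0' w'0' mulr0 addr0.
- by rewrite !crepr_comb ?lexx ?ltW// uv uv'.
- by rewrite !crepr_comb ?lexx ?ltW// vw vw'.
Qed.

Definition profile_of s (X : state) : @profile R := fun n =>
  match n with
  | Ux => part_fun s (wderiv 1 X.1.1.1) | Uxx => part_fun s (wderiv 2 X.1.1.1)
  | Vx => part_fun s (wderiv 1 X.1.1.2)
  | Wx => part_fun s (wderiv 1 X.1.2) | Wxx => part_fun s (wderiv 2 X.1.2)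
  | Ut => part_fun s X.2.1.1 | Vt => part_fun s X.2.1.2 | Wt => part_fun s X.2.2
  end.

Lemma profile_of_L2 s X : profile_L2 l0 l1 l2 l3 (profile_of s X).
Proof. by case; exact: L2_sqr_integrable. Qed.

Lemma profile_of_comb s k (X Y : state) : calH X -> calH Y ->
  profile_ae_eq l0 l1 l2 l3 (profile_of s (X + k%:C *: Y)) (profile_comb (profile_of s X) k (profile_of s Y)).
Proof.
case: X Y => [[[u v] w] [[a b] c]] [[[u' v'] w'] [[a' b'] c']].
move=> [[su _ _] sv [sw _ _] _ _] [[su' _ _] sv' [sw' _ _] _ _].
have H (d e : R) (f g : L2 d e) : ae_oo d e (fun x => part_fun s (f + k%:C *: g) x = part_fun s f x + k * part_fun s g x).
  by apply: ae_ooS2 (L2_partD f (k%:C *: g) s) (L2_partZ k g s) => x _ -> ->.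
have W (d e : R) m n (f g : L2 d e) : (n <= m)%N -> sobolev m f -> sobolev m g ->
    ae_oo d e (fun x => part_fun s (wderiv n (f + k%:C *: g)) x = part_fun s (wderiv n f) x +
      k * part_fun s (wderiv n g) x).
  by move=> nm sf sg; rewrite wderiv_comb; [exact: H|exact: sf|exact: sg].
by case; rewrite /= /profile_comb /=; [exact: (W _ _ 2)|exact: (W _ _ 2)|exact: (W _ _ 1)|exact: (W _ _ 2)|
  exact: (W _ _ 2)|exact: H|exact: H|exact: H].
Qed.

(** The Poincare inequality for functions that vanish at one end. *)
Lemma AC_poincare (a b : R) (f g h : R -> R) : a < b -> AC a b f g -> f a = 0 \/ f b = 0 ->
  measurable_oo a b h -> sqr_integrable a b g -> ae_oo a b (fun x => f x = h x) ->
  integral_oo a b (fun x => h x ^+ 2) <= (b - a) ^+ 2 * integral_oo a b (fun x => g x ^+ 2).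
Proof.
move=> ab hf f0 mh sg fh; have [_ g2] := sg.
have -> : integral_oo a b (fun x => h x ^+ 2) = integral_oo a b (fun x => f x ^+ 2).
  apply: integral_oo_ae; [exact: measurable_funX|by apply: measurable_funX; exact: AC_measurable hf|].
  by apply: ae_ooS fh => x _ ->.
have -> : (b - a) ^+ 2 * integral_oo a b (fun x => g x ^+ 2) =
    integral_oo a b (fun=> (b - a) * integral_oo a b (fun x => g x ^+ 2)).
  by rewrite integral_oo_cst ?(ltW ab)//; ring.
have H (c d : R) : a <= c -> c <= d -> d <= b -> (f d - f c) ^+ 2 <= (b - a) * integral_oo a b (fun x => g x ^+ 2).
  move=> ac cd db; have hcd := ACS ac cd db hf.
  have sgcd : sqr_integrable c d g.
    by split; [apply: integrable_oo_measurable; case: hcd|exact: integrable_ooS g2].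
  rewrite -(AC_integral cd hcd); apply: (le_trans (sqr_integral_le cd sgcd)).
  apply: ler_pM; [lra|exact: integral_sqr_ge0|lra|].
  have i1 : integrable_oo a d (fun x => g x ^+ 2) by exact: integrable_ooS g2.
  rewrite (@integral_oo_split _ a b d) ?(le_trans ac cd)// (@integral_oo_split _ a d c) ?ac//.
  by have := integral_sqr_ge0 a c g; have := integral_sqr_ge0 d b g; lra.
apply: le_integral_oo; [by case: (AC_sqr_integrable hf)|exact: integrable_oo_cst|].
move=> x /andP[ax xb]; case: f0 => f0.
  by have := H a x (lexx a) (ltW ax) (ltW xb); rewrite f0 subr0.
by have := H x b (ltW ax) (ltW xb) (lexx b); rewrite f0 sub0r sqrrN.
Qed.

Lemma profile_of_poincare s X : calH X -> poincare l0 l1 l2 l3 (profile_of s X).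
Proof.
case: X => [[[u v] w] y] [[su _ u0] _ [sw _ w0] _ _].
have [h1 e1] := wderiv1_AC s l01 (sobolev2_wderiv su).
have [h2 e2] := wderiv1_AC s l23 (sobolev2_wderiv sw).
split.
- apply: AC_poincare l01 h1 _ _ _ e1; [by left; rewrite u0 part0|by case: (L2_sqr_integrable (wderiv 1 u) s)|exact: L2_sqr_integrable].
- apply: AC_poincare l23 h2 _ _ _ e2; [by right; rewrite w0 part0|by case: (L2_sqr_integrable (wderiv 1 w) s)|exact: L2_sqr_integrable].
Qed.

Lemma calHdot_Re (X Y : state) : Re (calHdot X Y) =
  form_energy l0 l1 l2 l3 (profile_of false X) (profile_of false Y) +
    form_energy l0 l1 l2 l3 (profile_of true X) (profile_of true Y).
Proof.
have H (z1 z2 z3 z4 z5 z6 : R[i]) (p1 p2 p3 p4 p5 p6 q1 q2 q3 q4 q5 q6 : R) :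
    Re z1 = p1 + q1 -> Re z2 = p2 + q2 -> Re z3 = p3 + q3 ->
    Re z4 = p4 + q4 -> Re z5 = p5 + q5 -> Re z6 = p6 + q6 ->
    Re (z1 + z2 + z3 + (z4 + z5 + z6)) =
    p1 + p2 + p3 + p4 + p5 + p6 + (q1 + q2 + q3 + q4 + q5 + q6).
  case: z1 z2 z3 z4 z5 z6 => [? ?] [? ?] [? ?] [? ?] [? ?] [? ?] /= -> -> -> -> -> ->.
  by ring.
case: X Y => [[[u v] w] [[a b] c]] [[[u' v'] w'] [[a' b'] c']].
by apply: H; exact: L2dot_Re.
Qed.

Lemma calHnorm_sqr (X : state) : calHnorm X ^+ 2 =
  profile_energy l0 l1 l2 l3 (profile_of false X) + profile_energy l0 l1 l2 l3 (profile_of true X).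
Proof.
rewrite /calHnorm sqr_sqrtr calHdot_Re !form_energy_diag//.
by rewrite addr_ge0//; exact: profile_energy_ge0.
Qed.

(** A real cubic placed in one of the two parts, so that complex test
    functions separate the real and the imaginary part of the weak
    formulation. *)
Lemma L2_clamped_cubic (a b e A B : R) s : a < b -> exists u : L2 a b,
  [/\ sobolev 2 u,
      forall t, ae_oo a b (fun x => part_fun t u x = (t == s)%:R * clamped_cubic e A B x),
      forall t, ae_oo a b (fun x => part_fun t (wderiv 2 u) x = (t == s)%:R * clamped_cubic2 e A B x),
      forall t x, a <= x <= b -> part t (crepr u x) = (t == s)%:R * clamped_cubic e A B x &
      forall t x, a <= x <= b -> part t (crepr (wderiv 1 u) x) = (t == s)%:R * clamped_cubic1 e A B x].
Proof.
move=> ab.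
have h0 t := AC_Z (t == s)%:R (AC_clamped_cubic a b e A B).
have h1 t := AC_Z (t == s)%:R (AC_clamped_cubic1 a b e A B).
have h2 t := AC_Z (t == s)%:R (AC_clamped_cubic2 a b e A B).
have [u uE] := L2_of_parts (fun t => AC_sqr_integrable (h0 t)).
have [u1 u1E] := L2_of_parts (fun t => AC_sqr_integrable (h1 t)).
have [u2 u2E] := L2_of_parts (fun t => AC_sqr_integrable (h2 t)).
have d1 : is_wderiv 1 u u1 by exact: AC_is_wderiv (ltW ab) h0 uE u1E.
have d12 : is_wderiv 1 u1 u2 by exact: AC_is_wderiv (ltW ab) h1 u1E u2E.
have d2 : is_wderiv 2 u u2 by exact: (@is_wderiv_comp _ a b 1 1 u u1).
exists u; split => //.
- case=> [|[|[|//]]] _; [|by exists u1|by exists u2].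
  by exists u; apply/is_wderivP => phi t tphi; rewrite expr0 mul1r.
- by rewrite (wderivE d2).
- apply: (crepr_eq ab (F := fun t x => (t == s)%:R * clamped_cubic e A B x)) => r;
  first exact: AC_continuous (ltW ab) (h0 r).
  by apply: ae_ooS (uE r) => x _ ->.
- rewrite (wderivE d1); apply: (crepr_eq ab (F := fun t x => (t == s)%:R * clamped_cubic1 e A B x)) => r; first exact: AC_continuous (ltW ab) (h1 r).
  by apply: ae_ooS (u1E r) => x _ ->.
Qed.

Lemma L2_affine (a b A B : R) s : a < b -> exists v : L2 a b,
  [/\ sobolev 1 v,
      forall t, ae_oo a b (fun x => part_fun t v x = (t == s)%:R * affine a b A B x),
      forall t, ae_oo a b (fun x => part_fun t (wderiv 1 v) x = (t == s)%:R * ((B - A) / (b - a))),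
      forall t, part t (crepr v a) = (t == s)%:R * A &
      forall t, part t (crepr v b) = (t == s)%:R * B].
Proof.
move=> ab.
have h0 t := AC_Z (t == s)%:R (AC_affine a b A B).
have [v vE] := L2_of_parts (fun t => AC_sqr_integrable (h0 t)).
have [v1 v1E] := L2_of_parts (fun t => sqr_integrable_cst a b ((t == s)%:R * ((B - A) / (b - a)))).
have d1 : is_wderiv 1 v v1 by exact: AC_is_wderiv (ltW ab) h0 vE v1E.
have cr t x : a <= x <= b -> part t (crepr v x) = (t == s)%:R * affine a b A B x.
  apply: (crepr_eq ab (F := fun t x => (t == s)%:R * affine a b A B x)) => r;
    first exact: AC_continuous (ltW ab) (h0 r).
  by apply: ae_ooS (vE r) => y _ ->.
exists v; split => //.
- case=> [|[|//]] _; [|by exists v1].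
  by exists v; apply/is_wderivP => phi t tphi; rewrite expr0 mul1r.
- by rewrite (wderivE d1).
- by move=> t; rewrite cr ?lexx ?ltW// /affine subrr mulr0 addr0.
- move=> t; rewrite cr ?lexx ?ltW// /affine divfK; last by rewrite subr_eq0 (gt_eqF ab).
  by rewrite addrC subrK.
Qed.

End States.

(** * Regularity and transmission conditions on the domain *)

Section Regularity.
Context {R : realType}.
Variables l0 l1 l2 l3 beta : R.
Hypotheses (l01 : l0 < l1) (l12 : l1 < l2) (l23 : l2 < l3).
Implicit Types (s t : bool) (k x : R).
Local Notation state := (state l0 l1 l2 l3).
Local Notation opA := (opA 0 0 beta).
Local Notation domA := (domA 0 0 beta).

Lemma L2dot_part (a b : R) (u z : L2 a b) s (F : R -> R) : measurable_oo a b F ->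
  (forall t, ae_oo a b (fun x => part_fun t z x = (t == s)%:R * F x)) ->
  Re (L2dot u z) = integral_oo a b (fun x => part_fun s u x * F x).
Proof.
move=> mF zE; rewrite L2dot_Re.
have H t : part_dot u z t = if t == s then integral_oo a b (fun x => part_fun t u x * F x) else 0.
  have mu' : measurable_oo a b (part_fun t u) by case: (L2_sqr_integrable u t).
  have mz : measurable_oo a b (part_fun t z) by case: (L2_sqr_integrable z t).
  have E : part_dot u z t = integral_oo a b (fun x => part_fun t u x * ((t == s)%:R * F x)).
    apply: integral_oo_ae; [exact: measurable_funM| |by apply: ae_ooS (zE t) => x _ ->].
    by apply: measurable_funM => //; apply: measurable_funM.
  rewrite E; case: ifP => _; first by apply: integral_oo_ext => x _; rewrite mul1r.
  by rewrite -[RHS](integral_oo0 a b); apply: integral_oo_ext => x _; rewrite mul0r mulr0.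
by rewrite !H; case: s {H zE} => /=; rewrite ?add0r ?addr0.
Qed.

Lemma HH_zero (U : state) : HH U.1 -> HH ((0, 0, 0) : LL l0 l1 l2 l3).
Proof.
move=> hU; have := HH_comb l01 l12 l23 (-1) hU hU.
case: U {hU} => [[[u v] w] y] /=.
by rewrite rmorphN1 !scaleN1r !subrr.
Qed.

(** The weak transmission conditions tested with a static triple of cubics and
    an affine function, whose positions vanish: the products in the first
    factor of the energy space then cancel on both sides. *)
Lemma weak_test (U : state) s (A B C D : R) : domA U ->
  let a1 := clamped_cubic l0 A B l1 in let a2 := clamped_cubic l3 C D l2 in
  integral_oo l0 l1 (fun x => profile_of s (opA U) Ut x * clamped_cubic l0 A B x)
  + integral_oo l1 l2 (fun x => profile_of s (opA U) Vt x * affine l1 l2 a1 a2 x)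
  + integral_oo l2 l3 (fun x => profile_of s (opA U) Wt x * clamped_cubic l3 C D x) =
  - integral_oo l0 l1 (fun x => profile_of s U Uxx x * clamped_cubic2 l0 A B x)
  - beta * integral_oo l1 l2 (fun x => profile_of s U Vt x * affine l1 l2 a1 a2 x)
  - integral_oo l1 l2 (fun x => profile_of s U Vx x * ((a2 - a1) / (l2 - l1)))
  - integral_oo l2 l3 (fun x => profile_of s U Wxx x * clamped_cubic2 l3 C D x).
Proof.
move=> [hU1 hU2 _ hweak] a1 a2.
have [zu [su uE u2E ucr u1cr]] := @L2_clamped_cubic R l0 l1 l0 A B s l01.
have [zw [sw wE w2E wcr w1cr]] := @L2_clamped_cubic R l2 l3 l3 C D s l23.
have [zv [sv vE v1E vl vr]] := @L2_affine R l1 l2 a1 a2 s l12.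
have hz : HH ((zu, zv, zw) : LL l0 l1 l2 l3).
  have c0 e P Q : clamped_cubic e P Q e =
    0 :> R by rewrite /clamped_cubic subrr !expr0n/= !mulr0 addr0.
  have c1 e P Q : clamped_cubic1 e P Q e =
    0 :> R by rewrite /clamped_cubic1 subrr !expr0n/= !mulr0 addr0.
  split.
  - split=> //; apply: partP => t; rewrite part0.
      by rewrite ucr ?lexx ?ltW// c0 mulr0.
    by rewrite u1cr ?lexx ?ltW// c1 mulr0.
  - exact: sv.
  - split=> //; apply: partP => t; rewrite part0.
      by rewrite wcr ?lexx ?ltW// c0 mulr0.
    by rewrite w1cr ?lexx ?ltW// c1 mulr0.
  - by apply: partP => t; rewrite ucr ?lexx ?ltW// vl.
  - by apply: partP => t; rewrite wcr ?lexx ?ltW// vr.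
have := hweak ((0, 0, 0), (zu, zv, zw)) (HH_zero hU1) hz.
have alg (P1 P2 P3 q1 q2 q3 e1 x1 e2 e3 e4 x2 : R[i]) (r1 r2 r3 s1 s2 s3 s4 : R) :
    P1 + P2 + P3 + (q1 + q2 + q3) =
    P1 + P2 + P3 - e1 - 0%:C * x1 - beta%:C * e2 - e3 - e4 - 0%:C * x2 ->
    Re q1 = r1 -> Re q2 = r2 -> Re q3 = r3 ->
    Re e1 = s1 -> Re e2 = s2 -> Re e3 = s3 -> Re e4 = s4 ->
    r1 + r2 + r3 = - s1 - beta * s2 - s3 - s4.
  move/(congr1 Re).
  case: P1 P2 P3 q1 q2 q3 e1 x1 e2 e3 e4 x2 => [? ?] [? ?] [? ?] [? ?] [? ?] [? ?] [? ?] [? ?] [? ?] [? ?] [? ?] [? ?] /= h <- <- <- <- <- <- <-.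
  by lra.
have mcub (a b e P Q : R) : measurable_oo a b (clamped_cubic e P Q) by exact: AC_measurable (AC_clamped_cubic a b e P Q).
have mcub2 (a b e P Q : R) : measurable_oo a b (clamped_cubic2 e P Q) by exact: AC_measurable (AC_clamped_cubic2 a b e P Q).
have maff := AC_measurable (AC_affine l1 l2 a1 a2).
case: U hU1 hU2 hweak => [[[pu pv] pw] [[qu qv] qw]] hU1 hU2 hweak /alg {alg}; apply.
- exact: L2dot_part (mcub _ _ _ _ _) uE.
- exact: L2dot_part maff vE.
- exact: L2dot_part (mcub _ _ _ _ _) wE.
- exact: L2dot_part (mcub2 _ _ _ _ _) u2E.
- exact: L2dot_part maff vE.
- exact: (@L2dot_part _ _ _ _ s (fun=> (a2 - a1) / (l2 - l1)) (measurable_cst _) v1E).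
- exact: L2dot_part (mcub2 _ _ _ _ _) w2E.
Qed.

Lemma crepr_chain (a b : R) (u g h : L2 a b) s : a < b -> is_wderiv 1 u g ->
  is_wderiv 1 g h -> AC a b (fun x => part s (crepr u x)) (fun x => part s (crepr g x)).
Proof.
move=> ab ug gh; have [h1 _] := wderiv1_AC s ab ug; have [h2 e2] := wderiv1_AC s ab gh.
apply: AC_ae h1; first exact: AC_measurable h2.
by apply: ae_ooS e2 => x _ ->.
Qed.

(** The profile made of continuous representatives, which have traces. *)
Definition crepr_profile s (U : state) : @profile R := fun n =>
  match n with
  | Ux => fun x => part s (crepr (wderiv 1 U.1.1.1) x)
  | Uxx => fun x => part s (crepr (wderiv 2 U.1.1.1) x)
  | Vx => fun x => part s (crepr (wderiv 1 U.1.1.2) x)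
  | Wx => fun x => part s (crepr (wderiv 1 U.1.2) x)
  | Wxx => fun x => part s (crepr (wderiv 2 U.1.2) x)
  | Ut => fun x => part s (crepr U.2.1.1 x)
  | Vt => fun x => part s (crepr U.2.1.2 x)
  | Wt => fun x => part s (crepr U.2.2 x)
  end.

(** The fourth derivative of u and the second one of v give all lower
    derivatives by du Bois-Reymond. Integrating by parts in [weak_test] leaves
    a linear relation between traces, valid for all cubics; suitable cubics
    isolate the four transmission conditions. *)
Lemma domA_regular (U : state) s : domA U ->
  profile_L2 l0 l1 l2 l3 (crepr_profile s U) /\
    profile_ae_eq l0 l1 l2 l3 (crepr_profile s U) (profile_of s U) /\
  exists f0 f3 v0 w0 w3,
    regular l0 l1 l2 l3 beta (crepr_profile s U) (profile_of s (opA U)) f0 f3 v0 w0 w3.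
Proof.
move=> hU; have wt A B C D := weak_test s A B C D hU.
case: U hU wt => [[[u1 v1] w1] [[u2 v2] w2]].
move=> [[[su u10 u11] sv [sw w10 w11] uv vw] [[su2 _ _] sv2 [sw2 _ _] uv2 vw2] [du dv dw] _] wt.
have hu1 := sobolev_wderiv (isT : 1 <= 2)%N su.
have hu2 := sobolev2_wderiv su.
have hw1 := sobolev_wderiv (isT : 1 <= 2)%N sw.
have hw2 := sobolev2_wderiv sw.
have hv1 := sobolev_wderiv (isT : 1 <= 1)%N sv.
have hv2 : is_wderiv 1 (wderiv 1 v1) (wderiv 2 v1).
  exact: (@is_wderiv_quot R l1 l2 1 1 v1 _ _ hv1 (has_wderivP dv)).
have [u3 hu3 hu4] : exists2 g, is_wderiv 1 (wderiv 2 u1) g & is_wderiv 1 g (wderiv 4 u1).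
  apply: (is_wderiv2_split l01).
  exact: (@is_wderiv_quot R l0 l1 2 2 u1 _ _ (has_wderivP (su 2%N isT)) (has_wderivP du)).
have [w3 hw3 hw4] : exists2 g, is_wderiv 1 (wderiv 2 w1) g & is_wderiv 1 g (wderiv 4 w1).
  apply: (is_wderiv2_split l23).
  exact: (@is_wderiv_quot R l2 l3 2 2 w1 _ _ (has_wderivP (sw 2%N isT)) (has_wderivP dw)).
have hy := sobolev_wderiv (isT : 1 <= 2)%N su2.
have hz := sobolev_wderiv (isT : 1 <= 1)%N sv2.
have hr := sobolev_wderiv (isT : 1 <= 2)%N sw2.
set U : state := ((u1, v1, w1), (u2, v2, w2)).
set c := crepr_profile s U; set d := profile_of s (opA U).
have eqc : profile_ae_eq l0 l1 l2 l3 c (profile_of s U).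
  case; [exact: (wderiv1_AC s l01 hu2).2|exact: (wderiv1_AC s l01 hu3).2|
    exact: (wderiv1_AC s l12 hv2).2|exact: (wderiv1_AC s l23 hw2).2|
    exact: (wderiv1_AC s l23 hw3).2|exact: (wderiv1_AC s l01 hy).2|
    exact: (wderiv1_AC s l12 hz).2|exact: (wderiv1_AC s l23 hr).2].
have goodc : profile_L2 l0 l1 l2 l3 c.
  case; [exact: AC_sqr_integrable (wderiv1_AC s l01 hu2).1|exact: AC_sqr_integrable (wderiv1_AC s l01 hu3).1|
    exact: AC_sqr_integrable (wderiv1_AC s l12 hv2).1|exact: AC_sqr_integrable (wderiv1_AC s l23 hw2).1|
    exact: AC_sqr_integrable (wderiv1_AC s l23 hw3).1|exact: AC_sqr_integrable (wderiv1_AC s l01 hy).1|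
    exact: AC_sqr_integrable (wderiv1_AC s l12 hz).1|exact: AC_sqr_integrable (wderiv1_AC s l23 hr).1].
split=> //; split=> //.
have mbl (a b : R) (g : L2 a b) : measurable_oo a b (part_fun s g) by case: (L2_sqr_integrable g s).
have dE (a b : R) (g h : L2 a b) k :
    ae_oo a b (fun x => part_fun s (- g + k%:C *: h) x = - part_fun s g x + k * part_fun s h x).
  apply: ae_ooS2 (L2_partD (- g) (k%:C *: h) s) _; last first.
    exact: (ae_ooS2 (S := fun x => part_fun s (- g) x = - part_fun s g x /\
      part_fun s (k%:C *: h) x = k * part_fun s h x)
      (fun x _ h1 h2 => conj h1 h2) (L2_partN g s) (L2_partZ k h s)).
  by move=> x _ -> [-> ->].
have cf0 := crepr_chain s l01 hu1 hu2.
have cf1 := crepr_chain s l01 hu2 hu3.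
have cf2 := crepr_chain s l01 hu3 hu4.
have cf3 : AC l0 l1 (fun x => part s (crepr u3 x)) (fun x => - d Ut x).
  apply: AC_ae (wderiv1_AC s l01 hu4).1.
    by apply: measurable_funN; exact: mbl.
  by apply: ae_ooS (dE _ _ (wderiv 4 u1) (wderiv 2 u2) 0) => x _ h; rewrite /d /= h mul0r addr0 opprK.
have cw0 := crepr_chain s l23 hw1 hw2.
have cw1 := crepr_chain s l23 hw2 hw3.
have cw2 := crepr_chain s l23 hw3 hw4.
have cw3 : AC l2 l3 (fun x => part s (crepr w3 x)) (fun x => - d Wt x).
  apply: AC_ae (wderiv1_AC s l23 hw4).1.
    by apply: measurable_funN; exact: mbl.
  by apply: ae_ooS (dE _ _ (wderiv 4 w1) (wderiv 2 w2) 0) => x _ h; rewrite /d /= h mul0r addr0 opprK.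
have cv0 := crepr_chain s l12 hv1 hv2.
have cz := (wderiv1_AC s l12 hz).1.
have cv1 : AC l1 l2 (c Vx) (fun x => d Vt x + beta * c Vt x).
  apply: AC_ae (wderiv1_AC s l12 hv2).1.
    apply: measurable_funD; first exact: mbl.
    by apply: measurable_funM => //; exact: AC_measurable cz.
  have h1 := L2_partD (wderiv 2 v1) (- (beta%:C *: v2)) s.
  have h2 := ae_ooS2 (S := fun x => part_fun s (- (beta%:C *: v2)) x = - (beta * part_fun s v2 x))
    (fun x _ h1 h2 => etrans h1 (congr1 -%R h2)) (L2_partN (beta%:C *: v2) s) (L2_partZ beta v2 s).
  have h3 := ae_ooS2 (S := fun x => d Vt x = part_fun s (wderiv 2 v1) x - beta * part_fun s v2 x)
    (fun x _ h1 h2 => etrans h1 (congr1 (+%R _) h2)) h1 h2.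
  by apply: ae_ooS2 h3 (eqc Vt) => x _ -> ->; rewrite subrK.
have cy := (wderiv1_AC s l01 hy).1; have cr := (wderiv1_AC s l23 hr).1.
(* boundary terms of the weak formulation, for all cubics *)
have key A B C D :
    - (part s (crepr u3 l1) * clamped_cubic l0 A B l1) + c Uxx l1 * clamped_cubic1 l0 A B l1
    + c Vx l2 * clamped_cubic l3 C D l2 - c Vx l1 * clamped_cubic l0 A B l1
    + part s (crepr w3 l2) * clamped_cubic l3 C D l2 - c Wxx l2 * clamped_cubic1 l3 C D l2 = 0.
  have := wt A B C D; rewrite -/U -/d /=.
  set a1 := clamped_cubic l0 A B l1; set a2 := clamped_cubic l3 C D l2.
  have e1 := beam_test l0 (ltW l01) cf2 cf3 A B.
  have e2 := beam_test l3 (ltW l23) cw2 cw3 C D.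
  have e3 := wave_affine l12 cv0 cv1 cz a1 a2.
  have g1 : integral_oo l0 l1 (fun x => part_fun s (wderiv 2 u1) x * clamped_cubic2 l0 A B x) =
      integral_oo l0 l1 (fun x => c Uxx x * clamped_cubic2 l0 A B x).
    have mc := AC_measurable (AC_clamped_cubic2 l0 l1 l0 A B).
    apply: integral_oo_ae; [by apply: measurable_funM => //;
      exact: mbl|by apply: measurable_funM => //; exact: AC_measurable cf2|].
    by apply: ae_ooS (eqc Uxx) => x _ ->.
  have g2 : integral_oo l2 l3 (fun x => part_fun s (wderiv 2 w1) x * clamped_cubic2 l3 C D x) =
      integral_oo l2 l3 (fun x => c Wxx x * clamped_cubic2 l3 C D x).
    have mc := AC_measurable (AC_clamped_cubic2 l2 l3 l3 C D).
    apply: integral_oo_ae; [by apply: measurable_funM => //;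
      exact: mbl|by apply: measurable_funM => //; exact: AC_measurable cw2|].
    by apply: ae_ooS (eqc Wxx) => x _ ->.
  have g3 : integral_oo l1 l2 (fun x => part_fun s v2 x * affine l1 l2 a1 a2 x) =
      integral_oo l1 l2 (fun x => affine l1 l2 a1 a2 x * c Vt x).
    have mc := AC_measurable (AC_affine l1 l2 a1 a2).
    apply: integral_oo_ae; [by apply: measurable_funM => //;
      exact: mbl|by apply: measurable_funM => //; exact: AC_measurable cz|].
    by apply: ae_ooS (eqc Vt) => x _ ->; rewrite mulrC.
  have g4 : integral_oo l1 l2 (fun x => part_fun s (wderiv 1 v1) x * ((a2 - a1) / (l2 - l1))) =
      (a2 - a1) / (l2 - l1) * (part s (crepr v1 l2) - part s (crepr v1 l1)).
    rewrite -(AC_integral (ltW l12) (wderiv1_AC s l12 hv1).1) -integral_ooZ.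
      by apply: integral_oo_ext => x _; rewrite mulrC.
    exact/sqr_integrable_integrable/L2_sqr_integrable.
  rewrite g1 g2 g3 g4 {g1 g2 g3 g4 wt}.
  have -> : integral_oo l1 l2 (fun x => part_fun s (wderiv 2 v1 - beta%:C *: v2) x * affine l1 l2 a1 a2 x) =
     integral_oo l1 l2 (fun x => d Vt x * affine l1 l2 a1 a2 x) by [].
  have -> : integral_oo l0 l1 (fun x => part_fun s (- wderiv 4 u1 + 0%:C *: wderiv 2 u2) x * clamped_cubic l0 A B x) =
     integral_oo l0 l1 (fun x => d Ut x * clamped_cubic l0 A B x) by [].
  have -> : integral_oo l2 l3 (fun x => part_fun s (- wderiv 4 w1 + 0%:C *: wderiv 2 w2) x * clamped_cubic l3 C D x) =
     integral_oo l2 l3 (fun x => d Wt x * clamped_cubic l3 C D x) by [].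
  move: e1 e2 e3 => /=.
  have -> : clamped_cubic l0 A B l0 = 0 by rewrite /clamped_cubic subrr !expr0n/= !mulr0 addr0.
  have -> : clamped_cubic1 l0 A B l0 = 0 by rewrite /clamped_cubic1 subrr !expr0n/= !mulr0 addr0.
  have -> : clamped_cubic l3 C D l3 = 0 by rewrite /clamped_cubic subrr !expr0n/= !mulr0 addr0.
  have -> : clamped_cubic1 l3 C D l3 = 0 by rewrite /clamped_cubic1 subrr !expr0n/= !mulr0 addr0.
  rewrite -/a1 -/a2.
  move: (integral_oo l0 l1 _) (integral_oo l0 l1 _) (integral_oo l1 l2 _) (integral_oo l1 l2 _) (integral_oo l2 l3 _) (integral_oo l2 l3 _).
  move=> i1 i2 i3 i4 i5 i6.
  by lra.
have L1 : 0 < l1 - l0 by rewrite subr_gt0.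
have L3 : l2 - l3 < 0 by rewrite subr_lt0.
(* the cubic with value 0 and nonzero slope at the junction *)
have cU2 : c Uxx l1 = 0.
  have := key 1 (- (l1 - l0)) 0 0.
  have -> : clamped_cubic l0 1 (- (l1 - l0)) l1 = 0 by rewrite /clamped_cubic; ring.
  have -> : clamped_cubic1 l0 1 (- (l1 - l0)) l1 = (l1 - l0) ^+ 2 by rewrite /clamped_cubic1; ring.
  have -> : clamped_cubic l3 0 0 l2 = 0 by rewrite /clamped_cubic; ring.
  have -> : clamped_cubic1 l3 0 0 l2 = 0 by rewrite /clamped_cubic1; ring.
  rewrite !mulr0 !(oppr0, subr0, addr0) add0r => /eqP; rewrite mulf_eq0 expf_eq0/=.
  by rewrite (gt_eqF L1) orbF => /eqP.
have cW2 : c Wxx l2 = 0.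
  have := key 0 0 1 (- (l2 - l3)).
  have -> : clamped_cubic l3 1 (- (l2 - l3)) l2 = 0 by rewrite /clamped_cubic; ring.
  have -> : clamped_cubic1 l3 1 (- (l2 - l3)) l2 = (l2 - l3) ^+ 2 by rewrite /clamped_cubic1; ring.
  have -> : clamped_cubic l0 0 0 l1 = 0 by rewrite /clamped_cubic; ring.
  have -> : clamped_cubic1 l0 0 0 l1 = 0 by rewrite /clamped_cubic1; ring.
  rewrite !mulr0 !(oppr0, subr0, addr0) add0r => /eqP; rewrite oppr_eq0 mulf_eq0 expf_eq0/=.
  by rewrite (lt_eqF L3) orbF => /eqP.
(* with free bending moments, a nonzero value at the junction *)
have cu3 : part s (crepr u3 l1) = - c Vx l1.
  have := key 0 1 0 0; rewrite cU2 cW2.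
  have -> : clamped_cubic l0 0 1 l1 = (l1 - l0) ^+ 2 by rewrite /clamped_cubic; ring.
  have -> : clamped_cubic l3 0 0 l2 = 0 by rewrite /clamped_cubic; ring.
  rewrite !mulr0 !mul0r !(oppr0, subr0, addr0) -opprD -mulrDl => /eqP.
  by rewrite oppr_eq0 mulf_eq0 expf_eq0/= (gt_eqF L1) orbF addr_eq0 => /eqP.
have cw3' : part s (crepr w3 l2) = - c Vx l2.
  have := key 0 0 0 1; rewrite cU2 cW2.
  have -> : clamped_cubic l3 0 1 l2 = (l2 - l3) ^+ 2 by rewrite /clamped_cubic; ring.
  have -> : clamped_cubic l0 0 0 l1 = 0 by rewrite /clamped_cubic; ring.
  rewrite !mulr0 !mul0r !(oppr0, subr0, addr0, add0r) -mulrDl => /eqP.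
  by rewrite mulf_eq0 expf_eq0/= (lt_eqF L3) orbF addrC addr_eq0 => /eqP.
exists (fun x => part s (crepr u1 x)), (fun x => part s (crepr u3 x)),
  (fun x => part s (crepr v1 x)), (fun x => part s (crepr w1 x)), (fun x => part s (crepr w3 x)).
split; [exact: cf0|exact: cf1|exact: cf2|exact: cf3|exact: cy|exact: cv0|exact: cv1|
  exact: cz|exact: cw0|exact: cw1|exact: cw2|exact: cw3|exact: cr|
  by rewrite u10 part0|by rewrite /c /= u11 part0|by rewrite w10 part0|by rewrite /c /= w11 part0|
  by rewrite uv|by rewrite vw|by rewrite /c /= uv2|by rewrite /c /= vw2|
  exact: cU2|exact: cW2|exact: cu3|exact: cw3'].
Qed.

(** The weak formulation tested with the state itself. *)
Lemma domA_dissipation (U : state) : domA U ->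
  Re (calHdot (opA U) U) = - beta * (kineticV l1 l2 (profile_of false U) + kineticV l1 l2 (profile_of true U)).
Proof.
move=> [hU1 hU2 _ hweak]; rewrite (hweak U hU1 hU2).
have sym (a b : R) (f g : L2 a b) : Re (L2dot f g) = Re (L2dot g f).
  by rewrite !L2dot_Re; congr (_ + _); apply: integral_oo_ext => x _; rewrite mulrC.
case: U {hweak hU1 hU2} => [[[u v] w] [[a b] c]].
have alg (P1 P2 P3 Q1 x1 e2 Q2 Q3 x2 : R[i]) : Re P1 = Re Q1 -> Re P2 = Re Q2 -> Re P3 = Re Q3 ->
   Re (P1 + P2 + P3 - Q1 - 0%:C * x1 - beta%:C * e2 - Q2 - Q3 - 0%:C * x2) = - beta * Re e2.
  case: P1 P2 P3 Q1 x1 e2 Q2 Q3 x2 => [? ?] [? ?] [? ?] [? ?] [? ?] [? ?] [? ?] [? ?] [? ?] /=.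
  by move=> -> -> ->; ring.
transitivity (- beta * Re (L2dot b b)); first by apply: alg; exact: sym.
rewrite L2dot_Re /part_dot /kineticV; congr (_ * (_ + _)); apply: integral_oo_ext => x _; exact: expr2.
Qed.

End Regularity.

(** * Decay from a Lyapunov form *)

Section SemigroupDecay.
Context {R : realType} {X : lmodType R[i]}.
Variables (H : set X) (N : X -> R) (S : R -> X -> X) (b : X -> X -> R) (C kap : R).
Hypothesis HS : contraction_C0_semigroup H N S.
Hypothesis HD : forall x y (k : R), H x -> H y -> H (x + k%:C *: y).
Hypothesis N0 : forall x, 0 <= N x.
Hypothesis bl : forall x y z (k : R), H x -> H y -> H z ->
  b (x + k%:C *: y) z = b x z + k * b y z.
Hypothesis br : forall x y z (k : R), H x -> H y -> H z ->
  b z (x + k%:C *: y) = b z x + k * b z y.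
Hypothesis C0 : 0 <= C.
Hypothesis bN : forall x y, H x -> H y -> `|b x y| <= C * (N x * N y).
Hypothesis b0 : forall x, H x -> 0 <= b x x.
Hypothesis kap0 : 0 < kap.
Hypothesis bgen : forall x y, C0_generator H N S x y -> b y x + b x y <= - kap * b x x.

Let H0 x : H x -> H 0.
Proof. by move=> hx; have := HD (-1) hx hx; rewrite rmorphN1 scaleN1r subrr. Qed.

Let HB x y : H x -> H y -> H (x - y).
Proof. by move=> hx hy; have := HD (-1) hx hy; rewrite rmorphN1 scaleN1r. Qed.

Let HZ x (k : R) : H x -> H (k%:C *: x).
Proof. by move=> hx; have := HD k (H0 hx) hx; rewrite add0r. Qed.

Lemma semigroup_lin t (k : R) x y : 0 <= t -> H x -> H y ->
  S t (x + k%:C *: y) = S t x + k%:C *: S t y.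
Proof. by move=> t0 hx hy; rewrite addrC (C0_linear HS)// addrC. Qed.

(** S t commutes with S h and does not increase the norm, so the difference
    quotients along the orbit converge at least as fast as at time 0. *)
Lemma semigroup_generator t x y : 0 <= t -> C0_generator H N S x y ->
  C0_generator H N S (S t x) (S t y).
Proof.
move=> t0 [hx hy lim]; split; [exact: (C0_stable HS)|exact: (C0_stable HS)|].
apply: (squeeze_cvgr _ (cvg_cst 0) lim); near=> h.
rewrite N0/=.
have h0 : 0 < h by near: h; exact: nbhs_right_gt.
have hSx : H (S h x) by apply: (C0_stable HS) => //; exact: ltW.
have -> : (h^-1)%:C *: (S h (S t x) - S t x) - S t y =
    S t ((h^-1)%:C *: (S h x - x) - y).
  have -> : S h (S t x) = S t (S h x).
    by rewrite -!(C0_add HS)// ?(ltW h0)// addrC.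
  have E a c : H a -> H c -> S t (a - c) = S t a - S t c.
    by move=> ha hc; have := semigroup_lin (-1) t0 ha hc; rewrite rmorphN1 !scaleN1r.
  rewrite E//; last by apply: HZ; exact: HB.
  have E2 a : H a -> S t ((h^-1)%:C *: a) = (h^-1)%:C *: S t a.
    move=> ha; have hz := H0 ha.
    have S0 : S t 0 = 0.
      by have := E 0 0 hz hz; rewrite !subrr.
    by have := semigroup_lin h^-1 t0 hz ha; rewrite S0 !add0r.
  by rewrite E2 ?E//; exact: HB.
by apply: (C0_contraction HS) => //; apply: HB => //; apply: HZ; exact: HB.
Unshelve. all: by end_near. Qed.

(** One Euler step. The remainder is the image under S t of the remainder at
    time 0, hence the error is bounded uniformly in t by contractivity, and no
    continuity of the orbit is needed. *)
Lemma form_step t h x y : 0 <= t -> 0 < h -> h <= 1 -> C0_generator H N S x y ->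
  b (S (t + h) x) (S (t + h) x) <= (1 - kap * h) * b (S t x) (S t x) +
  h * (h * (C * N y ^+ 2) +
   N ((h^-1)%:C *: (S h x - x) - y) * (2 * C * (N x + N y) + C * N ((h^-1)%:C *: (S h x - x) - y))).
Proof.
move=> t0 h0 h1 gxy; have [hx hy _] := gxy.
set r := (h^-1)%:C *: (S h x - x) - y.
have hSx : H (S h x) by apply: (C0_stable HS) => //; exact: ltW.
have hr : H r by apply: HB => //; apply: HZ; exact: HB.
have SE : S h x = x + h%:C *: (y + 1%:C *: r).
  rewrite /r rmorph1 scale1r (addrC y) subrK scalerA -rmorphM divff ?gt_eqF// rmorph1 scale1r.
  by rewrite addrC subrK.
have -> : S (t + h) x = S t x + h%:C *: (S t y + 1%:C *: S t r).
  by rewrite (C0_add HS)// ?(ltW h0)// SE semigroup_lin// ?semigroup_lin//; exact: HD.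
have [HX HY _] := semigroup_generator t0 gxy.
have HR : H (S t r) by exact: (C0_stable HS).
have := bgen (semigroup_generator t0 gxy).
have nx := C0_contraction HS t0 hx.
have ny := C0_contraction HS t0 hy.
have nr := C0_contraction HS t0 hr.
move: HX HY HR nx ny nr; move: (S t x) (S t y) (S t r) => x' y' r' HX HY HR nx ny nr dis.
have HYR : H (y' + 1%:C *: r') by exact: HD.
have HXYR : H (x' + h%:C *: (y' + 1%:C *: r')) by exact: HD.
rewrite !(bl, br)//.
have B u v (nu nv : R) : H u -> H v -> N u <= nu -> N v <= nv -> b u v <= C * (nu * nv).
  move=> hu hv lu lv; apply: (le_trans (ler_norm _)); apply: (le_trans (bN hu hv)).
  by apply: ler_wpM2l => //; apply: ler_pM.
have b1 := B _ _ _ _ HY HY ny ny; have b2 := B _ _ _ _ HY HR ny nr.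
have b3 := B _ _ _ _ HR HY nr ny; have b4 := B _ _ _ _ HR HR nr nr.
have b5 := B _ _ _ _ HX HR nx nr; have b6 := B _ _ _ _ HR HX nr nx.
have CY0 : 0 <= C * (N r * N y) by rewrite !mulr_ge0.
have CR0 : 0 <= C * (N r * N r) by rewrite !mulr_ge0.
move: (N x) (N y) (N r) b1 b2 b3 b4 b5 b6 CY0 CR0 => nX nY nR b1 b2 b3 b4 b5 b6 CY0 CR0.
have e1 : h * (b y' y' + b y' r' + b r' y' + b r' r') <=
  h * (C * nY ^+ 2) + 2 * (C * (nR * nY)) + C * (nR * nR).
  apply: (@le_trans _ _ (h * (C * nY ^+ 2) + h * (2 * (C * (nR * nY)) + C * (nR * nR)))).
    by rewrite -mulrDr ler_wpM2l ?(ltW h0)//; lra.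
  rewrite -addrA lerD2l ler_piMl//; lra.
have e2 : b r' x' + b x' r' <= 2 * (C * (nR * nX)) by lra.
have e3 : (b y' x' + b x' y') + (b r' x' + b x' r') + h * (b y' y' + b y' r' + b r' y' + b r' r') <=
   - kap * b x' x' + (h * (C * nY ^+ 2) + nR * (2 * C * (nX + nY) + C * nR)) by lra.
have := ler_wpM2l (ltW h0) e3.
by lra.
Qed.

(** Iterate n + 1 Euler steps of length t / (n + 1): the factors 1 - kap h
    multiply to at most exp(- kap t), and the accumulated error is smaller
    than any e. *)
Theorem semigroup_decay t x y : 0 <= t -> C0_generator H N S x y ->
  b (S t x) (S t x) <= expR (- kap * t) * b x x.
Proof.
move=> t0 gxy; have [hx hy lim] := gxy.
move: t0; rewrite le_eqVlt => /predU1P[<-|tp].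
  by rewrite (C0_zero HS)// mulr0 expR0 mul1r.
apply/ler_addgt0Pr => e e0.
(* error per unit of time smaller than [e / t] for all small steps *)
pose err (h : R) := h * (C * N y ^+ 2) +
   N ((h^-1)%:C *: (S h x - x) - y) * (2 * C * (N x + N y) + C * N ((h^-1)%:C *: (S h x - x) - y)).
have err0 : err h @[h --> 0^'+] --> (0 : R).
  rewrite -[X in _ --> X](_ : 0 * (C * N y ^+ 2) + 0 * (2 * C * (N x + N y) + C * 0) = 0);
    last by ring.
  apply: cvgD.
    apply: cvgM; last exact: cvg_cst.
    by apply: cvg_at_right_filter; exact: cvg_id.
  apply: cvgM => //; apply: cvgD; first exact: cvg_cst.
  by apply: cvgM => //; exact: cvg_cst.
have et : 0 < e / t by rewrite divr_gt0.
have [d /= d0 hd] : \forall h \near 0^'+, [/\ err h < e / t, h <= 1 & kap * h <= 1].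
  near=> h; split.
  - by near: h; apply: (cvgr_lt 0 err0).
  - by near: h; exact: nbhs_right_le.
  - rewrite mulrC -ler_pdivlMr//; near: h; apply: nbhs_right_le; exact: divr_gt0.
pose n := Num.truncn (t / d).
pose h := t / n.+1%:R.
have n0 : (0 : R) < n.+1%:R by [].
have h0 : 0 < h by rewrite divr_gt0.
have hlt : h < d.
  rewrite /h ltr_pdivrMr// mulrC -ltr_pdivrMr//.
  by have := truncnS_gt (t / d).
have [he h1 hk] := hd h (ltac:(by rewrite /ball/= sub0r normrN gtr0_norm)) h0.
pose q := 1 - kap * h.
have q0 : 0 <= q by rewrite subr_ge0.
have q1 : q <= 1 by rewrite /q lerBlDr lerDl mulr_ge0// ltW.
have step k : b (S (k%:R * h) x) (S (k%:R * h) x) <= q ^+ k * b x x + k%:R * (h * (e / t)).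
  elim: k => [|k IH]; first by rewrite !mul0r expr0 mul1r addr0 (C0_zero HS).
  have kh0 : 0 <= k%:R * h by rewrite mulr_ge0// ltW.
  have := form_step kh0 h0 h1 gxy; rewrite -/(err h) -/q.
  have -> : k%:R * h + h = k.+1%:R * h by rewrite -natr1; ring.
  move=> /le_trans; apply.
  have l1 := ler_wpM2l q0 IH.
  have l2 : h * err h <= h * (e / t) by rewrite ler_wpM2l ?ltW.
  have l3 : q * (k%:R * (h * (e / t))) <= k%:R * (h * (e / t)).
    by rewrite ler_piMl// mulr_ge0// mulr_ge0// ltW.
  rewrite exprS -natr1.
  by lra.
have := step n.+1.
have -> : n.+1%:R * h = t by rewrite /h mulrC divfK// gt_eqF.
move=> /le_trans; apply; apply: lerD; last first.
  have -> : n.+1%:R * (h * (e / t)) = e by rewrite /h; field; rewrite !gt_eqF.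
  by [].
apply: ler_wpM2r; first exact: b0.
have -> : - kap * t = n.+1%:R * (- (kap * h)) by rewrite /h; field; rewrite gt_eqF.
rewrite expRM_natl lerXn2r ?nnegrE ?expR_ge0//.
exact: expR_ge1Dx.
Unshelve. all: by end_near. Qed.

End SemigroupDecay.

(** * Exponential stability *)

Lemma norm_le_of_sqr (R : realType) (M x y : R) : 0 <= M -> 0 <= y ->
  x ^+ 2 <= M * y ^+ 2 -> `|x| <= (M + 1) * y.
Proof.
move=> M0 y0 h; rewrite -(@ler_pXn2r _ 2)// ?nnegrE ?mulr_ge0 ?addr_ge0//.
rewrite real_normK ?num_real//; apply: (le_trans h); rewrite exprMn.
by apply: ler_wpM2r; [exact: sqr_ge0|nra].
Qed.

Section LyapunovOnStates.
Context {R : realType}.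
Variables l0 l1 l2 l3 beta : R.
Hypotheses (l01 : l0 < l1) (l12 : l1 < l2) (l23 : l2 < l3).
Local Notation state := (state l0 l1 l2 l3).
Local Notation opA := (opA 0 0 beta).
Local Notation domA := (domA 0 0 beta).
Local Notation cE := (profile_energy l0 l1 l2 l3).
Local Notation N := (@calHnorm R l0 l1 l2 l3).

Definition state_form (Q : @profile R -> @profile R -> R) (X Y : state) : R :=
  Q (profile_of false X) (profile_of false Y) + Q (profile_of true X) (profile_of true Y).

Lemma profile_of_energy_le s (X : state) : cE (profile_of s X) <= N X ^+ 2.
Proof.
rewrite calHnorm_sqr.
have h0 := profile_energy_ge0 l0 l1 l2 l3 (profile_of false X).
have h1 := profile_energy_ge0 l0 l1 l2 l3 (profile_of true X).
by case: s; lra.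
Qed.

Lemma state_form_left Q k (X Y Z : state) : bilinear_bounded l0 l1 l2 l3 Q ->
  calH X -> calH Y -> calH Z ->
  state_form Q (X + k%:C *: Y) Z = state_form Q X Z + k * state_form Q Y Z.
Proof.
move=> bQ hX hY hZ.
have E s : Q (profile_of s (X + k%:C *: Y)) (profile_of s Z) =
    Q (profile_of s X) (profile_of s Z) + k * Q (profile_of s Y) (profile_of s Z).
  have gX := profile_of_L2 s X; have gY := profile_of_L2 s Y; have gZ := profile_of_L2 s Z.
  have gXY := profile_L2_comb k gX gY.
  rewrite (bil_ae bQ (profile_of_L2 s _) gXY gZ gZ (profile_of_comb s k hX hY)) ?(bil_left bQ)//.
  by move=> n; apply: ae_ooW.
by rewrite /state_form !E; ring.
Qed.

Lemma state_form_right Q k (X Y Z : state) : bilinear_bounded l0 l1 l2 l3 Q ->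
  calH X -> calH Y -> calH Z ->
  state_form Q Z (X + k%:C *: Y) = state_form Q Z X + k * state_form Q Z Y.
Proof.
move=> bQ hX hY hZ.
have E s : Q (profile_of s Z) (profile_of s (X + k%:C *: Y)) =
    Q (profile_of s Z) (profile_of s X) + k * Q (profile_of s Z) (profile_of s Y).
  have gX := profile_of_L2 s X; have gY := profile_of_L2 s Y; have gZ := profile_of_L2 s Z.
  have gXY := profile_L2_comb k gX gY.
  have zz : profile_ae_eq l0 l1 l2 l3 (profile_of s Z) (profile_of s Z) by move=> n; apply: ae_ooW.
  by rewrite (bil_ae bQ gZ gZ (profile_of_L2 s _) gXY zz (profile_of_comb s k hX hY)) ?(bil_right bQ).
by rewrite /state_form !E; ring.
Qed.

Lemma state_form_bound Q : bilinear_bounded l0 l1 l2 l3 Q ->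
  exists2 C, 0 <= C & forall X Y : state, calH X -> calH Y ->
    `|state_form Q X Y| <= C * (N X * N Y).
Proof.
move=> bQ; have [C C0 hC] := bil_bound bQ.
exists (2 * (C + 1)); first by rewrite mulr_ge0// addr_ge0.
move=> X Y hX hY.
have NN : 0 <= N X * N Y by rewrite mulr_ge0// sqrtr_ge0.
have E s : `|Q (profile_of s X) (profile_of s Y)| <= (C + 1) * (N X * N Y).
  apply: norm_le_of_sqr => //.
  have := hC _ _ (profile_of_L2 s X) (profile_of_L2 s Y) (profile_of_poincare l01 l23 s hX) (profile_of_poincare l01 l23 s hY).
  move=> /le_trans; apply; apply: ler_wpM2l => //; rewrite exprMn.
  by apply: ler_pM; rewrite ?profile_energy_ge0 ?profile_of_energy_le.
rewrite /state_form; apply: (le_trans (ler_normD _ _)).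
by have := E false; have := E true; lra.
Qed.

(** The real estimate applied to the real and the imaginary part, through the
    continuous representatives. *)
Lemma lyapunov_domA : exists a KD KZ C : R, forall U : state, domA U ->
  state_form (lyapunov l0 l1 l2 l3 a KD KZ) (opA U) U +
  state_form (lyapunov l0 l1 l2 l3 a KD KZ) U (opA U) <=
  - (1 / 4) * N U ^+ 2 + C * (kineticV l1 l2 (profile_of false U) +
    kineticV l1 l2 (profile_of true U)).
Proof.
have [a [KD [KZ [C hC]]]] := lyapunov_le beta l01 l12 l23.
exists a, KD, KZ, C => U dU.
have bL := bilinear_bounded_lyapunov l0 l3 l12 a KD KZ.
have bE := bilinear_bounded_energy l0 l1 l2 l3.
have E s : lyapunov l0 l1 l2 l3 a KD KZ (profile_of s (opA U)) (profile_of s U) +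
     lyapunov l0 l1 l2 l3 a KD KZ (profile_of s U) (profile_of s (opA U)) <=
    - (1 / 4) * cE (profile_of s U) + C * kineticV l1 l2 (profile_of s U).
  have [gc [ec [f0 [f3 [v0 [w0 [w3 reg]]]]]]] := domA_regular l01 l12 l23 s dU.
  have gU := profile_of_L2 s U; have gA := profile_of_L2 s (opA U).
  have aa : profile_ae_eq l0 l1 l2 l3 (profile_of s (opA U)) (profile_of s (opA U)) by move=> n;
    apply: ae_ooW.
  rewrite -(bil_ae bL gA gA gc gU aa ec) -(bil_ae bL gc gU gA gA ec aa).
  rewrite -form_energy_diag -(bil_ae bE gc gU gc gU ec ec) form_energy_diag.
  have -> : kineticV l1 l2 (profile_of s U) = kineticV l1 l2 (crepr_profile s U).
    apply: integral_oo_ae.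
    - by apply: measurable_funX; case: (gU Vt).
    - by apply: measurable_funX; case: (gc Vt).
    - by apply: ae_ooS (ec Vt) => x _ ->.
  by rewrite addrC; exact: hC reg.
have := E false; have := E true.
by rewrite calHnorm_sqr /state_form; lra.
Qed.

Lemma state_form_energy (U V : state) : state_form (form_energy l0 l1 l2 l3) U V = Re (calHdot U V).
Proof. by rewrite calHdot_Re. Qed.

Lemma form_energy_sym (c d : @profile R) : form_energy l0 l1 l2 l3 c d = form_energy l0 l1 l2 l3 d c.
Proof.
have sw a b (f g : R -> R) : integral_oo a b (fun x => f x * g x) =
  integral_oo a b (fun x => g x * f x).
  by apply: integral_oo_ext => x _; rewrite mulrC.
by rewrite /form_energy (sw l0 l1 (c Uxx)) (sw l1 l2 (c Vx)) (sw l2 l3 (c Wxx))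
  (sw l0 l1 (c Ut)) (sw l1 l2 (c Vt)) (sw l2 l3 (c Wt)).
Qed.

End LyapunovOnStates.

Theorem theorem4p6 (R : realType) (l0 l1 l2 l3 beta : R)
  (h01 : l0 < l1) (h12 : l1 < l2) (h23 : l2 < l3) (hbeta : 0 < beta)
  (S : R -> state l0 l1 l2 l3 -> state l0 l1 l2 l3)
  (hS : contraction_C0_semigroup calH calHnorm S)
  (hgen : generates calH calHnorm
            (domA 0 0 beta) (opA 0 0 beta) S) :
  exists C alpha : R, 0 < C /\ 0 < alpha /\
    forall U0 : state l0 l1 l2 l3, domA 0 0 beta U0 ->
      forall t : R, 0 <= t ->
        energy S U0 t <= C * expR (- alpha * t) * energy S U0 0.
Proof.
have [a [KD [KZ [C hL]]]] := @lyapunov_domA R l0 l1 l2 l3 beta h01 h12 h23.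
have bE := bilinear_bounded_energy l0 l1 l2 l3.
have bL := bilinear_bounded_lyapunov l0 l3 h12 a KD KZ.
have [M M0 hM] := state_form_bound h01 h23 bL.
(* K is large enough to make the form coercive and to let the damping absorb
   the kinetic energy of the string *)
pose K := M + 1 + `|C| / (2 * beta).
have K1 : M + 1 <= K by rewrite lerDl divr_ge0// mulr_ge0// ltW.
have K0 : 0 < K by apply: lt_le_trans K1; rewrite ltr_wpDl.
have KC : C <= 2 * beta * K.
  apply: (le_trans (ler_norm C)).
  have -> : `|C| = 2 * beta * (`|C| / (2 * beta)) by field; rewrite gt_eqF.
  by rewrite ler_pM2l ?mulr_gt0// lerDr addr_ge0.
pose Q (c d : @profile R) := K * form_energy l0 l1 l2 l3 c d + lyapunov l0 l1 l2 l3 a KD KZ c d.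
have bQ : bilinear_bounded l0 l1 l2 l3 Q := bilinear_boundedD (bilinear_boundedZ K bE) bL.
pose b := @state_form R l0 l1 l2 l3 Q.
have [B B0 hB] := state_form_bound h01 h23 bQ.
have bdiag (U : state l0 l1 l2 l3) : b U U = K * calHnorm U ^+ 2 +
    state_form (lyapunov l0 l1 l2 l3 a KD KZ) U U.
  by rewrite /b /state_form /Q !form_energy_diag calHnorm_sqr; ring.
have low (U : state l0 l1 l2 l3) : calH U -> calHnorm U ^+ 2 <= b U U.
  move=> hU; rewrite bdiag; have := hM U U hU hU; rewrite -expr2 ler_norml => /andP[h _].
  have := ler_wpM2r (sqr_ge0 (calHnorm U)) K1.
  by lra.
have up (U : state l0 l1 l2 l3) : calH U -> b U U <= (K + M) * calHnorm U ^+ 2.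
  move=> hU; rewrite bdiag; have := hM U U hU hU; rewrite -expr2 ler_norml => /andP[_ h].
  by lra.
have KM0 : 0 < K + M by rewrite ltr_wpDr.
pose kap := (4 * (K + M))^-1.
have kap0 : 0 < kap by rewrite invr_gt0 mulr_gt0.
have decay U0 : domA 0 0 beta U0 -> forall t, 0 <= t ->
    b (S t U0) (S t U0) <= expR (- kap * t) * b U0 U0.
  move=> dU t t0.
  apply: (@semigroup_decay R _ calH calHnorm S b B kap hS _ _ _ _ B0 hB _ kap0 _ t U0 (opA 0 0 beta U0) t0).
  - by move=> x y k; exact: HH_comb.
  - by move=> x; exact: sqrtr_ge0.
  - by move=> x y z k; exact: state_form_left.
  - by move=> x y z k; exact: state_form_right.
  - by move=> x hx; apply: le_trans (low x hx); exact: sqr_ge0.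
  - move=> x y /hgen[dx ->].
    have hx : calH x by case: dx.
    have hl := hL x dx.
    set k := kineticV l1 l2 (profile_of false x) + kineticV l1 l2 (profile_of true x) in hl.
    have k0 : 0 <= k by rewrite addr_ge0//; exact: integral_sqr_ge0.
    have hE : state_form (form_energy l0 l1 l2 l3) (opA 0 0 beta x) x = - beta * k.
      by rewrite state_form_energy (domA_dissipation dx).
    have hE' : state_form (form_energy l0 l1 l2 l3) x (opA 0 0 beta x) = - beta * k.
      by rewrite -hE /state_form !(@form_energy_sym _ l0 l1 l2 l3 (profile_of _ x)).
    have -> : b (opA 0 0 beta x) x + b x (opA 0 0 beta x) =
      K * (state_form (form_energy l0 l1 l2 l3) (opA 0 0 beta x) x
           + state_form (form_energy l0 l1 l2 l3) x (opA 0 0 beta x))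
      + (state_form (lyapunov l0 l1 l2 l3 a KD KZ) (opA 0 0 beta x) x
         + state_form (lyapunov l0 l1 l2 l3 a KD KZ) x (opA 0 0 beta x)).
      by rewrite /b /state_form /Q; ring.
    rewrite hE hE'.
    have h1 := ler_wpM2r k0 KC.
    have h2 : kap * b x x <= 1 / 4 * calHnorm x ^+ 2.
      apply: (le_trans (ler_wpM2l (ltW kap0) (up x hx))).
      rewrite mulrA; apply: ler_wpM2r; first exact: sqr_ge0.
      by rewrite le_eqVlt; apply/orP; left; apply/eqP; rewrite /kap; field; rewrite gt_eqF.
    by lra.
  - by apply/hgen.
exists (K + M), kap; split => //; split => // U0 dU t t0.
have hU : calH U0 by case: dU.
rewrite /energy (C0_zero hS hU) [leRHS]mulrCA; apply: ler_wpM2l; first by rewrite invr_ge0.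
apply: (le_trans (low _ (C0_stable hS t0 hU))); apply: (le_trans (decay _ dU _ t0)).
rewrite (mulrC (K + M)) -mulrA; apply: ler_wpM2l; first exact: expR_ge0.
exact: up.
Qed.
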